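(* Let $n_1=n_2=1$, $\theta=1$, and $\Omega=I_1\times I_2$ a bounded open box. Let $u\in L^1_{loc}(\Omega)$ with $\mathcal{E}(u)<\infty$. Then $\mu[u]=\partial_1\partial_2u$ is a finite Radon measure and there exists a Borel set $A\subset\Omega$ such that $\mathcal{H}^1\llcorner A$ is $\sigma$-finite and $\mu[u]=\mu[u]\llcorner A$.
   Context: Setting: $\theta_1,\theta_2>0$ with $\theta_1+\theta_2=\theta$; $\rho\in L^1(\mathbb{R}^2,\mathbb{R}_+)$ radial, supported in $B_1$, $\int\rho=1$, $\rho_\varepsilon(z)=\varepsilon^{-2}\rho(z/\varepsilon)$. $Du(x,z):=u(x+z)-u(x)$; for $z=(z_1,z_2)$, $z_1$ stands for $(z_1,0)$ and $z_2$ for $(0,z_2)$. $I_l^\varepsilon=\{s\in I_l:\operatorname{dist}(s,\mathbb{R}\setminus I_l)>\varepsilon\}$, $\Omega^\varepsilon=I_1^\varepsilon\times I_2^\varepsilon$, $\mathcal{E}_\varepsilon(u)=\int_{\mathbb{R}^2}\int_{\Omega^\varepsilon}|z|^{-2}|Du(x,z_1)|^{\theta_1}|Du(x,z_2)|^{\theta_2}\,dx\,\rho_\varepsilon(z)dz$, $\mathcal{E}(u)=\liminf_{\varepsilon\downarrow0}\mathcal{E}_\varepsilon(u)$. $\mu[u]=\partial_1\partial_2u$ in the sense of distributions. *)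

(* Defs.v *)
From HB Require Import structures.
From mathcomp Require Import all_boot all_order all_algebra.
From mathcomp Require Import all_classical all_reals all_analysis.
Set Implicit Arguments. Unset Strict Implicit. Unset Printing Implicit Defensive.
Import Order.TTheory GRing.Theory Num.Theory.
Import numFieldNormedType.Exports.
Local Open Scope classical_set_scope.
Local Open Scope ring_scope.

Section Defs.
Context {R : realType}.

(* R^2 as a measurable space: product of the Borel sigma-algebras of R,
   i.e. the Borel sigma-algebra of R^2. *)
Definition T2 := (measurableTypeR R * measurableTypeR R)%type.

Definition leb2 : set T2 -> \bar R :=
  (@lebesgue_measure R \x @lebesgue_measure R)%E.

Definition enorm (z : R * R) : R := Num.sqrt (z.1 ^+ 2 + z.2 ^+ 2).
Definition edist (p q : R * R) : R := enorm (p.1 - q.1, p.2 - q.2).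

Definition box (a1 b1 a2 b2 : R) : set (R * R) :=
  `]a1, b1[ `*` `]a2, b2[.

(* I_l^eps = {s in ]a,b[ : dist(s, R \ ]a,b[) > eps} = ]a+eps, b-eps[ *)
Definition Ieps (a b eps : R) : set R := [set s | a < s < b /\ eps < Num.min (s - a) (b - s)].
Definition box_eps (a1 b1 a2 b2 eps : R) : set (R * R) :=
  Ieps a1 b1 eps `*` Ieps a2 b2 eps.

Definition rho_eps (rho : R * R -> R) (eps : R) (z : R * R) : R :=
  eps ^-2 * rho (z.1 / eps, z.2 / eps).

Definition Du1 (u : R * R -> R) (x z : R * R) : R := u (x.1 + z.1, x.2) - u x.
Definition Du2 (u : R * R -> R) (x z : R * R) : R := u (x.1, x.2 + z.2) - u x.

Definition Eeps (th1 th2 : R) (rho : R * R -> R) (a1 b1 a2 b2 : R)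
  (u : R * R -> R) (eps : R) : \bar R :=
  (\int[leb2]_(z in [set: T2])
     ((\int[leb2]_(x in (box_eps a1 b1 a2 b2 eps : set T2))
         ((enorm z) ^-2 * (`|Du1 u x z| `^ th1) * (`|Du2 u x z| `^ th2))%:E)
      * (rho_eps rho eps z)%:E))%E.

Definition Eliminf (th1 th2 : R) (rho : R * R -> R) (a1 b1 a2 b2 : R)
  (u : R * R -> R) : \bar R :=
  ereal_sup [set ereal_inf [set Eeps th1 th2 rho a1 b1 a2 b2 u eps
                              | eps in [set e : R | 0 < e < d]]
            | d in [set d : R | 0 < d]].

Definition L1loc (O : set (R * R)) (u : R * R -> R) : Prop :=
  measurable_fun (O : set T2) (u : T2 -> R) /\
  forall K : set (R * R), compact K -> K `<=` O ->
    leb2.-integrable (K : set T2) (EFin \o (u : T2 -> R)).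

Definition dir (b : bool) : R * R := if b then (1, 0) else (0, 1).

Fixpoint iter_pd (s : seq bool) (f : R * R -> R) : R * R -> R :=
  match s with
  | [::] => f
  | b :: s' => fun p => derive (iter_pd s' f) p (dir b)
  end.

Definition smooth (f : R * R -> R) : Prop :=
  forall s : seq bool, continuous (iter_pd s f) /\
    forall (b : bool) (p : R * R), derivable (iter_pd s f) p (dir b).

Definition test_fun (O : set (R * R)) (phi : R * R -> R) : Prop :=
  smooth phi /\
  exists K : set (R * R), [/\ compact K, K `<=` O & forall p, ~ K p -> phi p = 0].

Definition d12 (phi : R * R -> R) : R * R -> R := iter_pd [:: true; false] phi.

Definition diamE (C : set (R * R)) : \bar R :=
  ereal_sup ([set 0%E] `|` [set (edist pq.1 pq.2)%:E | pq in C `*` C]).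

Definition H1delta (delta : R) (E : set (R * R)) : \bar R :=
  ereal_inf [set (\sum_(0 <= k <oo) diamE (F k))%E
            | F in [set F : nat -> set (R * R) |
                      E `<=` \bigcup_k F k /\ forall k, (diamE (F k) <= delta%:E)%E]].

Definition H1 (E : set (R * R)) : \bar R :=
  ereal_sup [set H1delta delta E | delta in [set d : R | 0 < d]].

Definition H1_restr_sigma_finite (A : set (R * R)) : Prop :=
  exists B : nat -> set T2,
    [/\ forall k, measurable (B k), \bigcup_k B k = setT &
        forall k, (H1 (A `&` (B k : set (R * R))) < +oo)%E].

End Defs.

(* Main.v *)
Require Import Defs.
From HB Require Import structures.
From mathcomp Require Import all_boot all_order all_algebra.
From mathcomp Require Import all_classical all_reals all_analysis.
From mathcomp Require Import measurable_realfun measurable_fun_approximation borel_hierarchy lebesgue_integral_fubini.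
From mathcomp Require Import ring lra.
Set Implicit Arguments. Unset Strict Implicit. Unset Printing Implicit Defensive.
Import Order.TTheory GRing.Theory Num.Theory.
Import numFieldNormedType.Exports.
Local Open Scope classical_set_scope.
Local Open Scope ring_scope.

(** The mixed difference D2 u(x, z) is bounded by the sum of |Du1|^th1 |Du2|^th2 over
    the four corners of the cell x + ]0, z]. Averaging the energy against rho gives
    increments z -> 0 in a cone around the diagonal for which the integral of
    |D2 u(., z)| / (z1 z2) stays bounded; a weak limit of these densities is a signed
    measure n1 - n2, which represents d1 d2 u, and D2 u(x, z) is the n1 - n2 mass of
    x + ]0, z] for almost every x. With n1, n2 mutually singular, let A be the set
    where lam = n1 + n2 has positive upper density lam(Q) / side(Q) on dyadic squares;
    it is a countable union of sets of finite H1 measure. If n1 charged the complement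
    of A, then on some rectangle n1 restricted to the points of small density would
    dominate n2. There every cell creates a small positive jump of both p = Du1 u and
    q = Du2 u across it; the integrals of the truncations of these jumps at level tau
    telescope to a boundary term of order tau |z|, so that most of the mass lies in
    cells where |p|, |q| > tau. As each cell carries a mass o(|z|), such cells are so
    numerous that the energy cannot be O(|z|^2). *)

(** The energy bounds single increments z, while the measure arises only in the limit. Testing the
    weak limit with trapezoidal kernels instead of smooth functions identifies D2 u(., t) with cell
    masses for every small t, so the identity can be inserted at any good increment z. Radial
    symmetry of rho lets one z be good for its four sign patterns at once, as the four corners of a
    cell require. The conclusion is a balance of powers. With r = |z|, density level s^2 and
    truncation level s r, a cell carries at most 8 s^2 r and the boundary terms are of order s r^2.
    Points where both jumps exceed s r fill an area at most M r^2 / (s r), hence contribute at most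
    8 s M r^2 to the integral of the cell masses. Division by z1 z2 >= c r^2 leaves O(s), with s
    arbitrary. The mass of n2 is paid once for each of the two truncated jumps, so the outcome is n1
    <= 2 n2 off A; on a set that carries n1 and is null for n2, this gives n1 = 0. The same argument
    for -u treats n2. *)

Local Notation finmeas R := {finite_measure set (@T2 R) -> \bar R}.

(** * Lebesgue measure on the plane *)

(** [leb2] is a bare set function; the measure structure of the product is transferred to it by
    conversion. *)
Definition leb2_measure (R : realType) : {measure set (@T2 R) -> \bar R} :=
  ((@lebesgue_measure R) \x (@lebesgue_measure R))%E.

HB.instance Definition _ (R : realType) := isMeasure.Build _ _ _ (@leb2 R)
  (measure0 (leb2_measure R)) (measure_ge0 (leb2_measure R)) (@measure_semi_sigma_additive _ _ _ (leb2_measure R)).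

Lemma leb2X (R : realType) (A B : set (measurableTypeR R)) : measurable A -> measurable B ->
  @leb2 R (A `*` B) = (lebesgue_measure A * lebesgue_measure B)%E.
Proof. exact: product_measure1E. Qed.

Lemma leb2_sigma_finite (R : realType) : sigma_finite setT (@leb2 R).
Proof.
exists (fun k : nat => `] - k%:R, k%:R]%classic `*` `] - k%:R, k%:R]%classic).
  apply/seteqP; split => // -[x y] _.
  pose k := (Num.truncn `|x|%R + Num.truncn `|y|%R).+1.
  have hk (t : R) : (Num.truncn `|t|%R < k)%N -> t \in `]- k%:R, k%:R].
    move=> tk; have : `|t| < k%:R.
      by apply: lt_le_trans (truncnS_gt _) _; rewrite ler_nat.
    by rewrite in_itv/= ltr_norml => /andP[-> /ltW].
  by exists k => //; split; apply: hk; rewrite ltnS ?leq_addr ?leq_addl.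
move=> k; split; first exact: measurableX.
by rewrite leb2X// !lebesgue_measure_itv/=; case: ifP => _; rewrite ?mule0 ?ltry// -EFinD -EFinM ltry.
Qed.

HB.instance Definition _ (R : realType) := @Measure_isSigmaFinite.Build _ _ _ (@leb2 R)
  (leb2_sigma_finite R).

Section affine.
Context {R : realType}.
Notation leb := (@lebesgue_measure R).
Notation leb2 := (@leb2 R).
Notation T2 := (@T2 R).

Definition aff1 (c d : R) : measurableTypeR R -> measurableTypeR R := fun x => c * x + d.

Lemma measurable_aff1 c d : measurable_fun setT (aff1 c d).
Proof. by apply: measurable_funD => //; exact: measurable_funM. Qed.

HB.instance Definition _ c d := isMeasurableFun.Build _ _ _ _ _ (measurable_aff1 c d).

(** Uniqueness of Lebesgue measure: the image measure rescaled by c agrees with it on half-open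
    intervals. *)
Lemma leb_aff1_pos c d (A : set (measurableTypeR R)) : 0 < c -> measurable A ->
  leb (aff1 c d @^-1` A) = ((c^-1)%:E * leb A)%E.
Proof.
move=> c0 mA.
pose mu : {measure set (measurableTypeR R) -> \bar R} := mscale (NngNum (ltW c0)) (pushforward leb (aff1 c d)).
rewrite (@lebesgue_measure_unique R (mu (measurable_aff1 c d)) _ A mA).
  by rewrite /mu/= /mscale/= muleA -EFinM mulVf ?mul1e//; exact: lt0r_neq0.
move=> X -[[a b] _ <-]; rewrite /mu/=.
  rewrite /mscale/= /pushforward.
  rewrite [X in _ = (_ * lebesgue_measure X)%E](_ : _ = `](a - d) / c, (b - d) / c]%classic).
    rewrite !lebesgue_measure_itv/= !lte_fin ltr_pM2r ?invr_gt0// ltrD2r.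
    case: ifPn => ab; last by rewrite mule0.
    rewrite -!EFinB -EFinM; congr (_%:E); field; exact: lt0r_neq0.
  apply/seteqP; split=> x /=; rewrite !in_itv/= /aff1 -ltrBlDr -lerBrDr ltr_pdivrMr// ler_pdivlMr// ![x * c]mulrC//.
Qed.

Lemma leb_aff1 c d (A : set (measurableTypeR R)) : c != 0 -> measurable A ->
  leb (aff1 c d @^-1` A) = ((`|c|^-1)%:E * leb A)%E.
Proof.
move=> c0 mA; have [cp|cn|/eqP] := ltrgtP c 0; last by rewrite (negbTE c0).
- have -> : aff1 c d @^-1` A = (-%R : _ -> measurableTypeR R) @^-1` (aff1 (- c) d @^-1` A).
    by apply/seteqP; split=> x /=; rewrite /aff1 mulrNN.
  rewrite -[LHS]/(pushforward leb (-%R : _ -> measurableTypeR R) _) lebesgue_measureN; last first.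
    by rewrite -[X in measurable X]setTI; exact: measurable_aff1.
  by rewrite leb_aff1_pos ?oppr_gt0// ltr0_norm.
- by rewrite gtr0_norm// leb_aff1_pos.
Qed.

Definition aff2 (c d : R * R) : T2 -> T2 := fun x => (aff1 c.1 d.1 x.1, aff1 c.2 d.2 x.2).

Lemma measurable_aff2 c d : measurable_fun setT (aff2 c d).
Proof.
by apply: measurable_fun_pair => /=; apply: measurableT_comp => //; exact: measurable_aff1.
Qed.

HB.instance Definition _ c d := isMeasurableFun.Build _ _ _ _ _ (measurable_aff2 c d).

Lemma leb2_aff2 c d (A : set T2) : c.1 != 0 -> c.2 != 0 -> measurable A ->
  leb2 (aff2 c d @^-1` A) = ((`|c.1 * c.2|^-1)%:E * leb2 A)%E.
Proof.
move=> c1 c2 mA.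
have k0 : 0 <= `|c.1 * c.2| by [].
have hk : `|c.1 * c.2| != 0 by rewrite normr_eq0 mulf_neq0.
pose mu : {measure set T2 -> \bar R} := mscale (NngNum k0) (pushforward leb2 (aff2 c d)).
rewrite -[leb2 A]/((leb \x leb)%E A).
rewrite (@product_measure_unique _ _ _ _ _ leb leb (mu (measurable_aff2 c d)) _ A mA).
  by rewrite /mu/= /mscale/= muleA -EFinM mulVf ?mul1e//.
move=> X Y mX mY; rewrite /mu/=.
rewrite /mscale/= /pushforward.
  have -> : aff2 c d @^-1` (X `*` Y) = (aff1 c.1 d.1 @^-1` X) `*` (aff1 c.2 d.2 @^-1` Y) by [].
  have m1 : forall c d X, measurable X -> measurable (aff1 c d @^-1` X).
    by move=> c' d' X' mX'; rewrite -[X in measurable X]setTI; exact: measurable_aff1.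
  rewrite leb2X; [|exact: m1..].
rewrite !leb_aff1//; move: (lebesgue_measure X) (lebesgue_measure Y) => lX lY.
rewrite (_ : (`|c.1|^-1)%:E * lX * ((`|c.2|^-1)%:E * lY) = (`|c.1|^-1 * `|c.2|^-1)%:E * (lX * lY))%E; last first.
  by rewrite EFinM muleACA.
rewrite muleA -EFinM.
by rewrite -invfM -normrM divff ?mul1e.
Qed.

Lemma ge0_integral_aff2 c d (f : T2 -> \bar R) : c.1 != 0 -> c.2 != 0 ->
  measurable_fun setT f -> (forall x, 0 <= f x)%E ->
  (\int[leb2]_x f (aff2 c d x) = (`|c.1 * c.2|^-1)%:E * \int[leb2]_x f x)%E.
Proof.
move=> c1 c2 mf f0.
have k0 : 0 <= `|c.1 * c.2|^-1 by [].
have := @ge0_integral_pushforward _ _ _ _ _ (aff2 c d) (@measurable_aff2 c d) leb2 setT f measurableT mf.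
rewrite preimage_setT => <- //.
rewrite -(ge0_integral_mscale _ measurableT (NngNum k0))//.
by apply: eq_measure_integral => A mA _; rewrite /= /mscale/= /pushforward leb2_aff2.
Qed.

Lemma integral_trans2 d (f : T2 -> \bar R) :
  leb2.-integrable setT f ->
  (\int[leb2]_x f (x.1 + d.1, x.2 + d.2)%R = \int[leb2]_x f x)%E /\
  leb2.-integrable setT (fun x => f (x.1 + d.1, x.2 + d.2)).
Proof.
move=> intf.
have mf := measurable_int _ intf.
have e : (fun x : T2 => f (x.1 + d.1, x.2 + d.2)) = f \o aff2 (1, 1) d.
  by apply/funext => x; rewrite /= /aff2 /aff1/= !mul1r.
have mt : measurable_fun setT (f \o aff2 (1, 1) d).
  by apply: measurableT_comp => //; exact: measurable_aff2.
have intt : leb2.-integrable setT (f \o aff2 (1, 1) d).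
  apply/integrableP; split => //.
  have := @ge0_integral_aff2 (1, 1) d (fun x => `|f x|)%E; rewrite /= oner_eq0 => -> //.
    by rewrite mulr1 normr1 invr1 mul1e; case/integrableP : intf.
  by apply: measurableT_comp.
split; last by rewrite e.
rewrite e.
have := @integral_pushforward _ _ _ _ _ (aff2 (1,1) d) (@measurable_aff2 (1,1) d) leb2 setT f mf.
rewrite preimage_setT => /(_ intt measurableT) <-.
apply: eq_measure_integral => A mA _; rewrite /= /pushforward leb2_aff2//=.
by rewrite mulr1 normr1 invr1 mul1e.
Qed.

End affine.

(** * Dyadic squares *)

Section dyadic.
Context {R : realType}.
Notation T2 := (@T2 R).

(** Open half-lines generate the Borel sets of each factor, and preimages under the two projections
    generate the product. *)
Lemma measurable_T2_sub (S : set (set T2)) : sigma_algebra setT S ->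
  (forall x : R, S [set p | x < p.1]) -> (forall x : R, S [set p | x < p.2]) ->
  measurable `<=` S.
Proof.
move=> [S0 SC SU] S1 S2.
have gen (f : T2 -> R) : (forall x : R, S [set p | x < f p]) ->
    forall A : set (measurableTypeR R), measurable A -> S (f @^-1` A).
  move=> Sf A; rewrite [measurable A](_ : _ = <<s (@RGenOInfty.G R) >> A); last first.
    by have := RGenOInfty.measurableE R => /(congr1 (fun M => M A)) .
  move: A; apply: smallest_sub.
    split; first by rewrite /= preimage_set0.
      by move=> A /= SA; rewrite setTD preimage_setC -setTD; exact: SC.
    by move=> F SF /=; rewrite preimage_bigcup; exact: SU.
  move=> A [x ->] /=; rewrite (_ : _ @^-1` _ = [set p | x < f p])//.
  by apply/seteqP; split=> p /=; rewrite in_itv/= andbT.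
apply: smallest_sub; first by [].
move=> A [[B mB <-]|[B mB <-]]; rewrite setTI.
- exact: (gen fst).
- exact: (gen snd).
Qed.

Definition dlab (j : nat) (p : R * R) : int * int :=
  (Num.floor (2 ^+ j * p.1), Num.floor (2 ^+ j * p.2)).

Definition dsq (j : nat) (k : int * int) : set T2 := dlab j @^-1` [set k].

Lemma floor_double (x y : R) : Num.floor (2 * x) = Num.floor (2 * y) ->
  Num.floor x = Num.floor y.
Proof.
have h (s t : R) : Num.floor (2 * s) = Num.floor (2 * t) -> Num.floor s <= Num.floor t.
  move=> st; rewrite floor_ge_int -(@ler_pM2l _ 2)//.
  rewrite -(intrM _ 2) -floor_ge_int -st floor_ge_int intrM ler_pM2l//; exact: floor_le.
by move=> xy; apply/eqP; rewrite eq_le !h.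
Qed.

Lemma dlab_le i j p q : (i <= j)%N -> dlab j p = dlab j q -> dlab i p = dlab i q.
Proof.
move=> /subnK <-; elim: (j - i)%N => // n ih; rewrite addSn => -[h1 h2].
apply: ih; rewrite /dlab; congr (_, _); apply: floor_double; rewrite !mulrA -exprS//.
Qed.

Lemma dsqE j k : dsq j k =
  `[k.1%:~R / 2 ^+ j, (k.1 + 1)%:~R / 2 ^+ j[%classic `*` `[k.2%:~R / 2 ^+ j, (k.2 + 1)%:~R / 2 ^+ j[%classic.
Proof.
have h (x : R) m : (Num.floor (2 ^+ j * x) == m) = (x \in `[m%:~R / 2 ^+ j, (m + 1)%:~R / 2 ^+ j[).
  have j0 : 0 < 2 ^+ j :> R by rewrite exprn_gt0.
  by rewrite floor_eq in_itv/= ler_pdivrMr// ltr_pdivlMr// ![_ * x]mulrC.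
apply/seteqP; split => -[x y]; rewrite /dsq/dlab/=.
  by move=> <-/=; split; rewrite /= -h.
by case: k => k1 k2/= []; rewrite -!h => /eqP -> /eqP ->.
Qed.

Lemma measurable_dsq j k : measurable (dsq j k).
Proof. by rewrite dsqE; apply: measurableX. Qed.

(** All squares of a member have one level; two members are rewritten at their common finer level,
    which makes the family a ring. *)
Definition dfam : set (set T2) := [set A | exists j S, A = dlab j @^-1` S].

Lemma preimage_dlabE j S : dlab j @^-1` S = \bigcup_(k in S) dsq j k.
Proof.
apply/seteqP; split => [p Sp|p [k Sk]]; first by exists (dlab j p).
by rewrite /dsq/= => ->.
Qed.

Lemma measurable_preimage_dlab j S : measurable (dlab j @^-1` S).
Proof.
rewrite preimage_dlabE bigcup_mkcond; apply: countable_bigcupT_measurable => //.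
by move=> k; case: ifP => // _; exact: measurable_dsq.
Qed.

(** Enumerates the fibres over S along the countable coding of labels. An index that codes no label
    of S gives the empty set, so the pieces stay disjoint. *)
Definition pfiber d (T : measurableType d) (K : countType) (lab : T -> K) (S : set K) (n : nat) : set T :=
  if @pickle_inv K n is Some k then
     if k \in S then lab @^-1` [set k] else set0 else set0.

Lemma measurable_pfiber d (T : measurableType d) (K : countType) (lab : T -> K) (S : set K) n :
  (forall k, measurable (lab @^-1` [set k])) -> measurable (pfiber lab S n).
Proof. by move=> mlab; rewrite /pfiber; case: pickle_inv => // k; case: ifP. Qed.

Lemma bigcup_pfiber d (T : measurableType d) (K : countType) (lab : T -> K) (S : set K) :
  \bigcup_n pfiber lab S n = lab @^-1` S.
Proof.
apply/seteqP; split => [p [n _]|p Sp].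
  by rewrite /pfiber; case: pickle_inv => // k; case: ifP => // /set_mem Sk /= ->.
by exists (pickle (lab p)) => //; rewrite /pfiber pickleK_inv mem_set.
Qed.

Lemma trivIset_pfiber d (T : measurableType d) (K : countType) (lab : T -> K) (S : set K) :
  trivIset setT (pfiber lab S).
Proof.
apply/trivIsetP => m n _ _ mn; rewrite /pfiber.
have := @pickle_invK K m; have := @pickle_invK K n.
case: (pickle_inv m) => [k|]; last by rewrite set0I.
case: (pickle_inv n) => [l|]; last by rewrite setI0.
case: ifP => _; last by rewrite set0I.
case: ifP => _; last by rewrite setI0.
move=> /= en em; apply/seteqP; split => // p /= [pk pl].
by move: mn; rewrite -en -em -pk -pl eqxx.
Qed.

Lemma measure_fibers d (T : measurableType d) (K : countType) (lab : T -> K)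
    (mu : {measure set T -> \bar R}) (S : set K) :
  (forall k, measurable (lab @^-1` [set k])) ->
  mu (lab @^-1` S) = (\sum_(n <oo) mu (pfiber lab S n))%E.
Proof.
move=> mlab; rewrite -bigcup_pfiber measure_bigcup.
- by apply: eq_eseriesl => n; rewrite in_setT.
- by move=> n _; exact: measurable_pfiber.
- exact: trivIset_pfiber.
Qed.

Lemma setring_dfam : setring dfam.
Proof.
have both A B : dfam A -> dfam B ->
    exists j S S', A = dlab j @^-1` S /\ B = dlab j @^-1` S'.
  move=> [i [S ->]] [j [S' ->]].
  have lift k l U : (k <= l)%N -> dlab k @^-1` U = dlab l @^-1` (dlab l @` (dlab k @^-1` U)).
    move=> kl; apply/seteqP; split => [p Up|p [q /= Uq]]; first by exists p.
    by move=> /(dlab_le kl); rewrite /= => <-.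
  by exists (maxn i j), (dlab (maxn i j) @` (dlab i @^-1` S)),
    (dlab (maxn i j) @` (dlab j @^-1` S')); split; apply: lift; rewrite ?leq_maxl ?leq_maxr.
split; first by exists 0%N, set0; rewrite preimage_set0.
- move=> A B fA fB; have [j [S [S' [-> ->]]]] := both _ _ fA fB.
  by exists j, (S `|` S').
- move=> A B fA fB; have [j [S [S' [-> ->]]]] := both _ _ fA fB.
  by exists j, (S `\` S').
Qed.

(** If f p > x, then 2^j (f p - x) > 1 for some j, and the integer part of 2^j f p already exceeds
    2^j x. A half-plane is thus a countable union of dyadic sets. *)
Lemma dfam_strip (f : T2 -> R) (x : R) (lab : nat -> (int * int) -> int) :
  (forall j p, lab j (dlab j p) = Num.floor (2 ^+ j * f p)) ->
  <<sr dfam>> [set p | x < f p].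
Proof.
move=> labE.
have -> : [set p | x < f p] = \bigcup_j (dlab j @^-1` [set k | 2 ^+ j * x < (lab j k)%:~R]).
  apply/seteqP; split => [p /= xp|p [j _] /=].
    have fx : 0 < f p - x by rewrite subr_gt0.
    pose j := Num.truncn ((f p - x)^-1).
    have hj : (f p - x)^-1 < 2 ^+ j.+1.
      apply: lt_le_trans (truncnS_gt _) _; rewrite -natrX ler_nat; exact/ltnW/ltn_expl.
    exists j.+1 => //=; rewrite labE.
    have := floorD1_gt (2 ^+ j.+1 * f p); rewrite intrD.
    move: hj; rewrite -(ltr_pM2l fx) divff ?gt_eqF// => h1 h2.
    have : 2 ^+ j.+1 * x + 1 < 2 ^+ j.+1 * f p; last by move: h2 => /=; lra.
    by move: h1; nra.
  rewrite labE => h; have := floor_le (2 ^+ j * f p) => /(lt_le_trans h).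
  by rewrite ltr_pM2l// exprn_gt0.
have [_ _ U] := smallest_sigma_ring dfam.
by apply: U => j; apply: sub_g_sigma_ring; exists j; eexists.
Qed.

Lemma measurable_sub_dfam : measurable `<=` <<sr dfam>>.
Proof.
have [S0 SD SU] := smallest_sigma_ring dfam.
apply: measurable_T2_sub.
- split => // A SA; apply: SD => //.
  by apply: sub_g_sigma_ring; exists 0%N, setT; rewrite preimage_setT.
- by move=> x; apply: (@dfam_strip fst x (fun=> fst)).
- by move=> x; apply: (@dfam_strip snd x (fun=> snd)).
Qed.

(** Monotone class argument on the ring of dyadic sets; finite total masses let the inequality pass
    to decreasing intersections. *)
Lemma measure_le_dsq (a b : {measure set T2 -> \bar R}) :
  (a setT < +oo)%E -> (b setT < +oo)%E ->
  (forall j k, (a (dsq j k) <= b (dsq j k))%E) ->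
  forall A, measurable A -> (a A <= b A)%E.
Proof.
move=> afin bfin ab.
have fin (c : {measure set T2 -> \bar R}) A : (c setT < +oo)%E -> measurable A -> (c A < +oo)%E.
  by move=> cT mA; apply: le_lt_trans cT; apply: le_measure; rewrite ?inE.
suff : <<M dfam>> `<=` [set A | measurable A /\ (a A <= b A)%E].
  move=> h A mA; have [] // := h A.
  by rewrite (g_monotone_g_sigma_ring setring_dfam); exact: measurable_sub_dfam.
apply: smallest_sub.
  split => [F ndF SF|F niF SF].
    have mF i : measurable (F i) by have [] := SF i.
    have mUF : measurable (\bigcup_n F n) by exact: bigcupT_measurable.
    split => //; apply: lee_cvg_to (nondecreasing_cvg_mu mF mUF ndF) (nondecreasing_cvg_mu mF mUF ndF) _.
    by apply: nearW => n /=; have [] := SF n.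
  have mF i : measurable (F i) by have [] := SF i.
  have mIF : measurable (\bigcap_n F n) by exact: bigcapT_measurable.
  split => //; apply: lee_cvg_to (nonincreasing_cvg_mu (fin a _ afin (mF _)) mF mIF niF) (nonincreasing_cvg_mu (fin b _ bfin (mF _)) mF mIF niF) _.
  by apply: nearW => n /=; have [] := SF n.
move=> _ [j [S ->]]; split; first exact: measurable_preimage_dlab.
have mfib k : measurable (dlab j @^-1` [set k]) by exact: measurable_dsq.
rewrite /= (@measure_fibers _ T2 _ (dlab j) a _ mfib) (@measure_fibers _ T2 _ (dlab j) b _ mfib); apply: lee_nneseries => // n _.
rewrite /pfiber; case: pickle_inv => [k|]; last by rewrite !measure0.
by case: ifP => _; [exact: ab|rewrite !measure0].
Qed.

End dyadic.

(** * Hausdorff measure of sets of large dyadic density *)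

Section hausdorff.
Context {R : realType}.
Notation T2 := (@T2 R).

Lemma enorm_le (a b r : R) : 0 <= r -> `|a| <= r -> `|b| <= r -> enorm (a, b) <= 2 * r.
Proof.
move=> r0 ar br; rewrite /enorm/= -(@ger0_norm _ (2 * r)); last by rewrite mulr_ge0.
rewrite -sqrtr_sqr ler_sqrt ?sqr_ge0//.
rewrite -(real_normK (num_real a)) -(real_normK (num_real b)).
have : `|a| ^+ 2 <= r ^+ 2 by rewrite lerXn2r// nnegrE.
have : `|b| ^+ 2 <= r ^+ 2 by rewrite lerXn2r// nnegrE.
rewrite exprMn; have := sqr_ge0 r; lra.
Qed.

Lemma diamE_le (C : set (R * R)) (r : R) : 0 <= r ->
  (forall p q, C p -> C q -> `|p.1 - q.1| <= r /\ `|p.2 - q.2| <= r) ->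
  (diamE C <= (2 * r)%:E)%E.
Proof.
move=> r0 h; apply: ge_ereal_sup => _ [->|[[p q] [/= Cp Cq] <-]].
  by rewrite lee_fin mulr_ge0.
by rewrite lee_fin; have [? ?] := h _ _ Cp Cq; exact: enorm_le.
Qed.

Lemma diamE_ge0 (C : set (R * R)) : (0 <= diamE C)%E.
Proof. by apply: ereal_sup_ubound; left. Qed.

Lemma diamE0 : diamE (set0 : set (R * R)) = 0%E.
Proof.
apply/eqP; rewrite eq_le diamE_ge0 andbT.
have := @diamE_le set0 0 (lexx 0); rewrite mulr0; apply.
by move=> p q [].
Qed.

Lemma H1_set0 : (H1 (set0 : set (R * R)) < +oo)%E.
Proof.
apply: (@le_lt_trans _ _ 0%E) => //; apply: ge_ereal_sup => _ [d d0 <-].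
apply: ereal_inf_lbound; exists (fun=> set0); last first.
  by apply: eseries0 => n _ _; rewrite diamE0.
by split => // n; rewrite diamE0 lee_fin ltW.
Qed.

Lemma dsq_dist j k (p q : R * R) : dsq j k p -> dsq j k q ->
  `|p.1 - q.1| <= 2 ^- j /\ `|p.2 - q.2| <= 2 ^- j.
Proof.
have h (x y : R) (m : int) : Num.floor (2 ^+ j * x) = m -> Num.floor (2 ^+ j * y) = m ->
    x - y <= 2 ^- j.
  have j0 : 0 < 2 ^+ j :> R by rewrite exprn_gt0.
  move=> hx hy; rewrite -(ler_pM2l j0) divff ?gt_eqF// mulrBr.
  have := floor_le (2 ^+ j * y); have := floorD1_gt (2 ^+ j * x).
  by rewrite hx hy intrD; lra.
case: k => k1 k2; rewrite /dsq/dlab/= => -[p1 p2] [q1 q2].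
split; rewrite ler_norml lerNl opprB; apply/andP; split.
- exact: h q1 p1.
- exact: h p1 q1.
- exact: h q2 p2.
- exact: h p2 q2.
Qed.

Variable lam : {measure set T2 -> \bar R}.
Hypothesis lam_fin : (lam setT < +oo)%E.

Definition heavy (c : R) (j : nat) (p : R * R) : Prop :=
  ((2 ^- j * c)%:E < lam (dsq j (dlab j p)))%E.

Definition upper_dens (c : R) : set T2 :=
  [set p | forall J : nat, exists2 j, (J <= j)%N & heavy c j p].

Lemma measurable_heavy c j : measurable [set p : T2 | heavy c j p].
Proof.
rewrite (_ : [set p : T2 | _] = dlab j @^-1` [set k | ((2 ^- j * c)%:E < lam (dsq j k))%E])//.
exact: measurable_preimage_dlab.
Qed.

Lemma measurable_upper_dens c : measurable (upper_dens c).
Proof.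
rewrite (_ : upper_dens c = \bigcap_J \bigcup_(j in [set j | (J <= j)%N]) [set p | heavy c j p]).
  apply: bigcapT_measurable => J; apply: bigcup_measurable => j _; exact: measurable_heavy.
apply/seteqP; split => [p h J _|p h J].
  by have [j Jj hj] := h J; exists j.
by have [j Jj hj] := h J I; exists j.
Qed.

(** A heavy square has diameter at most 2 side(Q) < (2 / c) lam(Q). Disjoint heavy squares covering
    A have total diameter at most (2 / c) lam(setT), whatever the scale. *)
Lemma H1_upper_dens (c : R) (A : set (R * R)) : 0 < c -> A `<=` upper_dens c ->
  (H1 A < +oo)%E.
Proof.
move=> c0 Ac.
have c20 : 0 <= 2 / c by rewrite divr_ge0// ltW.
apply: (@le_lt_trans _ _ ((2 / c)%:E * lam setT)%E); last first.
  by rewrite lte_mul_pinfty.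
apply: ge_ereal_sup => _ [d d0 <-].
(* Squares of level above J have diameter at most d. *)
pose J := Num.truncn (2 / d).
have J2 j : (J.+1 <= j)%N -> 2 * 2 ^- j <= d.
  move=> Jj; rewrite ler_pdivrMr ?exprn_gt0// -ler_pdivrMl// mulrC.
  apply/ltW/(lt_le_trans (truncnS_gt _)); rewrite -natrX ler_nat.
  exact/ltnW/(leq_ltn_trans Jj)/ltn_expl.
(* Maximal heavy dyadic squares are disjoint, so no Vitali covering is needed. *)
pose F m : set T2 := if @pickle_inv (nat * (int * int))%type m is Some (j, k) then
  [set p | [/\ (J.+1 <= j)%N, dlab j p = k, heavy c j p &
     forall i, (J.+1 <= i < j)%N -> ~ heavy c i p]] else set0.
have FE m : F m = set0 \/ exists j k, [/\ F m = dsq j k, (J.+1 <= j)%N &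
    ((2 ^- j * c)%:E < lam (dsq j k))%E].
  rewrite /F; case: pickle_inv => [[j k]|]; last by left.
  have [->|/set0P[p [Jj pk hp np]]] := eqVneq [set p | [/\ (J < j)%N, dlab j p = k, heavy c j p & forall i, (J < i < j)%N -> ~ heavy c i p]] set0.
    by left.
  right; exists j, k; split => //; last by move: hp; rewrite /heavy pk.
  apply/seteqP; split => [q [_ qk _ _]//|q qk]; split => //.
    by move: hp; rewrite /heavy pk qk.
  (* Heaviness at a coarser level i depends only on the label at that level, which all points of a
     square of level j share. *)
  move=> i /[dup] /andP[_ ij] /np; rewrite /heavy.
  by rewrite (dlab_le (ltnW ij) (_ : dlab j p = dlab j q)) // pk qk.
have mF m : measurable (F m).
  by have [->//|[j [k [-> _ _]]]] := FE m; exact: measurable_dsq.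
have tF : trivIset setT F.
  apply/trivIsetP => m n _ _ mn; rewrite /F.
  have := @pickle_invK (nat * (int * int))%type m; have := @pickle_invK (nat * (int * int))%type n.
  case: (pickle_inv m) => [[j k]|]; last by rewrite set0I.
  case: (pickle_inv n) => [[j' k']|]; last by rewrite setI0.
  move=> /= en em; apply/seteqP; split => // p [[J1 pk h1 n1] [J2' pk' h2 n2]].
  have ejj : j = j'.
    apply/eqP; rewrite eqn_leq; apply/andP; split; rewrite leqNgt; apply/negP => ij.
      by apply: (n1 j'); rewrite ?J2'.
    by apply: (n2 j); rewrite ?J1.
  by move: mn; rewrite -en -em -pk -pk' ejj eqxx.
have Fcov : A `<=` \bigcup_m F m.
  move=> p /Ac h.
  have exj : exists j, (J.+1 <= j)%N && `[< heavy c j p >].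
    by have [j Jj hj] := h J.+1; exists j; rewrite Jj; apply/asboolP.
  pose j := ex_minn exj.
  exists (pickle (j, dlab j p)) => //; rewrite /F pickleK_inv.
  rewrite /j; case: ex_minnP => {}j /andP[Jj /asboolP hj] jmin; split => //.
  move=> i /andP[Ji ij] hi; have := jmin i; rewrite Ji/= => /(_ (asboolT hi)).
  by rewrite leqNgt ij.
apply: (@le_trans _ _ (\sum_(0 <= k <oo) diamE (F k))%E).
  apply: ereal_inf_lbound; exists F => //; split => // m.
  have [->|[j [k [-> Jj _]]]] := FE m; first by rewrite diamE0 lee_fin ltW.
  apply: le_trans (diamE_le _ (@dsq_dist j k)) _; first by rewrite invr_ge0 exprn_ge0.
  by rewrite lee_fin J2.
apply: (@le_trans _ _ (\sum_(0 <= k <oo) ((2 / c)%:E * lam (F k)))%E).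
  apply: lee_nneseries => [m _ _|m _]; first exact: diamE_ge0.
  have [->|[j [k [-> Jj hv]]]] := FE m; first by rewrite diamE0 measure0 mule0.
  apply: le_trans (diamE_le _ (@dsq_dist j k)) _; first by rewrite invr_ge0 exprn_ge0.
  apply: (@le_trans _ _ ((2 / c)%:E * (2 ^- j * c)%:E)%E).
    rewrite -EFinM lee_fin le_eqVlt; apply/orP; left; apply/eqP; field.
    by rewrite ?gt_eqF// ?exprn_gt0.
  by rewrite lee_pmul// ?lee_fin ?mulr_ge0 ?invr_ge0 ?exprn_ge0// ltW.
rewrite nneseriesZl//; apply: lee_wpmul2l; first by rewrite lee_fin.
have := @measure_bigcup _ _ _ lam setT F (fun i _ => mF i) tF.
under eq_eseriesl do rewrite in_setT.
by move=> <-; apply: le_measure; rewrite ?inE//; exact: bigcupT_measurable.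
Qed.

End hausdorff.

(** * Weak limits along an ultrafilter *)

Section tree_measure.
Context {R : realType}.

Lemma finite_measure_of d (T : measurableType d) (mu : {measure set T -> \bar R}) :
  (mu setT < +oo)%E ->
  exists nu : {finite_measure set T -> \bar R}, forall A, nu A = mu A.
Proof.
move=> h; exists (mfrestr measurableT h) => A.
by rewrite -[LHS]/(mu (A `&` setT)) setIT.
Qed.

Lemma pushforward_finite d d' (T : measurableType d) (T' : measurableType d')
    (m : {finite_measure set T -> \bar R}) (g : T -> T') : measurable_fun setT g ->
  exists mu : {finite_measure set T' -> \bar R}, forall A, mu A = pushforward m g A.
Proof.
move=> mg; pose mu : {measure set T' -> \bar R} := pushforward m g.
have [|nu nuE] := @finite_measure_of d' T' (mu mg); last by exists nu => A; rewrite nuE.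
by rewrite /= /pushforward preimage_setT -ge0_fin_numE ?fin_num_measure.
Qed.

Lemma measurable_preimage_fibers d (T : measurableType d) (K : countType) (lab : T -> K) (S : set K) :
  (forall k, measurable (lab @^-1` [set k])) -> measurable (lab @^-1` S).
Proof.
move=> mlab; rewrite -bigcup_pfiber; apply: bigcupT_measurable => n.
exact: measurable_pfiber.
Qed.

Lemma measurable_fun_fibers d d' (T : measurableType d) (T' : measurableType d')
    (K : countType) (lab : T -> K) (F : K -> T') :
  (forall k, measurable (lab @^-1` [set k])) -> measurable_fun setT (F \o lab).
Proof.
by move=> mlab _ B mB; rewrite setTI comp_preimage; exact: measurable_preimage_fibers.
Qed.

(* [W w] is the mass prescribed to the dyadic cell coded by the word [w] (last bit
   first). Cutting [0, W nil[ successively into intervals of lengths [W w], the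
   image of Lebesgue measure under the limit of [branch] has these masses; this
   replaces the Riesz representation theorem. *)
Variables (W : seq bool -> R) (thr : seq bool -> R).
Hypothesis W_ge0 : forall w, 0 <= W w.
Hypothesis W_split : forall w, W w = W (false :: w) + W (true :: w).

Fixpoint left_end (w : seq bool) : R :=
  if w is b :: w' then left_end w' + (if b then W (false :: w') else 0) else 0.

Fixpoint branch (n : nat) (t : R) : seq bool :=
  if n is m.+1 then let w := branch m t in (left_end w + W (false :: w) <= t) :: w
  else [::].

Lemma size_branch n t : size (branch n t) = n.
Proof. by elim: n => //= n ->. Qed.

Lemma measurable_branch n w : measurable ((branch n : measurableTypeR R -> _) @^-1` [set w]).
Proof.
elim: n w => [|n ih] w.
  have [->|w0] := eqVneq w [::].
    by rewrite (_ : _ @^-1` _ = setT)//; apply/seteqP; split.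
  rewrite (_ : _ @^-1` _ = set0)//; apply/seteqP; split => // t /= /esym/eqP.
  by rewrite (negbTE w0).
case: w => [|b w].
  by rewrite (_ : _ @^-1` _ = set0)//; apply/seteqP; split.
rewrite (_ : _ @^-1` _ = (branch n : measurableTypeR R -> _) @^-1` [set w] `&`
    (if b then `[left_end w + W (false :: w), +oo[%classic
     else `]-oo, left_end w + W (false :: w)[%classic)).
  by apply: measurableI => //; case: b.
apply/seteqP; split => t /=.
  by move=> [<- <-]; split => //; case: leP => /=; rewrite in_itv/= ?andbT.
move=> [->] h; congr (_ :: _); apply/idP; move: h.
by case: b => /=; rewrite in_itv/= ?andbT// ltNge => /negbTE ->.
Qed.

Lemma branch_itv n t w : 0 <= t < W [::] -> branch n t = w ->
  left_end w <= t < left_end w + W w.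
Proof.
move=> t0; elim: n w => [|n ih] w; first by move=> <- /=; rewrite add0r.
move=> /= <-; have := ih _ erefl; set v := branch n t => /andP[h1 h2].
case: (leP (left_end v + W (false :: v)) t) => /= h; first by rewrite h/= -addrA -W_split.
by rewrite addr0 h1 h.
Qed.

Lemma itv_branch t w : left_end w <= t < left_end w + W w ->
  (0 <= t < W [::]) /\ branch (size w) t = w.
Proof.
elim: w => [|b w ih]; first by rewrite /= add0r.
move=> /= h.
have hw : left_end w <= t < left_end w + W w.
  have := W_ge0 (false :: w); have := W_ge0 (true :: w); rewrite (W_split w).
  by move: h => /andP[]; case: b => *; apply/andP; split; lra.
have [t0 bt] := ih hw; split => //.
rewrite bt; congr (_ :: _); move: h; case: b => /=; first by case/andP.
by rewrite addr0 => /andP[_]; rewrite ltNge => /negbTE.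
Qed.

Lemma leb_branch w : lebesgue_measure (`[0, W [::][%classic `&` (branch (size w)) @^-1` [set w])
  = (W w)%:E.
Proof.
rewrite (_ : _ `&` _ = `[left_end w, left_end w + W w[%classic).
  rewrite lebesgue_measure_itv/= lte_fin ltrDl; case: ltP => Ww.
    by rewrite -EFinB; congr (_%:E); ring.
  by congr (_%:E); apply/eqP; rewrite eq_le W_ge0.
apply/seteqP; split => t /=; rewrite !in_itv/=.
  by move=> [t0 /(branch_itv t0)].
by move=> /itv_branch[].
Qed.

End tree_measure.

(** * Integrals against an integrable weight *)

Section weighted_integrals.
Context {R : realType} d (T : measurableType d) (mu : {measure set T -> \bar R}).
Variable f : T -> R.
Hypothesis intf : mu.-integrable setT (EFin \o f).

Lemma integrable_bounded_mul (g : T -> R) (M : R) : measurable_fun setT g ->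
  (forall x, `|g x| <= M) -> mu.-integrable setT (fun x => (g x * f x)%:E).
Proof.
move=> mg gM.
have mf : measurable_fun setT f by apply/measurable_EFinP; exact: measurable_int intf.
apply: (@le_integrable _ _ _ _ _ measurableT _ (fun x => M%:E * (f x)%:E)%E).
- by apply/measurable_EFinP; exact: measurable_funM.
- move=> x _ /=; rewrite lee_fin !normrM ler_wpM2r//.
  exact: le_trans (gM x) (ler_norm _).
- exact: integrableZl.
Qed.

Lemma Rintegral_step m (lab : T -> seq bool) (F : seq bool -> R) :
  (forall x, size (lab x) = m) ->
  (forall k, measurable (lab @^-1` [set k])) ->
  \int[mu]_x (F (lab x) * f x) =
  \sum_(w : m.-tuple bool) F w * \int[mu]_(x in lab @^-1` [set val w]) f x.
Proof.
move=> slab mlab.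
have e x : F (lab x) * f x = \sum_(w : m.-tuple bool) F w * (\1_(lab @^-1` [set val w]) x * f x).
  rewrite (bigD1 (Tuple (introT eqP (slab x))))//= big1 => [|w wx].
    by rewrite addr0 indicE mem_set ?mul1r//.
  rewrite indicE memNset ?mul0r ?mulr0// => /= h; move: wx; rewrite -val_eqE/= h eqxx//.
have int1 w : mu.-integrable setT (fun x => (\1_(lab @^-1` [set w]) x * f x)%:E).
  apply: (@integrable_bounded_mul _ 1); first exact: measurable_indic.
  by move=> x; rewrite indicE; case: (_ \in _); rewrite ?normr1 ?normr0.
rewrite /Rintegral; under eq_integral do rewrite e -sumEFin.
rewrite integral_sum//; last first.
  by move=> w; apply: (@integrableZl _ _ _ _ _ measurableT _ (fun x => (\1_(lab @^-1` [set val w]) x * f x)%:E)).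
rewrite (eq_bigr (fun w : m.-tuple bool => (F w * fine (\int[mu]_(x in lab @^-1` [set val w]) (f x)%:E))%:E)) ?sumEFin// => w _.
rewrite (_ : (fun x => _) = (fun x => (F w)%:E * (\1_(lab @^-1` [set val w]) x * f x)%:E)%E)//.
rewrite integralZl// EFinM; congr (_ * _)%E.
rewrite fineK; last first.
  by apply: integrable_fin_num => //; apply: integrableS intf.
rewrite [RHS]integral_mkcond; apply: eq_integral => x _.
by rewrite patchE indicE; case: ifP; rewrite ?mul1r ?mul0r.
Qed.

Lemma Rintegral_dist (g h : T -> R) (e : R) : measurable_fun setT g -> measurable_fun setT h ->
  (exists M, forall x, `|g x| <= M) -> (exists M, forall x, `|h x| <= M) ->
  (forall x, 0 <= f x) -> (forall x, `|g x - h x| <= e) ->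
  `|\int[mu]_x (g x * f x) - \int[mu]_x (h x * f x)| <= e * \int[mu]_x f x.
Proof.
move=> mg mh [M gM] [M' hM'] f0 ghe.
have ig := integrable_bounded_mul mg gM; have ih := integrable_bounded_mul mh hM'.
rewrite -RintegralB//.
have ii : mu.-integrable setT (EFin \o (fun x => g x * f x - h x * f x)).
  by have := integrableB measurableT ig ih.
apply: le_trans (le_normr_Rintegral measurableT ii) _.
rewrite -RintegralZl//; apply: le_Rintegral => //.
- exact: integrable_norm.
- by apply: (@integrableZl _ _ _ _ _ measurableT e (EFin \o f)).
- by move=> x _ /=; rewrite -mulrBl normrM (ger0_norm (f0 x)) ler_wpM2r.
Qed.

End weighted_integrals.

Section ultralimits.
Context {R : realType} (U : set_system nat) {UU : UltraFilter U}.

(** The image filter contains a compact segment, hence has a cluster point there; an ultrafilter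
    converges to each of its cluster points. *)
Lemma ultra_bounded_cvg (u : nat -> R) (C : R) :
  (forall k, 0 <= u k <= C) -> exists2 l, 0 <= l <= C & u @ U --> l.
Proof.
move=> ub.
have FA : (u @ U) `[0, C]%classic.
  by apply: (@filterS _ U _ setT); [move=> k _ /=; rewrite in_itv/= ub|exact: filterT].
have [l [lC cl]] := @segment_compact _ 0 C (u @ U) _ FA.
exists l => //; move=> B Bl; rewrite /= nbhs_filterE.
have [//|nB] := in_ultra_setVsetC (u @^-1` B) UU.
by have [x [nBx Bx]] := cl (~` B) B nB Bl.
Qed.

Lemma cvg_bigsum (I : Type) (s : seq I) (f : nat -> I -> R) (l : I -> R) :
  (forall i, f^~ i @ U --> l i) ->
  (fun k => \sum_(i <- s) f k i) @ U --> \sum_(i <- s) l i.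
Proof.
move=> fl; elim: s => [|i s ih].
  by rewrite big_nil; under eq_fun do rewrite big_nil; exact: cvg_cst.
by rewrite big_cons; under eq_fun do rewrite big_cons; exact: cvgD.
Qed.

End ultralimits.

Lemma monotone_squeeze (R : realType) (u v : nat -> R) :
  (forall n, u n <= u n.+1) -> (forall n, v n.+1 <= v n) -> (forall n, u n <= v n) ->
  u @ \oo --> limn u /\ forall n, u n <= limn u <= v n.
Proof.
move=> /nondecreasing_seqP iu /nonincreasing_seqP dv uv.
have uvn m n : u m <= v n.
  apply: le_trans (iu _ _ (leq_maxl m n)) _; apply: le_trans (uv _) _.
  exact/dv/leq_maxr.
have cu : cvgn u.
  by apply: nondecreasing_is_cvgn => //; exists (v 0%N) => _ [m _ <-].
split => // n; rewrite nondecreasing_cvgn_le//=.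
by apply: limr_le => //; apply: nearW.
Qed.

(** * Dyadic coding of the unit square and construction of the weak limit *)

Section coding.
Context {R : realType}.

(** Half the side in the direction about to be bisected: after n bits the first coordinate has been
    halved [uphalf n] times and the second [n./2] times. *)
Definition mesh (w : seq bool) : R := 2 ^- (size w)./2.+1.

(* The bits of a word alternate between the two coordinates. *)
Fixpoint corner (w : seq bool) : R * R :=
  if w is b :: w' then
    let c := corner w' in let h := if b then mesh w' else 0 in
    if odd (size w') then (c.1, c.2 + h) else (c.1 + h, c.2)
  else (0, 0).

Definition thr (w : seq bool) : R :=
  (if odd (size w) then (corner w).2 else (corner w).1) + mesh w.

Lemma half_exp n : 2 ^- n = 2 ^- n.+1 + 2 ^- n.+1 :> R.
Proof. by rewrite exprS; field; rewrite expf_neq0. Qed.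

Lemma corner_step b w :
  [/\ (corner w).1 <= (corner (b :: w)).1,
      (corner (b :: w)).1 + 2 ^- (uphalf (size w).+1) <= (corner w).1 + 2 ^- (uphalf (size w)),
      (corner w).2 <= (corner (b :: w)).2 &
      (corner (b :: w)).2 + 2 ^- (size w).+1./2 <= (corner w).2 + 2 ^- (size w)./2].
Proof.
have m0 : 0 < mesh w by rewrite invr_gt0 exprn_gt0.
have mE : 2 ^- (size w)./2 = mesh w + mesh w by rewrite half_exp.
have uE : uphalf (size w) = if odd (size w) then (size w)./2.+1 else (size w)./2.
  by rewrite uphalf_half; case: odd.
have uSE : uphalf (size w).+1 = (size w)./2.+1 by [].
have hSE : (size w).+1./2 = uphalf (size w) by [].
rewrite hSE uSE uE /= -/(mesh w).
by case: ifP => o; case: b => /=; rewrite -/(mesh w) ?mE; split; lra.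
Qed.

Context d (T : measurableType d) (c1 c2 : T -> R).
Hypothesis mc1 : measurable_fun setT c1.
Hypothesis mc2 : measurable_fun setT c2.

Fixpoint code (n : nat) (x : T) : seq bool :=
  if n is m.+1 then let w := code m x in
    (thr w <= (if odd m then c2 x else c1 x)) :: w else [::].

Lemma size_code n x : size (code n x) = n.
Proof. by elim: n => //= n ->. Qed.

Lemma measurable_code n w : measurable (code n @^-1` [set w]).
Proof.
elim: n w => [|n ih] w.
  have [->|w0] := eqVneq w [::].
    by rewrite (_ : _ @^-1` _ = setT)//; apply/seteqP; split.
  rewrite (_ : _ @^-1` _ = set0)//; apply/seteqP; split => // t /= /esym/eqP.
  by rewrite (negbTE w0).
case: w => [|b w].
  by rewrite (_ : _ @^-1` _ = set0)//; apply/seteqP; split.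
pose c x := if odd n then c2 x else c1 x.
have mc : measurable_fun setT c by rewrite /c; case: odd.
rewrite (_ : _ @^-1` _ = code n @^-1` [set w] `&`
    (c @^-1` (if b then `[thr w, +oo[%classic else `]-oo, thr w[%classic))).
  by apply: measurableI => //; rewrite -[X in measurable X]setTI; apply: mc => //; case: b.
apply/seteqP; split => x /=.
  by move=> [<- <-]; split => //; rewrite -/(c x); case: leP => /=; rewrite in_itv/= ?andbT.
move=> [->] h; congr (_ :: _); apply/idP; move: h; rewrite -/(c x).
by case: b => /=; rewrite in_itv/= ?andbT// ltNge => /negbTE ->.
Qed.

Lemma code_itv n x : 0 <= c1 x < 1 -> 0 <= c2 x < 1 ->
  ((corner (code n x)).1 <= c1 x < (corner (code n x)).1 + 2 ^- (uphalf n)) /\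
  ((corner (code n x)).2 <= c2 x < (corner (code n x)).2 + 2 ^- n./2).
Proof.
move=> h1 h2; elim: n => [|n [ih1 ih2]]; first by rewrite /= !add0r expr0 invr1.
rewrite /= size_code; set w := code n x in ih1 ih2 *.
have uE : uphalf n = if odd n then n./2.+1 else n./2.
  by rewrite uphalf_half; case: odd.
have uSE : uphalf n.+1 = n./2.+1 by [].
rewrite uE in ih1 *; rewrite /thr size_code.
have mE : mesh w = 2 ^- n./2.+1 by rewrite /mesh size_code.
have hE := half_exp n./2.
rewrite mE; move: ih1 ih2; rewrite hE.
case: odd => /= /andP[? ?] /andP[? ?]; case: ifPn; rewrite -?ltNge => ?; split; apply/andP; split; lra.
Qed.

Variables (U : set_system nat) (UU : UltraFilter U).
Variables (lam : {measure set T -> \bar R}) (f : nat -> T -> R) (C : R).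
Hypothesis intf : forall k, lam.-integrable setT (EFin \o f k).
Hypothesis f_ge0 : forall k x, 0 <= f k x.
Hypothesis f_le : forall k, \int[lam]_x f k x <= C.

Let cellmass k w := \int[lam]_(x in code (size w) @^-1` [set w]) f k x.

Let intfA k A : measurable A -> lam.-integrable A (EFin \o f k).
Proof. by move=> mA; apply: integrableS (intf k). Qed.

Let cellmass_itv w k : 0 <= cellmass k w <= C.
Proof.
have mc : measurable (code (size w) @^-1` [set w]) by exact: measurable_code.
apply/andP; split; first by apply: Rintegral_ge0.
apply: le_trans (f_le k); rewrite /cellmass /Rintegral fine_le//.
- exact: (integrable_fin_num mc (intfA k mc)).
- exact: (integrable_fin_num measurableT (intf k)).
- apply: ge0_subset_integral => //; first exact: measurable_int (intf k).
  by move=> x _; rewrite lee_fin.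
Qed.

Definition limmass w : R := sval (cid2 (ultra_bounded_cvg (cellmass_itv w))).

Lemma limmass_cvg w : (fun k => cellmass k w) @ U --> limmass w.
Proof. by rewrite /limmass; case: cid2. Qed.

Lemma limmass_itv w : 0 <= limmass w <= C.
Proof. by rewrite /limmass; case: cid2. Qed.

Lemma limmass_split w : limmass w = limmass (false :: w) + limmass (true :: w).
Proof.
have h : (fun k => cellmass k (false :: w) + cellmass k (true :: w)) @ U --> limmass (false :: w) + limmass (true :: w).
  by apply: cvgD; exact: limmass_cvg.
rewrite -(cvg_lim (@norm_hausdorff _ R^o) (@limmass_cvg w)) -(cvg_lim (@norm_hausdorff _ R^o) h).
congr (lim (_ @ U)); apply/funext => k /=.
rewrite /cellmass -Rintegral_setU; try exact: measurable_code.
- congr (Rintegral lam _ _); apply/seteqP; split => x /=.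
    by move=> h'; rewrite h'; case: leP => _; [right|left].
  by case => -[_ ->].
- by apply: intfA; apply: measurableU; exact: measurable_code.
- apply/disj_setPS => x /= [[h1 _] [h2 _]].
  by rewrite h1 in h2.
Qed.

(** The point to which the closed cells along the address of t shrink. It may lie on the right or
    upper edge of a cell, where mass can accumulate in the limit; hence closed inequalities in
    [limpointP] against half-open ones in [code_itv]. *)
Definition limpoint (t : R) : R * R :=
  (limn (fun n => (corner (branch limmass n t)).1),
   limn (fun n => (corner (branch limmass n t)).2)).

Lemma limpointP t :
  [/\ (fun n => (corner (branch limmass n t)).1) @ \oo --> (limpoint t).1,
      (fun n => (corner (branch limmass n t)).2) @ \oo --> (limpoint t).2,
      forall n, (corner (branch limmass n t)).1 <= (limpoint t).1 <=
                (corner (branch limmass n t)).1 + 2 ^- (uphalf n) &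
      forall n, (corner (branch limmass n t)).2 <= (limpoint t).2 <=
                (corner (branch limmass n t)).2 + 2 ^- n./2].
Proof.
pose w n := branch limmass n t.
have sw n := size_branch limmass n t.
have st n : exists b, w n.+1 = b :: w n by eexists.
have [|n|n|] := @monotone_squeeze R (fun n => (corner (w n)).1) (fun n => (corner (w n)).1 + 2 ^- (uphalf n)).
- by move=> n; have [b ->] := st n; have [] := corner_step b (w n).
- by have [b ->] := st n; have [] := corner_step b (w n); rewrite sw.
- by rewrite lerDl invr_ge0 exprn_ge0.
have [|n|n|] := @monotone_squeeze R (fun n => (corner (w n)).2) (fun n => (corner (w n)).2 + 2 ^- n./2).
- by move=> n; have [b ->] := st n; have [] := corner_step b (w n).
- by have [b ->] := st n; have [] := corner_step b (w n); rewrite sw.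
- by rewrite lerDl invr_ge0 exprn_ge0.
by move=> ? ? ? ?; split.
Qed.

Lemma measurable_limpoint : measurable_fun setT (limpoint : measurableTypeR R -> @T2 R).
Proof.
have mb n F : measurable_fun setT ((F : _ -> measurableTypeR R) \o (branch limmass n : measurableTypeR R -> _)).
  by apply: measurable_fun_fibers => k; exact: measurable_branch.
apply: measurable_fun_pair.
  apply: (@measurable_fun_cvg _ _ _ _ (fun n t => (corner (branch limmass n t)).1)).
    by move=> n; exact: (mb n (fst \o corner)).
  by move=> t _; have [] := limpointP t.
apply: (@measurable_fun_cvg _ _ _ _ (fun n t => (corner (branch limmass n t)).2)).
  by move=> n; exact: (mb n (snd \o corner)).
by move=> t _; have [] := limpointP t.
Qed.

Definition ucont (psi : R * R -> R) := forall e : R, 0 < e -> exists2 del : R, 0 < del &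
  forall p q : R * R, `|p.1 - q.1| <= del -> `|p.2 - q.2| <= del -> `|psi p - psi q| <= e.

Lemma exp2_small (e : R) : 0 < e -> exists n, forall m, (n <= m)%N -> 2 ^- m <= e :> R.
Proof.
move=> e0; exists (Num.truncn e^-1).+1 => m nm.
rewrite -[e]invrK lef_pV2 ?posrE ?exprn_gt0 ?invr_gt0//.
apply/ltW/(lt_le_trans (truncnS_gt _)); rewrite -natrX ler_nat.
exact/ltnW/(leq_ltn_trans nm)/ltn_expl.
Qed.

(** The values at the corners of the dyadic squares of level n form step functions that converge to
    psi. *)
Lemma measurable_ucont psi : ucont psi -> measurable_fun setT (psi : @T2 R -> R).
Proof.
move=> upsi.
pose F n (k : int * int) : R := psi (k.1%:~R / 2 ^+ n, k.2%:~R / 2 ^+ n).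
apply: (@measurable_fun_cvg _ _ _ _ (fun n => F n \o (dlab n : @T2 R -> _))).
  by move=> n; apply: measurable_fun_fibers => k; exact: measurable_dsq.
move=> p _; apply/cvgrPdist_le => e e0.
have [del del0 h] := upsi _ e0.
have [N hN] := exp2_small del0.
exists N => // n Nn; rewrite /= distrC; apply: h => /=.
all: have n0 : 0 < 2 ^+ n :> R by rewrite exprn_gt0.
all: apply: le_trans (hN _ Nn); rewrite distrC.
all: rewrite -(ler_pM2l n0) divff ?gt_eqF// -{1}(gtr0_norm n0) -normrM mulrBr.
all: rewrite [X in _ - X]mulrC divfK ?gt_eqF//.
all: rewrite ger0_norm ?subr_ge0 ?floor_le// lerBlDr addrC -intrD1.
all: by rewrite ltW// floorD1_gt.
Qed.

Hypothesis c1_itv : forall x, 0 <= c1 x < 1.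
Hypothesis c2_itv : forall x, 0 <= c2 x < 1.

Lemma norm_itv_le (c x r del : R) : c <= x -> x <= c + r -> r <= del -> `|x - c| <= del.
Proof. by move=> cx xd; rewrite ger0_norm ?subr_ge0//; apply: le_trans; rewrite lerBlDl. Qed.

Lemma dist_quarter_le (a b c r e : R) :
  `|a - b| <= e / 4 -> `|c - r| <= e / 4 -> `|r - b| <= e / 4 -> `|c - a| <= e.
Proof. by rewrite !ler_norml => /andP[? ?] /andP[? ?] /andP[? ?]; apply/andP; split; lra. Qed.

(** The limit is the image of Lebesgue measure on [0, W0[ under [limpoint]. At a fixed depth,
    replacing psi by its value at the corner of the cell costs little on both sides, uniformly in k
    by [f_le]; what remains is a finite sum of cell masses, which converge to the [limmass] by
    construction. *)
Lemma weak_limit : exists mu : finmeas R,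
  forall psi, ucont psi -> (exists M, forall p, `|psi p| <= M) ->
  (fun k => \int[lam]_x (psi (c1 x, c2 x) * f k x)) @ U --> \int[mu]_p psi p.
Proof.
pose W0 := limmass [::].
have := limmass_itv [::]; rewrite -/W0 => /andP[W00 W0C].
have I0fin : (lebesgue_measure `[0%R, W0[%classic < +oo)%E.
  by rewrite lebesgue_measure_itv; case: ifP => _; rewrite -?EFinD ltry.
have mI : measurable (`[0, W0[%classic : set (measurableTypeR R)) by exact: measurable_itv.
pose m0 : {finite_measure set (measurableTypeR R) -> \bar R} := mfrestr mI I0fin.
have mg := measurable_limpoint.
have [mu muE] := pushforward_finite m0 mg.
have m0T : m0 setT = W0%:E.
  rewrite -[LHS]/(lebesgue_measure (setT `&` `[0, W0[%classic)) setTI lebesgue_measure_itv/= lte_fin.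
  case: ltP => h; first by rewrite -EFinB subr0.
  by congr (_%:E); apply/eqP; rewrite eq_le W00 h.
exists mu => psi upsi [M psiM].
have mpsi := measurable_ucont upsi.
have int1 : m0.-integrable setT (EFin \o (cst 1 : _ -> R)).
  exact: finite_measure_integrable_cst.
have intpsi : m0.-integrable setT (EFin \o psi \o limpoint).
  rewrite (_ : _ \o _ = (fun x => (psi (limpoint x) * cst 1 x)%:E)); last first.
    by apply/funext => x /=; rewrite mulr1.
  apply: (integrable_bounded_mul int1 (M := M)) => //.
  by apply: measurableT_comp mg.
have -> : \int[mu]_p psi p = \int[m0]_t (psi (limpoint t) * 1).
  congr fine.
  have -> : (\int[mu]_p (psi p)%:E = \int[pushforward m0 (limpoint : measurableTypeR R -> @T2 R)]_p (psi p)%:E)%E.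
    by apply: eq_measure_integral => A _ _; exact: muE.
  rewrite integral_pushforward//; last exact/measurable_EFinP.
  by apply: eq_integral => x _ /=; rewrite mulr1.
apply/cvgrPdist_le => e e0.
(* The oscillation of psi allowed on a cell: times a mass of at most C it stays below e / 4. The
   added 1 covers C = 0. *)
pose e' := e / 4 / (C + 1).
have C0 : 0 <= C by apply: le_trans W0C.
have e'0 : 0 < e' by rewrite !divr_gt0// ltr_wpDl.
have e'C x : 0 <= x <= C -> e' * x <= e / 4.
  move=> /andP[x0 xC]; rewrite /e' mulrAC ler_pdivrMr ?ltr_wpDl//.
  by rewrite ler_wpM2l ?divr_ge0 ?ltW//; lra.
have [del del0 hdel] := upsi _ e'0.
have [N hN] := exp2_small del0.
pose pt w : R := psi (corner w).
have mcode : measurable_fun setT ((pt : _ -> measurableTypeR R) \o code N.*2).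
  by apply: measurable_fun_fibers => k; exact: measurable_code.
have mbranch : measurable_fun setT ((pt : _ -> measurableTypeR R) \o (branch limmass N.*2 : measurableTypeR R -> _)).
  by apply: measurable_fun_fibers => k; exact: measurable_branch.
have ptM w : `|pt w| <= M by exact: psiM.
have hN2 : 2 ^- (uphalf N.*2) <= del /\ 2 ^- N.*2./2 <= del.
  by rewrite uphalf_double doubleK hN.
have h1 k : `|\int[lam]_x (psi (c1 x, c2 x) * f k x) - \int[lam]_x (pt (code N.*2 x) * f k x)| <= e / 4.
  apply: le_trans (e'C (\int[lam]_x f k x) _); last by rewrite Rintegral_ge0 //= f_le.
  apply: Rintegral_dist => //.
  - by apply: measurableT_comp mpsi _; exact: measurable_fun_pair.
  - by exists M => x; exact: psiM.
  - by exists M => x.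
  move=> x; have [/andP[p1 /ltW q1] /andP[p2 /ltW q2]] := code_itv N.*2 (c1_itv x) (c2_itv x).
  by apply: hdel; [exact: norm_itv_le p1 q1 hN2.1|exact: norm_itv_le p2 q2 hN2.2].
have h2 : `|\int[m0]_t (psi (limpoint t) * 1) - \int[m0]_t (pt (branch limmass N.*2 t) * 1)| <= e / 4.
  apply: le_trans (e'C (\int[m0]_t 1) _); last first.
    rewrite Rintegral_cst// mul1r (_ : fine _ = W0) ?W00//; exact: (congr1 fine m0T).
  apply: Rintegral_dist => //.
  - by apply: measurableT_comp mpsi mg.
  - by exists M => x; exact: psiM.
  - by exists M => x.
  move=> t; have [_ _ /(_ N.*2)/andP[p1 q1] /(_ N.*2)/andP[p2 q2]] := limpointP t.
  by apply: hdel; [exact: norm_itv_le p1 q1 hN2.1|exact: norm_itv_le p2 q2 hN2.2].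
have h3 : (fun k => \int[lam]_x (pt (code N.*2 x) * f k x)) @ U --> \int[m0]_t (pt (branch limmass N.*2 t) * 1).
  rewrite (Rintegral_step int1 (m := N.*2))//; last 2 first.
  - by move=> x; rewrite size_branch.
  - by move=> w; exact: measurable_branch.
  have -> : (fun k => \int[lam]_x (pt (code N.*2 x) * f k x)) =
      (fun k => \sum_(w : (N.*2).-tuple bool) pt w * cellmass k w).
    apply/funext => k; rewrite (Rintegral_step (intf k) (m := N.*2))//; last 2 first.
    - by move=> x; rewrite size_code.
    - by move=> w; exact: measurable_code.
    by apply: eq_bigr => w _; rewrite /cellmass size_tuple.
  apply: cvg_bigsum => w; apply: cvgMr.
  have -> : \int[m0]_(x in branch limmass N.*2 @^-1` [set val w]) 1 = limmass w.
    have := leb_branch (fun w => (andP (limmass_itv w)).1) limmass_split (val w).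
    rewrite size_tuple => lb.
    rewrite Rintegral_cst ?mul1r; last exact: measurable_branch.
    by rewrite setIC in lb; exact: (congr1 fine lb).
  exact: limmass_cvg.
have e4 : 0 < e / 4 by rewrite divr_gt0.
move/cvgrPdist_le : h3 => /(_ _ e4); apply: filterS => k h3k.
exact: dist_quarter_le (h1 k) h2 h3k.
Qed.

End coding.

(** * Selection of good scales *)

Section four_corners.
Context {R : realType}.

(** A weighted geometric mean is at least the smaller factor, since p = p^th1 * p^th2. *)
Lemma min_le_powRM (th1 th2 p q : R) : 0 < th1 -> 0 < th2 -> th1 + th2 = 1 ->
  0 <= p -> 0 <= q -> Num.min p q <= p `^ th1 * q `^ th2.
Proof.
move=> h1 h2 h12 p0 q0.
have split_pow (x : R) : 0 <= x -> x = x `^ th1 * x `^ th2.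
  by move=> x0; rewrite -powRD ?h12 ?oner_eq0// powRr1.
case: (leP p q) => pq.
  by rewrite {1}(split_pow p)// ler_wpM2l ?powR_ge0// ge0_ler_powR ?nnegrE// ltW.
by rewrite {1}(split_pow q)// ler_wpM2r ?powR_ge0// ge0_ler_powR ?nnegrE// ltW.
Qed.

(* The four products are energy densities seen from the four corners of a cell, one
   for each sign pattern of the increment. *)
Lemma mixed_difference_le (th1 th2 a b c d : R) :
  0 < th1 -> 0 < th2 -> th1 + th2 = 1 ->
  `|d - b - c + a| <= 2 * (`|b - a| `^ th1 * `|c - a| `^ th2 +
    `|a - b| `^ th1 * `|d - b| `^ th2 + `|d - c| `^ th1 * `|a - c| `^ th2 +
    `|c - d| `^ th1 * `|b - d| `^ th2).
Proof.
move=> h1 h2 h12.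
have H (p q : R) := @min_le_powRM th1 th2 _ _ h1 h2 h12 (normr_ge0 p) (normr_ge0 q).
have {H} := (H (b - a) (c - a), H (a - b) (d - b), H (d - c) (a - c), H (c - d) (b - d)).
rewrite (distrC a b) (distrC a c) (distrC c d) (distrC b d).
move: (_ `^ _ * _ `^ _) (_ `^ _ * _ `^ _) (_ `^ _ * _ `^ _) (_ `^ _ * _ `^ _) => A B C D [[[]]].
have t1 : `|d - b - c + a| <= `|d - c| + `|b - a|.
  by rewrite (_ : d - b - c + a = (d - c) - (b - a)) ?ler_normB//; ring.
have t2 : `|d - b - c + a| <= `|d - b| + `|c - a|.
  by rewrite (_ : d - b - c + a = (d - b) - (c - a)) ?ler_normB//; ring.
have : 0 <= `|b - a| by []. have : 0 <= `|c - a| by [].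
have : 0 <= `|d - b| by []. have : 0 <= `|d - c| by [].
move: t1 t2; move: `|b - a| `|c - a| `|d - b| `|d - c| => p q r s.
by move=> ? ? ? ? ? ?; rewrite !ge_min; do 4 (case/orP => ?); lra.
Qed.

End four_corners.

Section selection.
Context {R : realType}.
Notation T2 := (@T2 R).
Notation leb2 := (@leb2 R).

Lemma enorm_ge (z : R * R) : `|z.1| <= enorm z /\ `|z.2| <= enorm z.
Proof.
rewrite /enorm; split; rewrite -sqrtr_sqr ler_sqrt ?addr_ge0 ?sqr_ge0//.
  by rewrite lerDl sqr_ge0.
by rewrite lerDr sqr_ge0.
Qed.

Lemma measurable_enorm : measurable_fun setT (@enorm R : T2 -> R).
Proof.
apply: measurableT_comp.
  by apply: continuous_measurable_fun; exact: sqrt_continuous.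
by apply: measurable_funD; apply: measurable_funX.
Qed.

(** The inner integral of [Eeps] freed from the weight |z|^-2, so that good increments are those
    with a bound M |z|^2. *)
Definition energy (th1 th2 : R) (V : set (R * R)) (u : R * R -> R) (z : R * R) : \bar R :=
  (\int[leb2]_(x in (V : set T2)) (`|Du1 u x z| `^ th1 * `|Du2 u x z| `^ th2)%:E)%E.

Lemma measurable_coords :
  [/\ measurable_fun setT (fun zx : T2 * T2 => zx.1.1 : R),
      measurable_fun setT (fun zx : T2 * T2 => zx.1.2 : R),
      measurable_fun setT (fun zx : T2 * T2 => zx.2.1 : R) &
      measurable_fun setT (fun zx : T2 * T2 => zx.2.2 : R)].
Proof. by split; exact: measurableT_comp. Qed.

Lemma measurable_Du_pow th1 th2 (u : T2 -> R) : measurable_fun setT u ->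
  measurable_fun setT (fun zx : T2 * T2 => `|Du1 u zx.2 zx.1| `^ th1 * `|Du2 u zx.2 zx.1| `^ th2).
Proof.
move=> mu.
have mp (th : R) (f : T2 * T2 -> R) : measurable_fun setT f -> measurable_fun setT (fun x => `|f x| `^ th).
  move=> mf; apply: (measurableT_comp (measurable_powR th)).
  exact: (measurableT_comp (@normr_measurable _ setT)).
have [m11 m12 m21 m22] := measurable_coords.
have m2 : measurable_fun setT (fun zx : T2 * T2 => u zx.2) by exact: measurableT_comp.
apply: measurable_funM; apply: mp; apply: measurable_funB => //.
- apply: (measurableT_comp mu (g := fun zx : T2 * T2 => (zx.2.1 + zx.1.1, zx.2.2))).
  by apply: measurable_fun_pair => //; exact: measurable_funD.
- apply: (measurableT_comp mu (g := fun zx : T2 * T2 => (zx.2.1, zx.2.2 + zx.1.2))).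
  by apply: measurable_fun_pair => //; exact: measurable_funD.
Qed.

Lemma measurable_energy th1 th2 V (u : T2 -> R) : measurable (V : set T2) -> measurable_fun setT u ->
  measurable_fun setT (energy th1 th2 V u : T2 -> \bar R).
Proof.
move=> mV mu.
pose F (zx : T2 * T2) : \bar R := ((\1_V zx.2 * (`|Du1 u zx.2 zx.1| `^ th1 * `|Du2 u zx.2 zx.1| `^ th2))%:E).
have mF : measurable_fun setT F.
  apply/measurable_EFinP; apply: measurable_funM; last exact: measurable_Du_pow.
  by apply: measurableT_comp => //; exact: measurable_indic.
have F0 zx : (0 <= F zx)%E by rewrite lee_fin !mulr_ge0 ?powR_ge0.
rewrite (_ : energy _ _ _ _ = fubini_F leb2 F); first exact: (@measurable_fun_fubini_tonelli_F _ _ _ _ _ leb2 F mF F0).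
apply/funext => z; rewrite /energy /fubini_F [LHS]integral_mkcond; congr (integral _ _ _); apply/funext => x.
by rewrite patchE /F/= indicE; case: ifP => _; rewrite ?mul1r ?mul0r.
Qed.

Lemma measurable_Du_pow_x th1 th2 (u : T2 -> R) z : measurable_fun setT u ->
  measurable_fun setT (fun x : T2 => `|Du1 u x z| `^ th1 * `|Du2 u x z| `^ th2).
Proof.
by move=> /(measurable_Du_pow th1 th2) h; exact: (measurableT_comp h (pair1_measurable (z : T2))).
Qed.

Lemma energy_ge0 th1 th2 V u z : (0 <= energy th1 th2 V u z)%E.
Proof. by apply: integral_ge0 => x _; rewrite lee_fin mulr_ge0 ?powR_ge0. Qed.

Lemma Ieps_itv (a b e : R) : 0 < e -> Ieps a b e = `]a + e, b - e[%classic.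
Proof.
move=> e0; apply/seteqP; split => s; rewrite /Ieps/= in_itv/= lt_min.
  by move=> [_ /andP[? ?]]; apply/andP; split; lra.
by move=> /andP[? ?]; split; apply/andP; split; lra.
Qed.

Lemma measurable_box_eps (a1 b1 a2 b2 e : R) : 0 < e -> measurable (box_eps a1 b1 a2 b2 e : set T2).
Proof. by move=> e0; rewrite /box_eps !Ieps_itv//; apply: measurableX. Qed.

Definition quadrant : set T2 := `]0, +oo[ `*` `]0, +oo[.

(* On a cone [z1 z2] is comparable to [|z|^2], so that a bound of the energy by
   [M |z|^2] bounds the mean of [|D2 u| / (z1 z2)]. *)
Definition cone (c : R) : set T2 :=
  quadrant `&` [set z | c * enorm z ^+ 2 <= z.1 * z.2].

Lemma measurable_cone c : measurable (cone c).
Proof.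
apply: measurableI; first by apply: measurableX.
rewrite -[X in measurable X]setTI; apply: (measurable_fun_le measurableT).
  by apply: measurable_funM => //; apply: measurable_funX; exact: measurable_enorm.
exact: measurable_funM.
Qed.

Definition flip (s : bool * bool) (z : R * R) : R * R := ((-1) ^+ s.1 * z.1, (-1) ^+ s.2 * z.2).

Lemma enorm_flip s z : enorm (flip s z) = enorm z.
Proof. by rewrite /enorm /flip/= !exprMn !sqrr_sign !mul1r. Qed.

Lemma flipE s : flip s = aff2 ((-1) ^+ s.1, (-1) ^+ s.2) (0, 0).
Proof. by apply/funext => z; rewrite /aff2 /aff1/= !addr0. Qed.

Lemma ge0_integral_flip s (f : T2 -> \bar R) : measurable_fun setT f -> (forall x, 0 <= f x)%E ->
  (\int[leb2]_z f (flip s z) = \int[leb2]_z f z)%E.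
Proof.
move=> mf f0; under eq_integral do rewrite flipE.
rewrite ge0_integral_aff2//= ?signr_eq0//.
by rewrite -signr_addb normr_sign invr1 mul1e.
Qed.

Variables (rho : R * R -> R).
Hypothesis rho0 : forall z, 0 <= rho z.
Hypothesis int_rho : leb2.-integrable [set: T2] (EFin \o (rho : T2 -> R)).
Hypothesis rho_radial : forall z w, enorm z = enorm w -> rho z = rho w.
Hypothesis rho_supp : forall z, 1 < enorm z -> rho z = 0.
Hypothesis rho1 : (\int[leb2]_(z in [set: T2]) (rho z)%:E = 1)%E.

Let mrho : measurable_fun setT (rho : T2 -> R).
Proof. by apply/measurable_EFinP; exact: measurable_int int_rho. Qed.

(** The four reflections of the open quadrant cover the plane up to the axes, so by radial symmetry
    the quadrant has positive rho-mass. It is the increasing union of the cones with c = 1 / (n +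
    1), one of which must then have positive mass. *)
Lemma cone_mass : exists2 c, 0 < c & (0 < \int[leb2]_(z in cone c) (rho z)%:E)%E.
Proof.
pose K n := cone (n.+1%:R^-1).
have mK n : measurable (K n) by exact: measurable_cone.
have mQ : measurable quadrant by apply: measurableX.
have KQ : \bigcup_n K n = quadrant.
  apply/seteqP; split => [z [n _ []]//|z Qz].
  have [] : 0 < z.1 /\ 0 < z.2 by move: Qz => []/=; rewrite !in_itv/= !andbT.
  move=> z1 z2; have z12 : 0 < z.1 * z.2 by rewrite mulr_gt0.
  exists (Num.truncn (enorm z ^+ 2 / (z.1 * z.2))) => //; split => //=.
  rewrite -ler_pdivlMl ?invr_gt0// invrK mulrC -ler_pdivrMl// mulrC.
  exact/ltW/truncnS_gt.
have ndK : nondecreasing_seq K.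
  move=> m n mn; apply/subsetPset => z [Qz h]; split => //.
  apply: le_trans h; rewrite ler_wpM2r ?sqr_ge0//.
  by rewrite lef_pV2 ?posrE// ler_nat.
have [h|] := pselect (exists n, 0 < \int[leb2]_(z in K n) (rho z)%:E)%E.
  by have [n hn] := h; exists n.+1%:R^-1; rewrite ?invr_gt0.
move=> /forallNP h; exfalso.
have K0 n : (\int[leb2]_(z in K n) (rho z)%:E = 0)%E.
  apply/eqP; rewrite eq_le integral_ge0 ?andbT; last by move=> z _; rewrite lee_fin.
  by rewrite leNgt; apply/negP; exact: h.
have Q0 : (\int[leb2]_(z in quadrant) (rho z)%:E = 0)%E.
  have := @ge0_nondecreasing_set_cvg_integral _ _ _ K (EFin \o rho) leb2 ndK mK.
  rewrite KQ; have -> : (fun n => \int[leb2]_(z in K n) (EFin \o rho) z)%E = cst 0%E.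
    by apply/funext => n; exact: K0.
  move=> cv; have {}cv := cv _ _; rewrite -(cvg_lim (@ereal_hausdorff R) (cv _ _)).
  - by rewrite lim_cst//; exact: ereal_hausdorff.
  - by move=> n; apply/measurable_EFinP; exact: measurable_funTS.
  - by move=> n z _; rewrite lee_fin.
pose g (z : T2) : \bar R := (\1_quadrant z * rho z)%:E.
have mg : measurable_fun setT g.
  by apply/measurable_EFinP; apply: measurable_funM.
have g0 z : (0 <= g z)%E by rewrite lee_fin mulr_ge0.
have intg : (\int[leb2]_z g z = 0)%E.
  rewrite -Q0 [RHS]integral_mkcond; congr (integral _ _ _); apply/funext => z.
  by rewrite patchE /g indicE; case: ifP => _; rewrite ?mul1r ?mul0r.
have mgf s : measurable_fun setT (fun z => g (flip s z)).
  apply: (measurableT_comp mg); rewrite flipE; exact: measurable_aff2.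
(* Off the axes, the reflection of z by the signs of its coordinates lies in the quadrant, so this
   sum dominates rho. *)
have : (1 <= \int[leb2]_z \sum_(s : bool * bool) g (flip s z))%E.
  rewrite -rho1; apply: ae_ge0_le_integral => //.
  - by move=> z _; rewrite lee_fin.
  - by apply/measurable_EFinP.
  - by move=> z _; apply: sume_ge0.
  - by apply: emeasurable_sum.
  exists ([set 0] `*` setT `|` setT `*` [set 0]); split.
  - by apply: measurableU; apply: measurableX.
  - have n1 : leb2 ([set 0] `*` setT) = 0%E.
      by rewrite [LHS](@leb2X R [set 0] setT)// lebesgue_measure_set1 mul0e.
    have n2 : leb2 (setT `*` [set 0]) = 0%E.
      by rewrite [LHS](@leb2X R setT [set 0])// lebesgue_measure_set1 mule0.
    by apply: null_set_setU => //; apply: measurableX.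
  - move=> z /= /not_implyP[_ hz]; apply: contrapT => /not_orP[nz1 nz2]; apply: hz.
    have z1 : z.1 != 0 by apply/eqP => z1; apply: nz1.
    have z2 : z.2 != 0 by apply/eqP => z2; apply: nz2.
    pose s := (z.1 < 0, z.2 < 0).
    have fl : quadrant (flip s z).
      by split; rewrite /= in_itv/= andbT -normrEsign normr_gt0.
    apply: (@le_trans _ _ (g (flip s z))); last first.
      by rewrite (bigD1 s)//=; apply: leeDl; apply: sume_ge0.
    by rewrite /g indicE mem_set// mul1r (@rho_radial _ z)// enorm_flip.
rewrite ge0_integral_sum//.
rewrite big1 ?lee_fin ?ler10// => s _.
by rewrite ge0_integral_flip.
Qed.

Lemma rho_eps_ge0 e z : 0 <= rho_eps rho e z.
Proof. by rewrite /rho_eps mulr_ge0 ?invr_ge0 ?sqr_ge0. Qed.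

Lemma rho_epsE e : 0 < e -> rho_eps rho e = fun z => e ^- 2 * rho (aff2 (e^-1, e^-1) (0, 0) z).
Proof.
by move=> e0; apply/funext => z; rewrite /rho_eps /aff2 /aff1/= !addr0 ![_^-1 * _]mulrC.
Qed.

Lemma enormZ (c : R) z : 0 <= c -> enorm (c * z.1, c * z.2) = c * enorm z.
Proof.
move=> c0; rewrite /enorm/= !exprMn -mulrDr sqrtrM ?sqr_ge0//.
by rewrite sqrtr_sqr ger0_norm.
Qed.

Lemma rho_eps_supp e z : 0 < e -> e < enorm z -> rho_eps rho e z = 0.
Proof.
move=> e0 ez; rewrite /rho_eps rho_supp ?mulr0//.
rewrite (_ : (_, _) = (e^-1 * z.1, e^-1 * z.2)); last by rewrite ![_^-1 * _]mulrC.
by rewrite enormZ ?invr_ge0 ?ltW// mulrC ltr_pdivlMr// mul1r.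
Qed.

Lemma rho_eps_flip e s z : 0 < e -> rho_eps rho e (flip s z) = rho_eps rho e z.
Proof.
move=> e0; rewrite /rho_eps; congr (_ * _); apply: rho_radial.
rewrite -[RHS](enorm_flip s); congr enorm.
by rewrite /flip/= !mulrA.
Qed.

Lemma measurable_rho_eps e : 0 < e -> measurable_fun setT (rho_eps rho e : T2 -> R).
Proof.
move=> e0; rewrite rho_epsE//; apply: measurable_funM => //.
by apply: (measurableT_comp mrho); exact: measurable_aff2.
Qed.

Lemma coneP c z : cone c z <-> [/\ 0 < z.1, 0 < z.2 & c * enorm z ^+ 2 <= z.1 * z.2].
Proof.
rewrite /cone /quadrant; split => [[[/= ]]|[z1 z2 h]]; first by rewrite !in_itv/= !andbT.
by split => //; split; rewrite /= in_itv/= andbT.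
Qed.

Lemma cone_scale c z t : 0 < t -> cone c (t * z.1, t * z.2) <-> cone c z.
Proof.
move=> t0; rewrite !coneP /= (enormZ _ (ltW t0)).
rewrite !(pmulr_rgt0 _ t0) exprMn (_ : c * _ = t ^+ 2 * (c * enorm z ^+ 2)); last by ring.
by rewrite (_ : t * z.1 * _ = t ^+ 2 * (z.1 * z.2)) ?ler_pM2l ?exprn_gt0//; ring.
Qed.

(** Cones are invariant under dilation and the Jacobian cancels the factor e^-2, so averages against
    [rho_eps] see the same mass at every scale. *)
Lemma cone_rho_eps c e : 0 < e ->
  (\int[leb2]_(z in cone c) (rho_eps rho e z)%:E = \int[leb2]_(z in cone c) (rho z)%:E)%E.
Proof.
move=> e0.
have ie0 : 0 < e^-1 by rewrite invr_gt0.
rewrite [LHS]integral_mkcond [RHS]integral_mkcond.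
set f := (X in _ = integral _ _ X).
have f0 z : (0 <= f z)%E by rewrite /f patchE; case: ifP => // _; rewrite lee_fin.
have mf : measurable_fun setT f.
  apply/(measurable_restrictT _ _).1; first exact: measurable_cone.
  by apply: measurable_funTS; apply/measurable_EFinP.
pose a := aff2 (e^-1, e^-1) (0, 0).
rewrite (_ : _ \_ _ = fun z => ((e ^- 2)%R%:E * f (a z))%E); last first.
  apply/funext => z; rewrite /f !patchE rho_epsE//.
  have -> : (z \in cone c) = (a z \in cone c).
    have aE : a z = (e^-1 * z.1, e^-1 * z.2) by rewrite /a /aff2 /aff1/= !addr0.
    by apply/idP/idP; rewrite !inE aE => /(cone_scale _ _ ie0).
  by case: ifP => _; rewrite ?mule0// -EFinM.
rewrite ge0_integralZl//; last 2 first.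
- by apply: (measurableT_comp mf); exact: measurable_aff2.
- by rewrite lee_fin invr_ge0 sqr_ge0.
rewrite ge0_integral_aff2//=; try by rewrite gt_eqF.
rewrite muleA -EFinM (_ : _ * _ = 1) ?mul1e//.
by rewrite gtr0_norm ?mulr_gt0//; field; rewrite gt_eqF.
Qed.

(** If every z of the cone with |z| <= e had a bad sign pattern, the energies at its four
    reflections would sum to more than M |z|^2. Integration against |z|^-2 [rho_eps], which is
    invariant under reflections, would give M k <= 4 times the averaged energy, with k the mass of
    the cone. *)
Lemma good_scales (th1 th2 a1 b1 a2 b2 Cb : R) (u : T2 -> R) : measurable_fun setT u ->
  (forall d, 0 < d -> exists2 e, 0 < e < d &
    (\int[leb2]_z (energy th1 th2 (box_eps a1 b1 a2 b2 e) u z *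
      ((enorm z) ^- 2 * rho_eps rho e z)%R%:E) < Cb%:E)%E) ->
  exists c M : R, 0 < c /\ forall eta, 0 < eta -> exists e z,
    [/\ 0 < e < eta, cone c z, enorm z <= e &
     forall s, (energy th1 th2 (box_eps a1 b1 a2 b2 e) u (flip s z) <= (M * enorm z ^+ 2)%:E)%E].
Proof.
move=> mu hE; have [c c0 kap] := cone_mass.
set k := (X in (0 < X)%E) in kap.
have mc := measurable_cone c.
have kfin : k \is a fin_num.
  apply: (integrable_fin_num mc); first exact: integrableS int_rho.
have k0 : 0 < fine k by rewrite fine_gt0// kap/= ltey_eq kfin.
(* M k is four times the energy bound, one share per sign pattern; strictness of that bound yields
   the contradiction. *)
have [M [M0 Mk]] : exists M, 0 <= M /\ M * fine k = 4 * Cb.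
  exists (4 * Cb / fine k); rewrite divfK ?gt_eqF//; split => //.
  have [e _ hEe] := hE 1 ltr01.
  rewrite !mulr_ge0 ?invr_ge0 ?(ltW k0)// -lee_fin; apply/ltW/(le_lt_trans _ hEe).
  apply: integral_ge0 => z _; rewrite mule_ge0 ?energy_ge0// lee_fin.
  by rewrite mulr_ge0 ?rho_eps_ge0// invr_ge0 sqr_ge0.
exists c, M; split => // eta eta0.
have [e /andP[e0 eeta] hEe] := hE _ eta0.
apply: contrapT => nex.
have key z : cone c z -> enorm z <= e -> exists s,
    ((M * enorm z ^+ 2)%:E < energy th1 th2 (box_eps a1 b1 a2 b2 e) u (flip s z))%E.
  move=> cz ze; apply: contrapT => /forallNP ns; apply: nex; exists e, z.
  split => //; first by rewrite e0.
  by move=> s; rewrite leNgt; apply/negP; exact: ns.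
pose G z := (energy th1 th2 (box_eps a1 b1 a2 b2 e) u z *
      ((enorm z) ^- 2 * rho_eps rho e z)%R%:E)%E.
have G0 z : (0 <= G z)%E.
  rewrite mule_ge0 ?energy_ge0// lee_fin mulr_ge0 ?rho_eps_ge0// invr_ge0 sqr_ge0//.
have mG : measurable_fun setT G.
  apply: emeasurable_funM.
    by apply: measurable_energy => //; exact: measurable_box_eps.
  apply/measurable_EFinP; apply: measurable_funM; last exact: measurable_rho_eps.
  have -> : (fun z : T2 => enorm z ^- 2) = (fun z => (enorm z ^+ 2) `^ (-1)).
    by apply/funext => z; rewrite powR_inv1// sqr_ge0.
  apply: (measurableT_comp (measurable_powR (-1))).
  by apply: measurable_funX; exact: measurable_enorm.
have mGf s : measurable_fun setT (fun z => G (flip s z)).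
  apply: (measurableT_comp mG); rewrite flipE; exact: measurable_aff2.
have Gfin : (\int[leb2]_z G z)%E \is a fin_num.
  by rewrite ge0_fin_numE ?integral_ge0//; apply: lt_trans hEe _; rewrite ltry.
have : (M%:E * k <= \sum_(s : bool * bool) \int[leb2]_z G (flip s z))%E.
  rewrite -ge0_integral_sum// /k -(cone_rho_eps _ e0) -ge0_integralZl//; last 2 first.
  - by apply/measurable_EFinP; apply: measurable_funTS; exact: measurable_rho_eps.
  - by move=> z _; rewrite lee_fin rho_eps_ge0.
  have sum0 z : (0 <= \sum_(s : bool * bool) G (flip s z))%E by apply: sume_ge0.
  have msum : measurable_fun setT (fun z => (\sum_(s : bool * bool) G (flip s z))%E).
    exact: emeasurable_sum.
  apply: (@le_trans _ _ (\int[leb2]_(z in cone c) \sum_(s : bool * bool) G (flip s z))%E).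
    apply: ge0_le_integral => //.
    - by move=> z _; rewrite -EFinM lee_fin mulr_ge0 ?rho_eps_ge0.
    - apply: measurable_funeM; apply/measurable_EFinP; apply: measurable_funTS.
      exact: measurable_rho_eps.
    - exact: measurable_funTS.
    move=> z cz; have [ze|ze] := leP (enorm z) e; last first.
      by rewrite rho_eps_supp// mule0.
    have [s hs] := key _ cz ze.
    apply: (@le_trans _ _ (G (flip s z))); last first.
      by rewrite (bigD1 s)//=; apply: leeDl; apply: sume_ge0.
    rewrite /G enorm_flip rho_eps_flip//.
    have nz : 0 < enorm z.
      have [z1 _ _] := (coneP c z).1 cz; have [+ _] := enorm_ge z.
      by apply: lt_le_trans; rewrite normr_gt0 gt_eqF.
    apply: le_trans (lee_wpmul2r _ (ltW hs)).
      rewrite -!EFinM lee_fin le_eqVlt; apply/orP; left; apply/eqP.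
      by field; rewrite ?gt_eqF.
    by rewrite lee_fin mulr_ge0 ?rho_eps_ge0// invr_ge0 sqr_ge0.
  by apply: ge0_subset_integral.
have -> : (\sum_(s : bool * bool) \int[leb2]_z G (flip s z) = \sum_(s : bool * bool) \int[leb2]_z G z)%E.
  by apply: eq_bigr => s _; rewrite ge0_integral_flip.
rewrite big_const card_prod card_bool /=.
rewrite -(fineK kfin) -(fineK Gfin) -EFinM Mk adde0 -!EFinD lee_fin.
by move: hEe; rewrite -/G -(fineK Gfin) lte_fin; lra.
Qed.
End selection.

(** * Normalised mixed differences and their limit *)

Section mixed_difference.
Context {R : realType}.
Notation T2 := (@T2 R).
Notation leb2 := (@leb2 R).

Definition D2 (u : R * R -> R) (x z : R * R) : R :=
  u (x.1 + z.1, x.2 + z.2) - u (x.1 + z.1, x.2) - u (x.1, x.2 + z.2) + u x.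

Definition translate (x d : R * R) : R * R := (x.1 + d.1, x.2 + d.2).

Lemma translateE d x : translate x d = aff2 (1, 1) d x.
Proof. by rewrite /aff2 /aff1/= !mul1r. Qed.

Lemma measurable_translate d : measurable_fun setT (translate^~ d : T2 -> T2).
Proof.
rewrite (_ : translate^~ d = aff2 (1, 1) d); first exact: measurable_aff2.
by apply/funext => x; rewrite translateE.
Qed.

Lemma ge0_integral_translate d (f : T2 -> \bar R) : measurable_fun setT f -> (forall x, 0 <= f x)%E ->
  (\int[leb2]_x f (translate x d) = \int[leb2]_x f x)%E.
Proof.
move=> mf f0; under eq_integral do rewrite translateE.
by rewrite ge0_integral_aff2//= ?oner_eq0// mulr1 normr1 invr1 mul1e.
Qed.

Lemma measurable_D2 (u : T2 -> R) z : measurable_fun setT u ->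
  measurable_fun setT (fun x : T2 => D2 u x z).
Proof.
move=> mu.
have m d : measurable_fun setT (fun x : T2 => u (translate x d)).
  by apply: (measurableT_comp mu); exact: measurable_translate.
have := m z; have := m (z.1, 0); have := m (0, z.2) => h3 h2 h1.
rewrite /D2; apply: measurable_funD => //; apply: measurable_funB; first apply: measurable_funB => //.
  by apply: eq_measurable_fun h2 => x _; rewrite /translate/= addr0.
by apply: eq_measurable_fun h3 => x _; rewrite /translate/= addr0.
Qed.

(** Locates the corner from which the increment [flip s z] points back across the cell. *)
Definition corner_offset (s : bool * bool) (z : R * R) : R * R :=
  (if s.1 then z.1 else 0, if s.2 then z.2 else 0).

Lemma offset_itv (l h y w e : R) (b : bool) : l + 2 * e < y < h - 2 * e -> 0 < w <= e ->
  l + e < y + (if b then w else 0) < h - e.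
Proof. by case: b => /andP[? ?] /andP[? ?]; apply/andP; split; lra. Qed.

Lemma D2_le (th1 th2 : R) u x z : 0 < th1 -> 0 < th2 -> th1 + th2 = 1 ->
  `|D2 u x z| <= 2 * \sum_(s : bool * bool)
    (`|Du1 u (translate x (corner_offset s z)) (flip s z)| `^ th1 *
     `|Du2 u (translate x (corner_offset s z)) (flip s z)| `^ th2).
Proof.
move=> h1 h2 h12.
apply: le_trans (@mixed_difference_le _ th1 th2 (u x) (u (x.1 + z.1, x.2)) (u (x.1, x.2 + z.2)) _ h1 h2 h12) _.
rewrite ler_pM2l//.
rewrite -(pair_big predT predT (fun s1 s2 => `|Du1 u (translate x (corner_offset (s1, s2) z)) (flip (s1, s2) z)| `^ th1 * `|Du2 u (translate x (corner_offset (s1, s2) z)) (flip (s1, s2) z)| `^ th2))/=.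
rewrite !big_bool /Du1 /Du2 /translate /corner_offset /flip/= !expr1 !expr0 !mulN1r !mul1r !addr0 !addrK.
by rewrite le_eqVlt; apply/orP; left; apply/eqP; case: x => x1 x2 /=; ring.
Qed.

End mixed_difference.

(** * Uniform L1 bound for the normalised mixed differences *)

Section densities.
Context {R : realType}.
Notation T2 := (@T2 R).
Notation leb2 := (@leb2 R).
Variables (a1 b1 a2 b2 th1 th2 : R) (u : T2 -> R) (c M : R).
Hypothesis th1_gt0 : 0 < th1.
Hypothesis th2_gt0 : 0 < th2.
Hypothesis th12 : th1 + th2 = 1.
Hypothesis mu : measurable_fun setT u.
Hypothesis c0 : 0 < c.

Definition good_pair (e : R) (z : R * R) := [/\ 0 < e, cone c z, enorm z <= e &
     forall s, (energy th1 th2 (box_eps a1 b1 a2 b2 e) u (flip s z) <= (M * enorm z ^+ 2)%:E)%E].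

(** The margin 2 e keeps the four corners of the cell inside [box_eps] with margin e, where the
    energy is controlled. *)
Definition dens (e : R) (z : R * R) (x : T2) : R :=
  \1_(box_eps a1 b1 a2 b2 (2 * e) : set T2) x * (D2 u x z / (z.1 * z.2)).

Lemma measurable_dens e z : 0 < e -> measurable_fun setT (dens e z).
Proof.
move=> e0; apply: measurable_funM.
  by apply: measurable_indic; apply: measurable_box_eps; rewrite mulr_gt0.
by apply: measurable_funM => //; exact: measurable_D2.
Qed.

Lemma box_epsP e x : 0 < e ->
  box_eps a1 b1 a2 b2 e x <-> (a1 + e < x.1 < b1 - e) /\ (a2 + e < x.2 < b2 - e).
Proof. by move=> e0; rewrite /box_eps !Ieps_itv//; split; case; rewrite /= !in_itv/=. Qed.

(** The constant is 2 from the four-corner inequality, times 4 sign patterns, times M, times the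
    bound 1 / c for |z|^2 / (z1 z2) on the cone. A translation brings each corner to the point where
    its energy is integrated. *)
Lemma dens_bound e z : good_pair e z ->
  (\int[leb2]_x `|(dens e z x)%:E| <= (8 * M / c)%:E)%E.
Proof.
move=> [e0 /coneP[z1 z2 cz] ze en].
have e20 : 0 < 2 * e by rewrite mulr_gt0.
have [z1e z2e] : z.1 <= e /\ z.2 <= e.
  have [] := enorm_ge z; rewrite !gtr0_norm// => h1 h2.
  by split; [exact: le_trans h1 ze|exact: le_trans h2 ze].
have nz : 0 < enorm z.
  by have [+ _] := enorm_ge z; apply: lt_le_trans; rewrite normr_gt0 gt_eqF.
pose F s (x : T2) : \bar R := (\1_(box_eps a1 b1 a2 b2 e : set T2) x *
  (`|Du1 u x (flip s z)| `^ th1 * `|Du2 u x (flip s z)| `^ th2))%:E.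
have F0 s x : (0 <= F s x)%E by rewrite lee_fin !mulr_ge0 ?powR_ge0.
have mF s : measurable_fun setT (F s).
  apply/measurable_EFinP; apply: measurable_funM; last exact: measurable_Du_pow_x.
  by apply: measurable_indic; exact: measurable_box_eps.
have mFs s : measurable_fun setT (fun x => F s (translate x (corner_offset s z))).
  by apply: (measurableT_comp (mF s)); exact: measurable_translate.
have intF s : (\int[leb2]_x F s x <= (M * enorm z ^+ 2)%:E)%E.
  apply: le_trans (en s); rewrite /energy [leRHS]integral_mkcond le_eqVlt; apply/orP; left; apply/eqP.
  congr (integral _ _ _); apply/funext => x.
  by rewrite patchE /F indicE; case: ifP => _; rewrite ?mul1r ?mul0r.
have K0 : 0 <= 2 / (z.1 * z.2) by rewrite divr_ge0// mulr_ge0// ltW.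
have sum0 x : (0 <= \sum_(s : bool * bool) F s (translate x (corner_offset s z)))%E by apply: sume_ge0.
apply: (@le_trans _ _ (\int[leb2]_x ((2 / (z.1 * z.2))%:E * \sum_(s : bool * bool) F s (translate x (corner_offset s z)))%E)%E).
  apply: ge0_le_integral => //.
  - by apply: measurableT_comp => //; apply/measurable_EFinP; exact: measurable_dens.
  - by apply: measurable_funeM; exact: emeasurable_sum.
  move=> x _; rewrite /dens indicE; case: (boolP (x \in _)) => [|_]; last first.
    by rewrite mul0r abse0; apply: mule_ge0 => //; rewrite lee_fin.
  rewrite inE => /(box_epsP _ e20)[/andP[? ?] /andP[? ?]].
  rewrite mul1r /F sumEFin -EFinM lee_fin normrM mulrC.
  rewrite (@ger0_norm _ (_^-1)) ?invr_ge0 ?mulr_ge0 ?(ltW z1) ?(ltW z2)//.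
  rewrite [leRHS]mulrAC mulrC ler_wpM2r ?invr_ge0 ?mulr_ge0 ?(ltW z1) ?(ltW z2)//.
  apply: le_trans (D2_le u x z th1_gt0 th2_gt0 th12) _; rewrite ler_pM2l//.
  apply: ler_sum => s _; rewrite indicE mem_set ?mul1r//; apply/(box_epsP _ e0).
  by split; apply: offset_itv; apply/andP.
rewrite ge0_integralZl//; last exact: emeasurable_sum.
rewrite ge0_integral_sum//.
apply: (@le_trans _ _ ((2 / (z.1 * z.2))%:E * \sum_(s : bool * bool) (M * enorm z ^+ 2)%:E)%E).
  apply: lee_wpmul2l; first by rewrite lee_fin.
  by apply: lee_sum => s _; rewrite (ge0_integral_translate _ (mF s)).
have M0 : 0 <= M * enorm z ^+ 2.
  by rewrite -lee_fin; apply: le_trans (intF (false, false)); exact: integral_ge0.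
rewrite sumEFin sumr_const card_prod card_bool -EFinM lee_fin.
have Mge0 : 0 <= M by move: M0; rewrite pmulr_lge0// exprn_gt0.
have zz : 0 < z.1 * z.2 by rewrite mulr_gt0.
have h : enorm z ^+ 2 / (z.1 * z.2) <= c^-1.
  by rewrite ler_pdivrMr// mulrC ler_pdivlMr// mulrC.
rewrite [leLHS](_ : _ = 8 * M * (enorm z ^+ 2 / (z.1 * z.2))).
  by rewrite ler_wpM2l// mulr_ge0.
by rewrite /=; ring.
Qed.

Lemma dens_integrable e z : good_pair e z -> leb2.-integrable setT (EFin \o dens e z).
Proof.
move=> g; apply/integrableP; split.
  by apply/measurable_EFinP; apply: measurable_dens; case: g.
by apply: le_lt_trans (dens_bound g) _; rewrite ltry.
Qed.

End densities.

(** * Finite measures and the Jordan decomposition *)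

Section finite_measures.
Context {R : realType} d (T : measurableType d).
Implicit Types m : {finite_measure set T -> \bar R}.

Lemma finite_lty m A : measurable A -> (m A < +oo)%E.
Proof. by move=> mA; rewrite ltey_eq fin_num_measure. Qed.

Lemma bounded_integrable m (phi : T -> R) : measurable_fun setT phi ->
  (exists M, forall x, `|phi x| <= M) -> m.-integrable setT (EFin \o phi).
Proof.
move=> mphi [M phiM].
have int1 : m.-integrable setT (EFin \o (cst 1 : T -> R)) by exact: finite_measure_integrable_cst.
have := integrable_bounded_mul int1 mphi phiM.
by apply: eq_integrable => // x _ /=; rewrite mulr1.
Qed.

Lemma restrict_finite m (D : set T) : measurable D ->
  exists m' : {finite_measure set T -> \bar R},
    (forall A, m' A = m (A `&` D)) /\
    forall phi : T -> R, (forall x, ~ D x -> phi x = 0) ->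
      \int[m']_x phi x = \int[m]_x phi x.
Proof.
move=> mD; pose mr : {measure set T -> \bar R} := mrestr m mD.
have [|m' m'E] := @finite_measure_of R d T mr.
  by rewrite /mr /= /mrestr setTI; exact: finite_lty.
exists m'; split; first by move=> A; rewrite m'E.
move=> phi phi0; have e (n : {finite_measure set T -> \bar R}) : \int[n]_x phi x = \int[n]_(x in D) phi x.
  rewrite [RHS]Rintegral_mkcond; congr (Rintegral _ _ _); apply/funext => x.
  by rewrite patchE; case: ifPn => // /negP h; rewrite phi0// => Dx; apply: h; rewrite inE.
rewrite !e /Rintegral; congr fine; apply: eq_measure_integral => A mA AD.
by rewrite (_ : _ A = mr A); [rewrite /mr/= /mrestr setIidl|exact: m'E].
Qed.

(** The Jordan decomposition of the charge m1 - m2, with positive set P. The last identity expresses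
    n1 - n2 = m1 - m2 without subtraction, a form that integrates directly over [measure_add]. *)
Lemma singular_pair m1 m2 : exists n1 n2 : {finite_measure set T -> \bar R},
  exists P, [/\ measurable P, n1 (~` P) = 0%E, n2 P = 0%E,
    forall A, measurable A -> (n1 A <= m1 A)%E /\ (n2 A <= m2 A)%E &
    forall A, measurable A -> (m1 A + n2 A = m2 A + n1 A)%E].
Proof.
pose nu : {charge set T -> \bar R} :=
  cadd (charge_of_finite_measure m1) (cscale (-1) (charge_of_finite_measure m2)).
have nuE A : nu A = (m1 A - m2 A)%E.
  by rewrite /nu/= /cadd/= cscaleN1.
have [P [N PN]] := Hahn_decomposition nu.
have [[mP posP] [mN negN] PNT PN0] := PN.
have NE : ~` P = N.
  apply/seteqP; split => x.
    by move=> nPx; have [] : (P `|` N) x by rewrite PNT.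
  by move=> Nx Px; have : (P `&` N) x by []; rewrite PN0.
have posE A : measurable A -> jordan_pos PN A = (m1 (A `&` P) - m2 (A `&` P))%E.
  by move=> mA; rewrite jordan_posE cjordan_posE /crestr0 mem_set// /crestr nuE.
have negE A : measurable A -> jordan_neg PN A = (m2 (A `&` N) - m1 (A `&` N))%E.
  move=> mA; rewrite jordan_negE cjordan_negE /crestr0 mem_set// /crestr nuE.
  have mAN := measurableI _ _ mA mN.
  have f (m : {finite_measure set T -> \bar R}) : m (A `&` N) \is a fin_num by rewrite fin_num_measure.
  by rewrite -(fineK (f m1)) -(fineK (f m2)) -!EFinB -EFinN opprB.
exists (jordan_pos PN), (jordan_neg PN), P; split => //.
- have := posE (~` P) (measurableC mP); rewrite setICl !measure0 sube0; exact.
- have := negE P mP; rewrite PN0 !measure0 sube0; exact.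
- move=> A mA; have := posE A mA; have := negE A mA.
  have mAP := measurableI _ _ mA mP; have mAN := measurableI _ _ mA mN.
  have le (m m' : {finite_measure set T -> \bar R}) B : measurable B ->
      (m (A `&` B) - m' (A `&` B) <= m A)%E.
    move=> mB; apply: (@le_trans _ _ (m (A `&` B))).
      rewrite leeBlDr ?fin_num_measure//; last exact: measurableI.
      by rewrite leeDl.
    by apply: le_measure; rewrite ?inE//; first [exact: measurableI|exact: subIsetl].
  by move=> nE pE; split; [apply: le_trans (le m1 m2 P mP)|apply: le_trans (le m2 m1 N mN)]; rewrite le_eqVlt; apply/orP; left; apply/eqP; [exact: pE|exact: nE].
- move=> A mA.
  have pE := posE A mA; have nE := negE A mA.
  have mAP := measurableI _ _ mA mP; have mAN := measurableI _ _ mA mN.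
  have sp (m : {finite_measure set T -> \bar R}) : (m A = m (A `&` P) + m (A `&` N))%E.
    rewrite -measureU//; last by rewrite setIACA PN0 setI0.
    by rewrite -setIUr PNT setIT.
  have f (m : {finite_measure set T -> \bar R}) B : measurable B -> m B \is a fin_num.
    by move=> mB; rewrite fin_num_measure.
  transitivity (m1 A + (m2 (A `&` N) - m1 (A `&` N)))%E; first by congr (_ + _)%E; exact: nE.
  transitivity (m2 A + (m1 (A `&` P) - m2 (A `&` P)))%E; last by congr (_ + _)%E; apply/esym; exact: pE.
  rewrite !sp -(fineK (f m1 _ mAP)) -(fineK (f m2 _ mAP)) -(fineK (f m1 _ mAN)) -(fineK (f m2 _ mAN)).
  by rewrite -!EFinB -!EFinD; congr (_%:E); ring.
Qed.

Lemma Rintegral_transfer m1 m2 (n1 n2 : {finite_measure set T -> \bar R}) (phi : T -> R) :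
  (forall A, measurable A -> (m1 A + n2 A = m2 A + n1 A)%E) ->
  measurable_fun setT phi -> (exists M, forall x, `|phi x| <= M) ->
  \int[m1]_x phi x - \int[m2]_x phi x = \int[n1]_x phi x - \int[n2]_x phi x.
Proof.
move=> mn mphi bphi.
have ip (m : {finite_measure set T -> \bar R}) := @bounded_integrable m phi mphi bphi.
have mE : measurable_fun setT (EFin \o phi) by apply/measurable_EFinP.
have h : (\int[measure_add m1 n2]_x (EFin \o phi) x = \int[measure_add m2 n1]_x (EFin \o phi) x)%E.
  by apply: eq_measure_integral => A mA _; apply: (eq_trans (measure_addE m1 n2 A)); apply: (eq_trans (mn A mA)); exact/esym/measure_addE.
have add (m n : {finite_measure set T -> \bar R}) :
    (\int[measure_add m n]_x (EFin \o phi) x = \int[m]_x (EFin \o phi) x + \int[n]_x (EFin \o phi) x)%E.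
  by apply: integral_measure_add => //; exact: ip.
have {}h := eq_trans (esym (add m1 n2)) (eq_trans h (add m2 n1)).
have f (m : {finite_measure set T -> \bar R}) := integrable_fin_num measurableT (ip m).
move: h; rewrite -(fineK (f m1)) -(fineK (f m2)) -(fineK (f n1)) -(fineK (f n2)) -!EFinD => -[].
by rewrite /Rintegral /comp; lra.
Qed.

End finite_measures.

(** * Weak limit of the densities in the box *)

Section limit_measures.
Context {R : realType}.
Notation T2 := (@T2 R).
Notation leb2 := (@leb2 R).
Variables (a1 b1 a2 b2 : R).
Hypothesis ab1 : a1 < b1.
Hypothesis ab2 : a2 < b2.
Variables (U : set_system nat) (UU : UltraFilter U).
Variables (f : nat -> T2 -> R) (C : R).
Hypothesis intf : forall k, leb2.-integrable setT (EFin \o f k).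
Hypothesis f_bound : forall k, (\int[leb2]_x `|(f k x)%:E| <= C%:E)%E.
Hypothesis f_supp : forall k x, ~ box a1 b1 a2 b2 x -> f k x = 0.

Let mbox : measurable (box a1 b1 a2 b2 : set T2).
Proof. by apply: measurableX. Qed.

(** Affine rescaling of the box to the unit interval. The value 0 outside keeps the range condition
    of the coding valid everywhere; the densities vanish there. *)
Definition coord1 (x : T2) : R := \1_(box a1 b1 a2 b2 : set T2) x * ((x.1 - a1) / (b1 - a1)).
Definition coord2 (x : T2) : R := \1_(box a1 b1 a2 b2 : set T2) x * ((x.2 - a2) / (b2 - a2)).

Lemma boxP (x : R * R) : box a1 b1 a2 b2 x <-> (a1 < x.1 < b1) /\ (a2 < x.2 < b2).
Proof. by rewrite /box; split; case; rewrite /= !in_itv/=. Qed.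

Lemma coord_itv x : (0 <= coord1 x < 1) /\ (0 <= coord2 x < 1).
Proof.
have d1 : 0 < b1 - a1 by rewrite subr_gt0.
have d2 : 0 < b2 - a2 by rewrite subr_gt0.
rewrite /coord1 /coord2 indicE; case: (boolP (x \in _)) => [|_]; last by rewrite !mul0r lexx ltr01.
rewrite inE => /boxP[/andP[h1 h2] /andP[h3 h4]]; rewrite !mul1r.
rewrite !divr_ge0 ?subr_ge0 ?(ltW h1) ?(ltW h3) ?(ltW ab1) ?(ltW ab2)//=.
by rewrite !ltr_pdivrMr// !mul1r !ltrD2r.
Qed.

Lemma measurable_coord : measurable_fun setT coord1 /\ measurable_fun setT coord2.
Proof.
by split; apply: measurable_funM => //; apply: measurable_funM => //; apply: measurable_funB.
Qed.

Lemma limit_one_sign (g : nat -> T2 -> R) :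
  (forall k, leb2.-integrable setT (EFin \o g k)) ->
  (forall k x, 0 <= g k x <= `|f k x|) ->
  exists m : finmeas R, m (~` (box a1 b1 a2 b2 : set T2)) = 0%E /\
  forall phi, ucont phi -> (exists B, forall p, `|phi p| <= B) ->
    (forall x, ~ box a1 b1 a2 b2 x -> phi x = 0) ->
    (fun k => \int[leb2]_x (phi x * g k x)) @ U --> \int[m]_x phi x.
Proof.
move=> intg gf.
have d1 : 0 < b1 - a1 by rewrite subr_gt0.
have d2 : 0 < b2 - a2 by rewrite subr_gt0.
have [mc1 mc2] := measurable_coord.
have gC k : \int[leb2]_x g k x <= C.
  rewrite -lee_fin /Rintegral fineK; last exact: (integrable_fin_num measurableT (intg k)).
  apply: le_trans (f_bound k); apply: ge0_le_integral => //.
  - by move=> x _; rewrite lee_fin; have /andP[] := gf k x.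
  - exact: measurable_int (intg k).
  - by apply: measurableT_comp => //; exact: measurable_int (intf k).
  - by move=> x _; rewrite lee_fin; have /andP[] := gf k x.
have [m0 hm0] := @weak_limit R _ T2 coord1 coord2 mc1 mc2 U UU leb2 g C intg
  (fun k x => (andP (gf k x)).1) gC (fun x => (coord_itv x).1) (fun x => (coord_itv x).2).
(* The inverse of the rescaling carries the limit from the unit square back to the box. *)
pose dec := @aff2 R (b1 - a1, b2 - a2) (a1, a2).
have mdec : measurable_fun setT (dec : T2 -> T2) by exact: measurable_aff2.
have [m1 m1E] := pushforward_finite m0 mdec.
have [m [mE mint]] := restrict_finite m1 mbox.
exists m; split.
  rewrite mE (_ : _ `&` _ = set0) ?measure0//.
  by apply/seteqP; split => x [].
move=> phi uphi [B hB] phi0.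
rewrite (mint _ phi0).
have mphi := measurable_ucont uphi.
have -> : \int[m1]_x phi x = \int[m0]_p phi (dec p).
  rewrite /Rintegral; congr fine.
  have -> : (\int[m1]_p (phi p)%:E = \int[pushforward m0 dec]_p (phi p)%:E)%E.
    by apply: eq_measure_integral => A _ _; exact: m1E.
  rewrite integral_pushforward//; first by apply/measurable_EFinP.
  apply: (@bounded_integrable _ _ _ m0 (phi \o dec)); last by exists B => x; exact: hB.
  by apply: measurableT_comp mphi mdec.
have h := hm0 (fun p => phi (dec p)).
have {h} := h _ _.
rewrite (_ : (fun k => \int[leb2]_x (phi (dec (coord1 x, coord2 x)) * g k x)) =
   (fun k => \int[leb2]_x (phi x * g k x))); last first.
  apply/funext => k; congr (Rintegral _ _ _); apply/funext => x.
  have [bx|nbx] := pselect (box a1 b1 a2 b2 x).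
    congr (phi _ * _); rewrite /dec /aff2 /aff1 /coord1 /coord2/= !indicE !mem_set// !mul1r.
    case: x bx => x1 x2 _ /=; by congr (_, _); rewrite mulrC divfK ?gt_eqF// subrK.
  have /andP[g0 gk] := gf k x.
  rewrite f_supp// normr0 in gk.
  by rewrite (_ : g k x = 0) ?mulr0//; apply/eqP; rewrite eq_le gk.
apply; last by exists B.
move=> e e0; have [del del0 hdel] := uphi _ e0.
have D0 : 0 < (b1 - a1) + (b2 - a2) by exact: addr_gt0.
exists (del / ((b1 - a1) + (b2 - a2))); first exact: divr_gt0.
move=> p q; rewrite !(ler_pdivlMr _ _ D0) => hp hq.
have H (w t : R) : 0 < w -> w <= b1 - a1 + (b2 - a2) -> `|t| * (b1 - a1 + (b2 - a2)) <= del -> `|w * t| <= del.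
  move=> w0 wle; apply: le_trans; rewrite normrM gtr0_norm// mulrC ler_wpM2l//.
apply: hdel; rewrite /dec /aff2 /aff1/= opprD addrACA subrr addr0 -mulrBr; apply: H => //.
- by rewrite lerDl ltW.
- by rewrite lerDr ltW.
Qed.

Lemma limit_measures : exists m1 m2 : finmeas R,
  [/\ m1 (~` (box a1 b1 a2 b2 : set T2)) = 0%E, m2 (~` (box a1 b1 a2 b2 : set T2)) = 0%E &
  forall phi, ucont phi -> (exists B, forall p, `|phi p| <= B) ->
    (forall x, ~ box a1 b1 a2 b2 x -> phi x = 0) ->
    (fun k => \int[leb2]_x (phi x * f k x)) @ U --> \int[m1]_x phi x - \int[m2]_x phi x].
Proof.
have [|k x|m1 [m10 hm1]] := @limit_one_sign (fun k x => Num.max (f k x) 0).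
- by move=> k; have := integrable_funrpos measurableT (intf k).
- by rewrite le_max lexx orbT/= ge_max normr_ge0 ler_norm.
have [|k x|m2 [m20 hm2]] := @limit_one_sign (fun k x => Num.max (- f k x) 0).
- by move=> k; have := integrable_funrneg measurableT (intf k).
- by rewrite le_max lexx orbT/= ge_max normr_ge0 -normrN ler_norm.
exists m1, m2; split => // phi uphi bphi phi0.
have [B hB] := bphi.
have h1 := hm1 _ uphi bphi phi0; have h2 := hm2 _ uphi bphi phi0.
have mphi := measurable_ucont uphi.
rewrite (_ : (fun k => \int[leb2]_x (phi x * f k x)) =
  (fun k => \int[leb2]_x (phi x * Num.max (f k x) 0) - \int[leb2]_x (phi x * Num.max (- f k x) 0))).
  exact: cvgB.
apply/funext => k; rewrite -RintegralB//.
- congr (Rintegral _ _ _); apply/funext => x; rewrite -mulrBr; congr (_ * _).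
  by rewrite !maxElt; do 2 (case: ltP => ?); lra.
- have := integrable_funrpos measurableT (intf k) => h.
  by have := integrable_bounded_mul h mphi hB.
- have := integrable_funrneg measurableT (intf k) => h.
  by have := integrable_bounded_mul h mphi hB.
Qed.

End limit_measures.

(** * Pairings with test functions *)

Section pairing.
Context {R : realType}.
Notation T2 := (@T2 R).
Notation leb2 := (@leb2 R).

(** The transpose of [D2] under translations of the integration variable, as [Rintegral_D2]
    shows. *)
Definition Dm (phi : R * R -> R) (y z : R * R) : R :=
  phi y - phi (y.1 - z.1, y.2) - phi (y.1, y.2 - z.2) + phi (y.1 - z.1, y.2 - z.2).

Definition crect (a1 b1 a2 b2 k : R) : set T2 :=
  `[a1 + k, b1 - k] `*` `[a2 + k, b2 - k].

Lemma measurable_crect a1 b1 a2 b2 k : measurable (crect a1 b1 a2 b2 k).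
Proof. by apply: measurableX. Qed.

Lemma crectP a1 b1 a2 b2 k (x : R * R) : crect a1 b1 a2 b2 k x <->
  (a1 + k <= x.1 <= b1 - k) /\ (a2 + k <= x.2 <= b2 - k).
Proof. by rewrite /crect; split; case; rewrite /= !in_itv/=. Qed.

Lemma Rintegral_D2 (v phi : T2 -> R) (z : R * R) :
  leb2.-integrable setT (EFin \o v) -> measurable_fun setT phi ->
  (exists B, forall x, `|phi x| <= B) ->
  [/\ \int[leb2]_x (phi x * D2 v x z) = \int[leb2]_y (Dm phi y z * v y),
    leb2.-integrable setT (fun x => (phi x * D2 v x z)%:E) &
    leb2.-integrable setT (fun y => (Dm phi y z * v y)%:E)].
Proof.
move=> intv mphi [B hB].
have ms (d : R * R) : measurable_fun setT (fun y : T2 => phi (translate y d)).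
  exact: (measurableT_comp mphi (@measurable_translate R d)).
have I1 (d : R * R) : leb2.-integrable setT (fun y => (phi (translate y d) * v y)%:E).
  exact: (@integrable_bounded_mul _ _ _ _ _ intv (fun y => phi (translate y d)) B (ms d) (fun y => hB _)).
have tr (d : R * R) :
    \int[leb2]_x (phi x * v (translate x d)) = \int[leb2]_y (phi (translate y (- d.1, - d.2)) * v y) /\
    leb2.-integrable setT (fun x => (phi x * v (translate x d))%:E).
  have [h1 h2] := integral_trans2 d (I1 (- d.1, - d.2)).
  have e : (fun x : T2 => (phi (translate (x.1 + d.1, x.2 + d.2) (- d.1, - d.2)) * v (x.1 + d.1, x.2 + d.2))%:E)
      = (fun x => (phi x * v (translate x d))%:E).
    by apply/funext => -[x1 x2]; rewrite /translate/= !addrK.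
  by rewrite e in h1, h2; split => //; rewrite /Rintegral h1.
have [t0 i0] := tr (0, 0). have [t1 i1] := tr z.
have [t2 i2] := tr (z.1, 0). have [t3 i3] := tr (0, z.2).
have E0 x : translate x (0, 0) = x by case: x => ? ?; rewrite /translate/= !addr0.
have D2E : (fun x => phi x * D2 v x z) = (fun x => phi x * v (translate x z) - phi x * v (translate x (z.1, 0)) -
   phi x * v (translate x (0, z.2)) + phi x * v (translate x (0, 0))).
  apply/funext => x; rewrite E0 /D2 /translate/= !addr0; ring.
have DmE : (fun y => Dm phi y z * v y) = (fun y => phi (translate y (- z.1, - z.2)) * v y - phi (translate y (- z.1, 0)) * v y -
   phi (translate y (0, - z.2)) * v y + phi (translate y (0, 0)) * v y).
  apply/funext => y; rewrite E0 /Dm /translate/= !addr0; ring.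
have z0 : - (0 : R) = 0 by rewrite oppr0.
rewrite /= !z0 in t0 t1 t2 t3.
have sub (p q : T2 -> R) : leb2.-integrable setT (EFin \o p) -> leb2.-integrable setT (EFin \o q) ->
   leb2.-integrable setT (EFin \o (fun x => p x - q x)).
  by move=> ip iq; have := integrableB measurableT ip iq.
have add (p q : T2 -> R) : leb2.-integrable setT (EFin \o p) -> leb2.-integrable setT (EFin \o q) ->
   leb2.-integrable setT (EFin \o (fun x => p x + q x)).
  by move=> ip iq; have := integrableD measurableT ip iq.
split; last 2 first.
- have -> : (fun x => (phi x * D2 v x z)%:E) = EFin \o (fun x => phi x * D2 v x z) by [].
  by rewrite D2E; apply: (add _ _) => //; apply: (sub _ _) => //; apply: (sub _ _).
- have -> : (fun y => (Dm phi y z * v y)%:E) = EFin \o (fun y => Dm phi y z * v y) by [].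
  rewrite DmE; apply: (add _ _); first apply: (sub _ _); first apply: (sub _ _); exact: I1.
rewrite D2E DmE.
have four (p q r s : T2 -> R) : leb2.-integrable setT (EFin \o p) -> leb2.-integrable setT (EFin \o q) ->
    leb2.-integrable setT (EFin \o r) -> leb2.-integrable setT (EFin \o s) ->
    \int[leb2]_x (p x - q x - r x + s x) =
    \int[leb2]_x p x - \int[leb2]_x q x - \int[leb2]_x r x + \int[leb2]_x s x.
  move=> ip iq ir i_s; have ipq := sub _ _ ip iq; have ipqr := sub _ _ ipq ir.
  by rewrite (RintegralD measurableT ipqr i_s) (RintegralB measurableT ipq ir) (RintegralB measurableT ip iq).
by rewrite (four _ _ _ _ i1 i2 i3 i0) (four _ _ _ _ (I1 _) (I1 _) (I1 _) (I1 _)) t0 t1 t2 t3.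
Qed.

Variables (a1 b1 a2 b2 : R) (u : T2 -> R) (kap : R).
Hypothesis kap0 : 0 < kap.
Hypothesis mu : measurable_fun setT u.

(** Since u is only locally integrable, it is cut off to an integrable function with the same values
    at the corners of small cells based in the rectangle of margin 2 kap. *)
Definition trunc_u (x : T2) : R := \1_(crect a1 b1 a2 b2 kap) x * u x.

Hypothesis int_trunc : leb2.-integrable setT (EFin \o trunc_u).

Lemma D2_trunc (x z : R * R) : crect a1 b1 a2 b2 (2 * kap) x ->
  0 <= z.1 <= kap -> 0 <= z.2 <= kap -> D2 u x z = D2 trunc_u x z.
Proof.
move=> /crectP[/andP[h1 h2] /andP[h3 h4]] /andP[z1 z1k] /andP[z2 z2k].
have e (y : R * R) : x.1 <= y.1 <= x.1 + kap -> x.2 <= y.2 <= x.2 + kap -> trunc_u y = u y.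
  move=> /andP[? ?] /andP[? ?]; rewrite /trunc_u indicE mem_set ?mul1r//.
  by apply/crectP; split; apply/andP; split; lra.
by rewrite /D2 !e//=; apply/andP; split; lra.
Qed.

Variables (e : nat -> R) (z : nat -> R * R).
Hypothesis e_gt0 : forall k, 0 < e k.
Hypothesis e_cvg : e @ \oo --> 0.
Hypothesis z1_gt0 : forall k, 0 < (z k).1.
Hypothesis z2_gt0 : forall k, 0 < (z k).2.
Hypothesis ze : forall k, enorm (z k) <= e k.

Lemma z_le k : (z k).1 <= e k /\ (z k).2 <= e k.
Proof.
have [] := enorm_ge (z k); rewrite !gtr0_norm// => h1 h2.
by split; [exact: le_trans h1 (ze k)|exact: le_trans h2 (ze k)].
Qed.

(** Discrete integration by parts, then dominated convergence. The limit g of the quotients is left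
    general to serve both smooth tests, where it is the mixed derivative, and trapezoidal kernels,
    where it is a mixed difference of an indicator. *)
Lemma pairing_cvg (phi g : T2 -> R) (B : R) :
  measurable_fun setT phi -> (exists B', forall x, `|phi x| <= B') ->
  (forall x, ~ crect a1 b1 a2 b2 (2 * kap) x -> phi x = 0) ->
  (forall k y, `|Dm phi y (z k) / ((z k).1 * (z k).2)| <= B) ->
  (forall y, (fun k => Dm phi y (z k) / ((z k).1 * (z k).2)) @ \oo --> g y) ->
  (fun k => \int[leb2]_x (phi x * dens a1 b1 a2 b2 u (e k) (z k) x)) @ \oo -->
    \int[leb2]_y (g y * trunc_u y).
Proof.
move=> mphi bphi phi0 qB qg.
pose q k y := Dm phi y (z k) / ((z k).1 * (z k).2).
have mq k : measurable_fun setT (q k : T2 -> R).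
  apply: measurable_funM => //.
  have ms (d : R * R) : measurable_fun setT (fun y : T2 => phi (translate y d)).
    exact: (measurableT_comp mphi (@measurable_translate R d)).
  rewrite (_ : Dm phi ^~ (z k) = (fun y => phi y - phi (translate y (- (z k).1, 0)) -
    phi (translate y (0, - (z k).2)) + phi (translate y (- (z k).1, - (z k).2)))); last first.
    by apply/funext => y; rewrite /Dm /translate/= !addr0.
  by apply: measurable_funD => //; apply: measurable_funB => //; apply: measurable_funB.
have mg : measurable_fun setT g by apply: (measurable_fun_cvg mq) => y _; exact: qg.
have mv : measurable_fun setT trunc_u by apply/measurable_EFinP; exact: measurable_int int_trunc.
(* Once e k < kap / 2, phi lives where the indicator in [dens] equals 1, and the cells based there
   do not feel the cut-off. *)
have near_eq : \forall k \near \oo, \int[leb2]_y (q k y * trunc_u y) =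
    \int[leb2]_x (phi x * dens a1 b1 a2 b2 u (e k) (z k) x).
  have k2 : 0 < kap / 2 by rewrite divr_gt0.
  move/cvgrPdist_lt : e_cvg => /(_ _ k2); apply: filterS => k.
  rewrite sub0r normrN gtr0_norm// => ek.
  have [z1e z2e] := z_le k.
  pose s := ((z k).1 * (z k).2)^-1.
  have [eqD intD' intD] := Rintegral_D2 (z k) int_trunc mphi bphi.
  transitivity (\int[leb2]_y (s * (Dm phi y (z k) * trunc_u y))).
    by congr (Rintegral _ _ _); apply/funext => y; rewrite /q /s; ring.
  rewrite RintegralZl// -eqD.
  transitivity (\int[leb2]_x (s * (phi x * D2 trunc_u x (z k)))).
    by rewrite RintegralZl.
  congr (Rintegral _ _ _); apply/funext => x.
  have [Kx|nKx] := pselect (crect a1 b1 a2 b2 (2 * kap) x); last first.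
    by rewrite phi0// !mul0r mulr0.
  rewrite -D2_trunc//; last 2 first.
  - by rewrite (ltW (z1_gt0 k))/=; lra.
  - by rewrite (ltW (z2_gt0 k))/=; lra.
  rewrite /dens indicE mem_set ?mul1r; first by rewrite /s; ring.
  have e20 : 0 < 2 * e k by rewrite mulr_gt0.
  apply/(box_epsP _ _ _ _ _ e20); move: Kx => /crectP[/andP[? ?] /andP[? ?]].
  by split; apply/andP; split; lra.
apply: cvg_trans (near_eq_cvg near_eq) _.
have intB : leb2.-integrable setT (fun x => B%:E * `|(trunc_u x)%:E|)%E.
  by apply: integrableZl => //; exact: integrable_abse.
have [|| |||intg _ cv] := @dominated_convergence _ _ _ leb2 setT measurableT
   (fun k y => (q k y * trunc_u y)%:E) (fun y => (g y * trunc_u y)%:E) (fun x => B%:E * `|(trunc_u x)%:E|)%E.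
- by move=> k; apply/measurable_EFinP; exact: measurable_funM.
- by apply/measurable_EFinP; exact: measurable_funM.
- apply: aeW => y _; apply: cvg_EFin; first by apply: nearW.
  by apply: cvgMl; exact: qg.
- exact: intB.
- by apply: aeW => y k _; rewrite /= -EFinM lee_fin normrM ler_wpM2r//; exact: qB.
apply: fine_cvg; rewrite fineK; last exact: (integrable_fin_num measurableT intg).
exact: cv.
Qed.

End pairing.

(** * Smooth test functions *)

Section smooth_tests.
Context {R : realType}.

Lemma slice_is_derive (b : bool) (f : R * R -> R) (p : R * R) (t : R) :
  derivable f (if b then (t, p.2) else (p.1, t)) (dir b) ->
  is_derive t 1 (fun s => f (if b then (s, p.2) else (p.1, s)))
    (derive f (if b then (t, p.2) else (p.1, t)) (dir b)).
Proof.
move=> df.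
have e : (fun h : R => h^-1 *: (f (h *: dir b + (if b then (t, p.2) else (p.1, t))) - f (if b then (t, p.2) else (p.1, t)))) =
   (fun h : R => h^-1 *: ((fun s => f (if b then (s, p.2) else (p.1, s))) (h *: 1 + t) - (fun s => f (if b then (s, p.2) else (p.1, s))) t)).
  apply/funext => h; congr (_ *: (f _ - _)).
  by case: b {df} => /=; rewrite [LHS]surjective_pairing /= ?scaler0 ?add0r.
split; last by rewrite /derive e.
by move: df; rewrite /derivable e.
Qed.

Lemma MVT_partial (b : bool) (f : R * R -> R) (p : R * R) (s t : R) : s <= t ->
  (forall x, derivable f x (dir b)) ->
  exists2 w, s <= w <= t & f (if b then (t, p.2) else (p.1, t)) - f (if b then (s, p.2) else (p.1, s)) =
    derive f (if b then (w, p.2) else (p.1, w)) (dir b) * (t - s).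
Proof.
move=> st df.
have dg (x : R) : is_derive x 1 (fun s => f (if b then (s, p.2) else (p.1, s)))
    (derive f (if b then (x, p.2) else (p.1, x)) (dir b)).
  by apply: slice_is_derive.
have [|w] := @MVT_segment R _ _ s t st (fun x _ => dg x).
  by apply: derivable_within_continuous => x _; have [] := dg x.
by rewrite in_itv/= => sw e; exists w.
Qed.

Lemma compact_sub_crect (a1 b1 a2 b2 : R) (K : set (R * R)) : a1 < b1 -> a2 < b2 ->
  compact K -> K `<=` box a1 b1 a2 b2 ->
  exists2 kap, 0 < kap & K `<=` crect a1 b1 a2 b2 (2 * kap).
Proof.
move=> ab1 ab2 cK Kbox.
have [K0|/set0P K0] := eqVneq K set0; first by exists 1 => //; rewrite K0.
have ext (f : R * R -> R) (l : R) : continuous f -> (forall p, K p -> l < f p) ->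
    exists2 k, 0 < k & forall p, K p -> l + 2 * k <= f p.
  move=> cf lf.
  have [|c Kc hc] := @compact_EVT_min _ R f K K0 cK; first exact: continuous_subspaceT.
  exists ((f c - l) / 2); first by rewrite divr_gt0// subr_gt0 lf// -in_setE.
  by move=> p Kp; have := hc p; rewrite inE => /(_ Kp); lra.
have c1 : continuous (fst : R * R -> R) by move=> p; exact: cvg_fst.
have c2 : continuous (snd : R * R -> R) by move=> p; exact: cvg_snd.
have b p : K p -> (a1 < p.1 < b1) /\ (a2 < p.2 < b2) by move=> /Kbox /boxP.
have [k1 k10 h1] := ext _ a1 c1 (fun p Kp => (andP (b p Kp).1).1).
have [k2 k20 h2] := ext _ a2 c2 (fun p Kp => (andP (b p Kp).2).1).
have c3 : continuous (fun p : R * R => - p.1) by move=> p; apply: cvgN; exact: c1.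
have c4 : continuous (fun p : R * R => - p.2) by move=> p; apply: cvgN; exact: c2.
have [|k3 k30 h3] := ext _ (- b1) c3; first by move=> p Kp; rewrite ltrN2; case: (b p Kp) => /andP[].
have [|k4 k40 h4] := ext _ (- b2) c4; first by move=> p Kp; rewrite ltrN2; case: (b p Kp) => _ /andP[].
exists (Num.min (Num.min k1 k2) (Num.min k3 k4)); first by rewrite !lt_min k10 k20 k30.
move=> p Kp; apply/crectP; have := h1 p Kp; have := h2 p Kp; have := h3 p Kp; have := h4 p Kp.
set m := Num.min _ _.
have : m <= k1 /\ m <= k2 /\ m <= k3 /\ m <= k4 by rewrite /m !ge_min !lexx ?orbT.
by move=> [? [? [? ?]]] ? ? ? ?; split; apply/andP; split; lra.
Qed.

Lemma continuous_supp_bounded (f : R * R -> R) (K : set (R * R)) : continuous f -> compact K ->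
  (forall p, ~ K p -> f p = 0) -> exists B, forall p, `|f p| <= B.
Proof.
move=> cf cK f0.
have cKf : compact (f @` K) by apply: continuous_compact => //; exact: continuous_subspaceT.
have [M [_ hM]] := compact_bounded cKf.
exists (`|M| + 1) => p; have [Kp|/f0 ->] := pselect (K p); last by rewrite normr0 addr_ge0.
by apply: (hM (`|M| + 1)); [rewrite (le_lt_trans (ler_norm M))// ltrDl|exists p].
Qed.

Lemma iter_pd_supp (f : R * R -> R) (K : set (R * R)) s : compact K ->
  (forall p, ~ K p -> f p = 0) -> forall p, ~ K p -> iter_pd s f p = 0.
Proof.
move=> cK f0; have clK : closed K by apply: compact_closed => //; exact: norm_hausdorff.
elim: s => [|b s ih] //= p Kp.
have oK : open (~` K) by rewrite openC.
rewrite (@near_eq_derive _ _ _ _ (cst 0)) ?derive_cst//.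
by have := open_nbhs_nbhs (conj oK Kp); apply: filterS => q /ih.
Qed.

(** Two mean value theorems: first in the second variable, for the difference of two slices, then in
    the first variable, for the partial derivative. *)
Lemma Dm_mean (phi : R * R -> R) (y z : R * R) : smooth phi -> 0 <= z.1 -> 0 <= z.2 ->
  exists w : R * R, [/\ y.1 - z.1 <= w.1 <= y.1, y.2 - z.2 <= w.2 <= y.2 &
    Dm phi y z = d12 phi w * (z.1 * z.2)].
Proof.
move=> sphi z1 z2.
pose A (p : R * R) := phi (y.1, p.2) - phi (y.1 - z.1, p.2).
have dp b := (sphi [::]).2 b. have dq b := (sphi [:: false]).2 b.
have dA (x : R) : is_derive x 1 (fun t => phi (y.1, t) - phi (y.1 - z.1, t))
    (iter_pd [:: false] phi (y.1, x) - iter_pd [:: false] phi (y.1 - z.1, x)).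
  have h1 := @slice_is_derive false phi y x (dp false (y.1, x)).
  have h2 := @slice_is_derive false phi (y.1 - z.1, y.2) x (dp false (y.1 - z.1, x)).
  exact: is_deriveB.
have [||w2 w2i eA] := @MVT_segment R (fun t => phi (y.1, t) - phi (y.1 - z.1, t)) _ (y.2 - z.2) y.2 _ (fun x _ => dA x).
- by rewrite lerBlDr lerDl.
- by apply: derivable_within_continuous => x _; have [] := dA x.
have [|w1 w1i eB] := @MVT_partial true (iter_pd [:: false] phi) (y.1, w2) (y.1 - z.1) y.1 _ (dq true).
  by rewrite lerBlDr lerDl.
exists (w1, w2); split; [exact: w1i|by move: w2i; rewrite in_itv|].
rewrite /= in eB eA.
have -> : Dm phi y z = phi (y.1, y.2) - phi (y.1 - z.1, y.2) - (phi (y.1, y.2 - z.2) - phi (y.1 - z.1, y.2 - z.2)).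
  by rewrite /Dm; case: y {A dA eA eB w1i w2i} => y1 y2 /=; ring.
rewrite eA eB /d12/=; ring.
Qed.

Lemma lip_partial (b : bool) (f : R * R -> R) (B : R) (p : R * R) (s t : R) :
  (forall x, derivable f x (dir b)) -> (forall x, `|derive f x (dir b)| <= B) ->
  `|f (if b then (t, p.2) else (p.1, t)) - f (if b then (s, p.2) else (p.1, s))| <= B * `|t - s|.
Proof.
move=> df dB; wlog st : s t / s <= t.
  move=> H; have [st|/ltW ts] := leP s t; first exact: H.
  by rewrite distrC (distrC t s); exact: H.
have [w _ ->] := MVT_partial p st df.
by rewrite normrM ler_wpM2r.
Qed.

(** The first partial derivatives are continuous and vanish off K, hence are bounded, and phi is
    Lipschitz in each variable. *)
Lemma smooth_ucont (phi : R * R -> R) (K : set (R * R)) : smooth phi -> compact K ->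
  (forall p, ~ K p -> phi p = 0) -> ucont phi.
Proof.
move=> sphi cK phi0.
have bd b : exists B, forall p, `|derive phi p (dir b)| <= B.
  apply: (@continuous_supp_bounded (iter_pd [:: b] phi) K (sphi [:: b]).1 cK).
  exact: iter_pd_supp.
have [B1 hB1] := bd true. have [B2 hB2] := bd false.
have B10 : 0 <= B1 by apply: le_trans (hB1 (0, 0)).
have B20 : 0 <= B2 by apply: le_trans (hB2 (0, 0)).
have S0 : 0 < B1 + B2 + 1 by rewrite ltr_wpDl// addr_ge0.
move=> e e0; exists (e / (B1 + B2 + 1)); first exact: divr_gt0.
move=> p q h1 h2.
have l1 := @lip_partial true phi B1 p q.1 p.1 ((sphi [::]).2 true) hB1.
have l2 := @lip_partial false phi B2 (q.1, p.2) q.2 p.2 ((sphi [::]).2 false) hB2.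
rewrite /= in l1 l2.
rewrite (_ : phi p - phi q = (phi (p.1, p.2) - phi (q.1, p.2)) + (phi (q.1, p.2) - phi (q.1, q.2))); last first.
  by case: p {h1 h2 l1 l2} => ? ?; case: q => ? ? /=; ring.
apply: le_trans (ler_normD _ _) _; apply: le_trans (lerD l1 l2) _.
apply: (@le_trans _ _ ((B1 + B2) * (e / (B1 + B2 + 1)))).
  by rewrite mulrDl lerD// ler_wpM2l.
rewrite mulrA ler_pdivrMr// mulrC ler_wpM2l ?(ltW e0)//; lra.
Qed.

Lemma smooth_iter_pd s (phi : R * R -> R) : smooth phi -> smooth (iter_pd s phi).
Proof.
move=> sphi t; have -> : iter_pd t (iter_pd s phi) = iter_pd (t ++ s) phi.
  by elim: t => //= b t ->.
exact: sphi.
Qed.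

End smooth_tests.


(** * Cells and trapezoids *)

Section trapezoids.
Context {R : realType}.
Notation T2 := (@T2 R).
Notation leb := (@lebesgue_measure R).
Notation leb2 := (@leb2 R).

Definition clamp (al be t : R) : R := Num.min (Num.max t al) be.

Lemma clampP al be t : al <= be ->
  [\/ t <= al /\ clamp al be t = al, al <= t <= be /\ clamp al be t = t |
      be <= t /\ clamp al be t = be].
Proof.
move=> ab; rewrite /clamp; have [ta|/ltW ta] := leP t al.
  by constructor 1; rewrite min_l.
have [tb|/ltW tb] := leP t be; first by constructor 2; rewrite ta.
by constructor 3.
Qed.

Local Ltac clamp_cases t ab := case: (clampP t ab) => [[? ->]|[/andP[? ?] ->]|[? ->]].

Lemma clamp_lip al be s t : al <= be -> s <= t -> 0 <= clamp al be t - clamp al be s <= t - s.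
Proof.
move=> ab st; apply/andP.
by clamp_cases s ab; clamp_cases t ab; split; lra.
Qed.

(* The convolution of the indicators of ]al, be] and ]0, ze]. *)
Definition trap (al be ze t : R) : R := clamp al be t - clamp al be (t - ze).

Definition hoind (al be t : R) : R := \1_(`]al, be] : set R) t.

Lemma hoindE al be t : hoind al be t = (al < t <= be)%R%:R.
Proof.
rewrite /hoind indicE; congr (nat_of_bool _)%:R.
by apply/idP/idP; rewrite inE/= in_itv.
Qed.

Lemma trap_lip al be ze s t : al <= be -> `|trap al be ze t - trap al be ze s| <= 2 * `|t - s|.
Proof.
move=> ab; wlog st : s t / s <= t.
  move=> H; have [st|/ltW ts] := leP s t; first exact: H.
  by rewrite distrC (distrC t s); exact: H.
have /andP[? ?] := clamp_lip ab st.
have st' : s - ze <= t - ze by rewrite lerD2r.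
have /andP[? ?] := clamp_lip ab st'.
by rewrite (ger0_norm (_ : 0 <= t - s)) ?subr_ge0// ler_norml /trap; apply/andP; split; lra.
Qed.

Lemma trap_itv al be ze t : al <= be -> 0 <= ze -> 0 <= trap al be ze t <= ze.
Proof.
move=> ab z0; have h : t - ze <= t by rewrite lerBlDr lerDl.
by have /andP[? ?] := clamp_lip ab h; rewrite /trap; apply/andP; split; lra.
Qed.

Lemma trap_out al be ze t : al <= be -> 0 <= ze -> ~ (al < t <= be + ze) -> trap al be ze t = 0.
Proof.
move=> ab z0 /negP; rewrite negb_and -leNgt -ltNge /trap => /orP[] h;
by clamp_cases t ab; clamp_cases (t - ze) ab; lra.
Qed.

Lemma trap_full al be ze t : al <= be -> 0 <= ze -> al + ze <= t <= be -> trap al be ze t = ze.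
Proof.
move=> ab z0 /andP[? ?]; rewrite /trap.
by clamp_cases t ab; clamp_cases (t - ze) ab; lra.
Qed.

(** The backward quotient is eventually exact even at the end points al and be; this dictates
    intervals open on the left and closed on the right. *)
Lemma clamp_quot al be t (h : nat -> R) : al <= be -> (forall k, 0 < h k) -> h @ \oo --> 0 ->
  \forall k \near \oo, clamp al be t - clamp al be (t - h k) = hoind al be t * h k.
Proof.
move=> ab h0 hc.
have sm (d : R) : 0 < d -> \forall k \near \oo, h k < d.
  by move=> d0; move/cvgrPdist_lt : hc => /(_ _ d0); apply: filterS => k; rewrite sub0r normrN gtr0_norm.
have [ta|ta] := leP t al.
  apply: nearW => k; rewrite hoindE ltNge ta/= mul0r; have := h0 k => ?.
  by clamp_cases t ab; clamp_cases (t - h k) ab; lra.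
have [tb|tb] := leP t be.
  have := sm (t - al); rewrite subr_gt0 => /(_ ta); apply: filterS => k hk.
  rewrite hoindE ta tb mul1r; have := h0 k => ?.
  by clamp_cases t ab; clamp_cases (t - h k) ab; lra.
have := sm (t - be); rewrite subr_gt0 => /(_ tb); apply: filterS => k hk.
rewrite hoindE ta leNgt tb mul0r; have := h0 k => ?.
by clamp_cases t ab; clamp_cases (t - h k) ab; lra.
Qed.

(** If |p| <= tau, then p + a stays below the level 2 tau and the truncation keeps the jump.
    Otherwise monotonicity and the Lipschitz bound of the truncation leave a loss of at most b. *)
Lemma clamp_ge (tau p p' a b : R) : 0 < tau -> 0 <= a <= tau -> 0 <= b -> a - b <= p' - p ->
  a * (`|p| <= tau)%R%:R - b <= clamp (- (2 * tau)) (2 * tau) p' - clamp (- (2 * tau)) (2 * tau) p.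
Proof.
move=> t0 /andP[a0 a1] b0 h; have t2 : - (2 * tau) <= 2 * tau by lra.
have [|] := leP `|p| tau; rewrite ?ler_norml ?mulr1 ?mulr0.
  move=> /andP[? ?].
  by clamp_cases p' t2; clamp_cases p t2; lra.
move=> _.
by clamp_cases p' t2; clamp_cases p t2; lra.
Qed.

Lemma clamp_norm_le (t x : R) : 0 <= t -> `|clamp (- t) t x| <= t.
Proof.
move=> t0; rewrite ler_norml; have t2 : - t <= t by lra.
by apply/andP; clamp_cases x t2; split; lra.
Qed.

Lemma measurable_clamp (al be : R) (f : T2 -> R) : measurable_fun setT f ->
  measurable_fun setT (fun x => clamp al be (f x)).
Proof.
move=> mf; apply: measurable_minr => //; exact: measurable_maxr.
Qed.

Lemma leb_clamp al be t : al <= be -> leb (`]al, be] `&` `]-oo, t[) = (clamp al be t - al)%:E.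
Proof.
move=> ab; have [ta|ta] := leP t al.
  rewrite (_ : _ `&` _ = set0) ?measure0.
    by congr (_%:E); clamp_cases t ab; lra.
  by apply/seteqP; split => // x /=; rewrite !in_itv/= => -[/andP[? ?] ?]; lra.
have [tb|tb] := leP t be.
  rewrite (_ : _ `&` _ = `]al, t[%classic).
    rewrite lebesgue_measure_itv/= lte_fin ta -EFinB; congr (_%:E).
    by clamp_cases t ab; lra.
  apply/seteqP; split => x /=; rewrite !in_itv/=; first by move=> [/andP[-> _] ->].
  by move=> /andP[-> xt]; split => //; rewrite ltW// (lt_le_trans xt).
rewrite (_ : _ `&` _ = `]al, be]%classic).
  rewrite lebesgue_measure_itv/= lte_fin; case: ltP => ?; rewrite -?EFinB; congr (_%:E);
  by clamp_cases t ab; lra.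
apply/seteqP; split => x /=; rewrite !in_itv/=; first by move=> [-> _].
by move=> /andP[-> xb]; split => //; exact: le_lt_trans tb.
Qed.

(** The set consists of the positions s in ]al, be] for which t lies in ]s, s + ze]. *)
Lemma leb_trap al be ze t : al <= be -> 0 <= ze ->
  leb (`]al, be] `&` `[t - ze, t[) = (trap al be ze t)%:E.
Proof.
move=> ab z0.
have mA s : measurable (`]al, be] `&` `]-oo, s[ : set (measurableTypeR R)) by exact: measurableI.
have -> : `]al, be] `&` `[t - ze, t[ = (`]al, be] `&` `]-oo, t[) `\` (`]al, be] `&` `]-oo, t - ze[).
  apply/seteqP; split => x /=; rewrite !in_itv/=.
    by move=> [-> /andP[h ->]]; split => // -[_]; rewrite ltNge h.
  move=> [[-> xt] h]; split => //; rewrite xt andbT leNgt; apply/negP => h'; exact: h.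
rewrite measureD//; last first.
  apply: (@le_lt_trans _ _ (clamp al be t - al)%:E); last exact: ltry.
  by rewrite -(leb_clamp t ab).
rewrite (_ : _ `&` (_ `&` _) = `]al, be] `&` `]-oo, t - ze[).
  transitivity ((clamp al be t - al)%:E - (clamp al be (t - ze) - al)%:E)%E.
    by congr (_ - _)%E; exact: leb_clamp.
  by rewrite -EFinB /trap; congr (_%:E); ring.
apply/seteqP; split => x /=; rewrite !in_itv/=; first by move=> [_ []].
by move=> [h1 h2]; split => //; split => //; apply: lt_le_trans h2 _; rewrite lerBlDr lerDl.
Qed.

Definition hocell (s ze : R * R) : set T2 := `]s.1, s.1 + ze.1] `*` `]s.2, s.2 + ze.2].

Lemma hocellP s ze (x : R * R) : hocell s ze x <->
  (s.1 < x.1 <= s.1 + ze.1) /\ (s.2 < x.2 <= s.2 + ze.2).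
Proof. by rewrite /hocell; split; case; rewrite /= !in_itv/=. Qed.

Definition horect (al be : R * R) : set T2 := `]al.1, be.1] `*` `]al.2, be.2].

Lemma horectP al be (x : R * R) : horect al be x <->
  (al.1 < x.1 <= be.1) /\ (al.2 < x.2 <= be.2).
Proof. by rewrite /horect; split; case; rewrite /= !in_itv/=. Qed.

Lemma measurable_horect al be : measurable (horect al be).
Proof. exact: measurableX. Qed.

Lemma measurable_hocell s ze : measurable (hocell s ze).
Proof. exact: measurableX. Qed.

Definition cellrel (ze : R * R) : set (T2 * T2) := [set xs | hocell xs.2 ze xs.1].

Lemma measurable_cellrel ze : measurable (cellrel ze).
Proof.
have [m11 m12 m21 m22] := @measurable_coords R.
have lt (f g : T2 * T2 -> R) : measurable_fun setT f -> measurable_fun setT g ->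
    measurable [set x | f x < g x].
  move=> mf mg; have := measurable_fun_ltr mf mg => /(_ measurableT [set true] I).
  by rewrite setTI.
have le (f g : T2 * T2 -> R) : measurable_fun setT f -> measurable_fun setT g ->
    measurable [set x | f x <= g x].
  by move=> mf mg; have := measurable_fun_le measurableT mf mg; rewrite setTI.
have -> : cellrel ze = ([set x | x.2.1 < x.1.1] `&` [set x | x.1.1 <= x.2.1 + ze.1]) `&`
     ([set x | x.2.2 < x.1.2] `&` [set x | x.1.2 <= x.2.2 + ze.2]).
  apply/seteqP; split => x /=.
    by rewrite /cellrel/= => /hocellP[/andP[? ?] /andP[? ?]].
  by move=> [[h1 h2] [h3 h4]]; rewrite /cellrel/=; apply/hocellP; rewrite h1 h2 h3 h4.
apply: measurableI; apply: measurableI.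
- exact: lt.
- by apply: le => //; exact: measurable_funD.
- exact: lt.
- by apply: le => //; exact: measurable_funD.
Qed.

Variable m : finmeas R.

Lemma measurable_cellmass (E : set T2) ze : measurable E ->
  measurable_fun setT (fun s : T2 => m (hocell s ze `&` E)).
Proof.
move=> mE.
have mS : measurable (cellrel ze `&` (E `*` setT)).
  by apply: measurableI; [exact: measurable_cellrel|exact: measurableX].
rewrite (_ : (fun s => _) = m \o ysection (cellrel ze `&` (E `*` setT))).
  exact: measurable_fun_ysection.
apply/funext => s /=; congr (m _); apply/seteqP; split => x.
  by move=> [h1 h2]; rewrite /ysection/= inE.
by rewrite /ysection/= inE => -[h1 [h2 _]].
Qed.

(** Tonelli on the incidence relation between points and the lower left corners of the cells
    containing them. *)
Lemma integral_cellmass (E : set T2) (f : T2 -> \bar R) ze : measurable E ->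
  measurable_fun setT f -> (forall s, 0 <= f s)%E ->
  (\int[leb2]_s (f s * m (hocell s ze `&` E)) =
   \int[m]_(x in E) \int[leb2]_s (f s * (\1_(hocell s ze) x)%:E))%E.
Proof.
move=> mE mf f0.
pose F (xs : T2 * T2) : \bar R := (f xs.2 * (\1_(cellrel ze `&` (E `*` setT)) xs)%:E)%E.
have mS : measurable (cellrel ze `&` (E `*` setT)).
  by apply: measurableI; [exact: measurable_cellrel|exact: measurableX].
have mF : measurable_fun setT F.
  apply: emeasurable_funM; first exact: measurableT_comp.
  by apply/measurable_EFinP; exact: measurable_indic.
have F0 xs : (0 <= F xs)%E by rewrite mule_ge0// lee_fin.
have := fubini_tonelli (m1 := m) (m2 := leb2) F mF F0.
have -> : (\int[m]_x \int[leb2]_s F (x, s) = \int[m]_(x in E) \int[leb2]_s (f s * (\1_(hocell s ze) x)%:E))%E.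
  rewrite [RHS]integral_mkcond; congr (integral _ _ _); apply/funext => x; rewrite patchE.
  case: ifPn => xE.
    congr (integral _ _ _); apply/funext => s; rewrite /F /= !indicE; congr (_ * (nat_of_bool _)%:R%:E)%E.
    by apply/idP/idP; rewrite !inE; [case|move=> h; split => //; split => //; rewrite -in_setE].
  apply: integral0_eq => s _; rewrite /F indicE memNset ?mule0// => -[_ [/= h _]].
  by move: xE; rewrite notin_setE.
move=> ->; congr (integral _ _ _); apply/funext => s; rewrite /F /=.
rewrite ge0_integralZl//; last first.
  by apply/measurable_EFinP; apply: (measurableT_comp (measurable_indic mS)); exact: pair2_measurable.
congr (_ * _)%E.
rewrite (_ : (fun x => _) = (fun x => (\1_(hocell s ze `&` E) x)%:E)).
  by rewrite integral_indic ?setIT//; apply: measurableI => //; exact: measurable_hocell.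
apply/funext => x; rewrite !indicE; congr (nat_of_bool _)%:R%:E.
by apply/idP/idP; rewrite !inE => -[h1]; [case|].
Qed.

End trapezoids.

(** * Comparison of finite measures on half-open rectangles *)

Section comparison.
Context {R : realType}.
Notation T2 := (@T2 R).

Lemma measure_le_bigcup (a b : {measure set T2 -> \bar R}) (F : nat -> set T2) :
  (forall n, measurable (F n)) -> (forall n m, (n <= m)%N -> F n `<=` F m) ->
  (forall n, a (F n) <= b (F n))%E -> (a (\bigcup_n F n) <= b (\bigcup_n F n))%E.
Proof.
move=> mF ndF ab; have mU : measurable (\bigcup_n F n) by exact: bigcup_measurable.
have nd : {homo F : n m / (n <= m)%N >-> (n <= m)%O} by move=> n m nm; apply/subsetPset; exact: ndF.
have ca := nondecreasing_cvg_mu (mu := a) mF mU nd; have cb := nondecreasing_cvg_mu (mu := b) mF mU nd.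
by apply: (lee_cvg_to ca cb); exact: nearW.
Qed.

Lemma measure_le_bigcap (a b : finmeas R) (F : nat -> set T2) :
  (forall n, measurable (F n)) -> (forall n m, (n <= m)%N -> F m `<=` F n) ->
  (forall n, a (F n) <= b (F n))%E -> (a (\bigcap_n F n) <= b (\bigcap_n F n))%E.
Proof.
move=> mF ndF ab; have mU : measurable (\bigcap_n F n) by exact: bigcap_measurable.
have nd : {homo F : n m / (n <= m)%N >-> (m <= n)%O} by move=> n m nm; apply/subsetPset; exact: ndF.
have fin (m : finmeas R) : (m (F 0%N) < +oo)%E by exact: finite_lty.
have ca := nonincreasing_cvg_mu (fin a) mF mU nd; have cb := nonincreasing_cvg_mu (fin b) mF mU nd.
by apply: (lee_cvg_to ca cb); exact: nearW.
Qed.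

Definition rr (k : nat) : R := k.+1%:R^-1.

Lemma rr_gt0 k : 0 < rr k. Proof. by rewrite invr_gt0. Qed.

Lemma rr_le k l : (k <= l)%N -> rr l <= rr k.
Proof. by move=> kl; rewrite lef_pV2 ?posrE// ler_nat. Qed.

Lemma rr_near (d : R) : 0 < d -> \forall k \near \oo, rr k < d.
Proof. by move=> d0; exact: (near_infty_natSinv_lt (PosNum d0)). Qed.

Lemma rr_small (d : R) : 0 < d -> exists k, rr k < d.
Proof. by move=> /rr_near[n _ /(_ n (leqnn n)) h]; exists n. Qed.

(** A dyadic square [l, r[ is, in each coordinate, a decreasing intersection over n of increasing
    unions over m of ]l - 1/(n+1), r - 1/(m+1)]; continuity of the measures reduces the claim to
    dyadic squares. *)
Lemma measure_le_horects (a b : finmeas R) :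
  (forall lo hi : R * R, (a (horect lo hi) <= b (horect lo hi))%E) ->
  forall B : set T2, measurable B -> (a B <= b B)%E.
Proof.
move=> ab B mB.
have h2 j k : (a (dsq j k) <= b (dsq j k))%E.
  rewrite dsqE; set l1 := _ / _; set r1 := _ / _; set l2 := _ / _; set r2 := _ / _.
  pose G n m := horect (l1 - rr n, l2 - rr n) (r1 - rr m, r2 - rr m).
  have -> : (`[l1, r1[ `*` `[l2, r2[ = \bigcap_n \bigcup_m G n m :> set T2)%classic.
    apply/seteqP; split => x /=.
      rewrite !in_itv/= => -[/andP[? ?] /andP[? ?]] n _.
      have d0 : 0 < Num.min (r1 - x.1) (r2 - x.2) by rewrite lt_min !subr_gt0; apply/andP.
      have [m] := rr_small d0; rewrite lt_min => /andP[? ?].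
      have := rr_gt0 n => ?; exists m => //; apply/horectP => /=.
      by split; apply/andP; split; lra.
    move=> H; rewrite !in_itv/=; have [m _ /horectP/=[/andP[_ ?] /andP[_ ?]]] := H 0%N I.
    have := rr_gt0 m => ?.
    have le (l : R) y : (forall n, l - rr n < y) -> l <= y.
      move=> Hn; rewrite leNgt; apply/negP => yl; have [|n hn] := @rr_small (l - y); first by rewrite subr_gt0.
      by have := Hn n; lra.
    by split; apply/andP; split; (lra || (apply: le => n; have [m' _ /horectP/=[/andP[? _] /andP[? _]]] := H n I)).
  apply: measure_le_bigcap.
  - by move=> n; apply: bigcup_measurable => m _; exact: measurable_horect.
  - move=> n m nm x [i _ /horectP/=[/andP[? r3] /andP[? r4]]]; exists i => //.
    by have := rr_le nm => ?; apply/horectP; rewrite /= r3 r4; split; apply/andP; split => //; lra.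
  - move=> n; apply: measure_le_bigcup.
    + by move=> m; exact: measurable_horect.
    + move=> i m nm x /horectP/=[/andP[l3 ?] /andP[l4 ?]].
      by have := rr_le nm => ?; apply/horectP; rewrite /= l3 l4; split; apply/andP; split => //; lra.
    + by move=> m; exact: ab.
exact: (measure_le_dsq (finite_lty a measurableT) (finite_lty b measurableT) h2 mB).
Qed.

(** The local estimates need a margin to the sides of the box; the trace of any rectangle on the
    open box is an increasing union of rectangles with such a margin. *)
Lemma measure_le_horect (a b : finmeas R) (a1 b1 a2 b2 : R) :
  (forall lo hi : R * R, a1 < lo.1 -> hi.1 < b1 -> a2 < lo.2 -> hi.2 < b2 ->
    (a (horect lo hi) <= b (horect lo hi))%E) ->
  forall B : set T2, measurable B -> B `<=` box a1 b1 a2 b2 -> (a B <= b B)%E.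
Proof.
move=> ab B mB Bbox.
have mbox : measurable (box a1 b1 a2 b2 : set T2) by apply: measurableX.
have [a' [a'E _]] := restrict_finite a mbox. have [b' [b'E _]] := restrict_finite b mbox.
have h1 (lo hi : R * R) : (a' (horect lo hi) <= b' (horect lo hi))%E.
  rewrite a'E b'E.
  pose F k := horect (Num.max lo.1 (a1 + rr k), Num.max lo.2 (a2 + rr k))
                     (Num.min hi.1 (b1 - rr k), Num.min hi.2 (b2 - rr k)).
  have -> : horect lo hi `&` (box a1 b1 a2 b2 : set T2) = \bigcup_k F k.
    apply/seteqP; split => x.
      move=> [/horectP[/andP[l1 r1] /andP[l2 r2]] /boxP[/andP[l3 r3] /andP[l4 r4]]].
      have d0 : 0 < Num.min (Num.min (x.1 - a1) (b1 - x.1)) (Num.min (x.2 - a2) (b2 - x.2)).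
        by rewrite !lt_min !subr_gt0 l3 r3 l4 r4.
      have [k] := rr_small d0; rewrite !lt_min => /andP[/andP[? ?] /andP[? ?]].
      exists k => //; apply/horectP; rewrite /= !gt_max !le_min l1 l2 r1 r2 /=.
      by split; apply/andP; split; lra.
    move=> [k _ /horectP]; rewrite /= !gt_max !le_min.
    move=> [/andP[/andP[l1 l3] /andP[r1 r3]] /andP[/andP[l2 l4] /andP[r2 r4]]].
    have := rr_gt0 k => ?; split; first by apply/horectP; rewrite l1 l2 r1 r2.
    by apply/boxP; split; apply/andP; split; lra.
  apply: measure_le_bigcup.
  - by move=> n; exact: measurable_horect.
  - move=> n m nm x /horectP; rewrite /= !gt_max !le_min.
    move=> [/andP[/andP[l1 l3] /andP[r1 r3]] /andP[/andP[l2 l4] /andP[r2 r4]]].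
    have := rr_le nm => ?; apply/horectP; rewrite /= !gt_max !le_min l1 l2 r1 r2 /=.
    by split; apply/andP; split; lra.
  - move=> n; have := rr_gt0 n => ?.
    by apply: ab; rewrite /= ?lt_max ?gt_min; apply/orP; right; lra.
have <- : a' B = a B by rewrite a'E setIidl.
have <- : b' B = b B by rewrite b'E setIidl.
exact: measure_le_horects.
Qed.

End comparison.

Section density_measure.
Context {R : realType} d (T : measurableType d) (mu : {measure set T -> \bar R}).
Variables (f : T -> \bar R) (mf : measurable_fun setT f) (f0 : forall x, (0 <= f x)%E).

(** The two hypotheses are arguments of the set function, so that its measure structure can be built
    from them. *)
Definition density_measure of measurable_fun setT f & (forall x, (0 <= f x)%E) :=
  fun A : set T => (\int[mu]_(x in A) f x)%E.

HB.instance Definition _ := isMeasure.Build _ _ _ (density_measure mf f0)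
  (integral_set0 mu f) (fun A => @integral_ge0 _ _ _ mu A f (fun x _ => f0 x))
  (@semi_sigma_additive_nng_induced _ _ _ mu f mf f0).

End density_measure.

(** * Functions whose integrals over rectangles vanish *)

Section rectangles.
Context {R : realType}.
Notation T2 := (@T2 R).
Notation leb2 := (@leb2 R).

Lemma horectI (al be al' be' : R * R) : horect al be `&` horect al' be' =
  horect (Num.max al.1 al'.1, Num.max al.2 al'.2) (Num.min be.1 be'.1, Num.min be.2 be'.2).
Proof.
apply/seteqP; split => x.
  move=> [/horectP[/andP[h1 h2] /andP[h3 h4]] /horectP[/andP[h5 h6] /andP[h7 h8]]].
  by apply/horectP; rewrite /= !gt_max !le_min h1 h2 h3 h4 h5 h6 h7 h8.
move/horectP; rewrite /= !gt_max !le_min.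
move=> [/andP[/andP[h1 h2] /andP[h3 h4]] /andP[/andP[h5 h6] /andP[h7 h8]]].
by split; apply/horectP; rewrite ?h1 ?h2 ?h3 ?h4 ?h5 ?h6 ?h7 ?h8.
Qed.

(** The positive and negative parts of h are densities of two finite measures that agree on
    half-open rectangles, hence on all Borel sets. *)
Lemma ae_eq0_horect (h : T2 -> R) : leb2.-integrable setT (EFin \o h) ->
  (forall al be, \int[leb2]_(x in horect al be) (h x)%:E = 0)%E ->
  {ae leb2, forall x, h x = 0}.
Proof.
move=> ih h0; have mh := measurable_int _ ih.
have fin (f : T2 -> \bar R) A : leb2.-integrable setT f -> measurable A ->
    (\int[leb2]_(x in A) f x)%E \is a fin_num.
  move=> jf mA; apply: integrable_fin_num => //; exact: integrableS jf.
have ip : leb2.-integrable setT ((EFin \o h)^\+)%E by exact: integrable_funepos.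
have im : leb2.-integrable setT ((EFin \o h)^\-)%E by exact: integrable_funeneg.
have eqm (A : set T2) : measurable A ->
    (\int[leb2]_(x in A) (EFin \o h)^\+ x = \int[leb2]_(x in A) (EFin \o h)^\- x)%E.
  move=> mA.
  have mp := measurable_int _ ip. have mm := measurable_int _ im.
  have [|p pE] := @finite_measure_of _ _ _ (@density_measure _ _ _ leb2 _ mp (funepos_ge0 _)).
    by rewrite /= ltey_eq fin.
  have [|n nE] := @finite_measure_of _ _ _ (@density_measure _ _ _ leb2 _ mm (funeneg_ge0 _)).
    by rewrite /= ltey_eq fin.
  have pn (lo hi : R * R) : p (horect lo hi) = n (horect lo hi).
    rewrite pE nE; have := h0 lo hi; rewrite integralE.
    have f1 := fin _ _ ip (measurable_horect lo hi). have f2 := fin _ _ im (measurable_horect lo hi).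
    by move/eqP; rewrite sube_eq ?add0e// => /eqP.
  transitivity (p A); first exact/esym/pE.
  transitivity (n A); last exact: nE.
  by apply/eqP; rewrite eq_le !measure_le_horects// => lo hi; rewrite pn.
have : ae_eq leb2 setT (EFin \o h) (cst 0%E).
  apply: integral_ae_eq => // E _ mE.
  rewrite integral0 integralE eqm// subee//; exact: fin.
by apply: filterS => x /= /(_ I) [].
Qed.

Lemma integrable_indic_fin (X : set T2) : measurable X -> (leb2 X < +oo)%E ->
  leb2.-integrable setT (EFin \o (\1_X : T2 -> R)).
Proof.
move=> mX Xfin; apply/integrableP; split; first exact/measurable_EFinP.
rewrite (_ : (fun x => _) = (fun x => (\1_X x)%:E)); last first.
  by apply/funext => x; rewrite /= ger0_norm.
by rewrite integral_indic// setIT.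
Qed.

End rectangles.

(** * Trapezoidal kernels and averaged cell masses *)

Section cell_kernel.
Context {R : realType}.
Notation T2 := (@T2 R).
Notation leb2 := (@leb2 R).
Notation leb := (@lebesgue_measure R).

(** The convolution of the indicators of a rectangle and of a cell based at 0. It is uniformly
    continuous, hence admissible in the weak limit, and its mixed difference quotients converge to a
    mixed difference of the indicator of the rectangle. *)
Definition trap2 (al be ze : R * R) (x : R * R) : R :=
  trap al.1 be.1 ze.1 x.1 * trap al.2 be.2 ze.2 x.2.

Section trap2.
Variables al be ze : R * R.
Hypothesis ab1 : al.1 <= be.1.
Hypothesis ab2 : al.2 <= be.2.
Hypothesis ze1 : 0 <= ze.1.
Hypothesis ze2 : 0 <= ze.2.

Lemma ucont_trap2 : ucont (trap2 al be ze).
Proof.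
have S0 : 0 < 2 * (ze.1 + ze.2) + 1 by have := ze1; have := ze2; lra.
move=> e e0; exists (e / (2 * (ze.1 + ze.2) + 1)); first exact: divr_gt0.
move=> p q; rewrite !ler_pdivlMr// => h1 h2; rewrite /trap2.
have /andP[t0 tz] := trap_itv p.2 ab2 ze2.
have /andP[s0 sz] := trap_itv q.1 ab1 ze1.
have l1 := trap_lip ze.1 q.1 p.1 ab1. have l2 := trap_lip ze.2 q.2 p.2 ab2.
set A := trap _ _ _ p.1 in l1 *; set B := trap _ _ _ p.2 in l2 t0 tz *.
set C := trap _ _ _ q.1 in l1 s0 sz *; set D := trap _ _ _ q.2 in l2 *.
rewrite (_ : A * B - C * D = (A - C) * B + C * (B - D)); last by ring.
apply: le_trans (ler_normD _ _) _; rewrite !normrM (ger0_norm t0) (ger0_norm s0).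
have n1 := normr_ge0 (p.1 - q.1). have n2 := normr_ge0 (p.2 - q.2).
have i1 : `|A - C| * B <= 2 * `|p.1 - q.1| * ze.2.
  by apply: ler_pM.
have i2 : C * `|B - D| <= ze.1 * (2 * `|p.2 - q.2|) by apply: ler_pM.
have := e0; have := ze1; have := ze2; move: n1 n2 h1 h2 i1 i2.
set X := `|p.1 - q.1|; set Y := `|p.2 - q.2|; set I1 := _ * B; set I2 := C * _ => *.
have [XY|YX] := leP X Y; nra.
Qed.

Lemma trap2_bounded x : `|trap2 al be ze x| <= ze.1 * ze.2.
Proof.
have /andP[t0 tz] := trap_itv x.2 ab2 ze2.
have /andP[s0 sz] := trap_itv x.1 ab1 ze1.
by rewrite /trap2 ger0_norm ?mulr_ge0//; apply: ler_pM.
Qed.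

Lemma trap2_out x : ~ horect al (be.1 + ze.1, be.2 + ze.2) x -> trap2 al be ze x = 0.
Proof.
move=> nx; rewrite /trap2.
have [h1|h1] := pselect (al.1 < x.1 <= be.1 + ze.1); last by rewrite trap_out// mul0r.
have [h2|h2] := pselect (al.2 < x.2 <= be.2 + ze.2); last by rewrite [X in _ * X]trap_out// mulr0.
by case: nx; apply/horectP.
Qed.

Lemma Dm_trap2 y (h : R * R) : Dm (trap2 al be ze) y h =
  (trap al.1 be.1 ze.1 y.1 - trap al.1 be.1 ze.1 (y.1 - h.1)) *
  (trap al.2 be.2 ze.2 y.2 - trap al.2 be.2 ze.2 (y.2 - h.2)).
Proof. rewrite /Dm /trap2 /=; ring. Qed.

Lemma Dm_trap2_le y (h : R * R) : 0 < h.1 -> 0 < h.2 ->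
  `|Dm (trap2 al be ze) y h / (h.1 * h.2)| <= 4.
Proof.
move=> h1 h2; have h12 : 0 < h.1 * h.2 by rewrite mulr_gt0.
rewrite normrM normfV (gtr0_norm h12) ler_pdivrMr// Dm_trap2 normrM.
rewrite (_ : 4 * _ = (2 * h.1) * (2 * h.2)); last by ring.
have l1 := trap_lip ze.1 (y.1 - h.1) y.1 ab1. have l2 := trap_lip ze.2 (y.2 - h.2) y.2 ab2.
rewrite subKr (gtr0_norm h1) in l1; rewrite subKr (gtr0_norm h2) in l2.
exact: ler_pM.
Qed.

Lemma indic_horect x : \1_(horect al be) x = hoind al.1 be.1 x.1 * hoind al.2 be.2 x.2 :> R.
Proof.
rewrite !hoindE indicE -natrM mulnb; congr (nat_of_bool _)%:R.
by apply/idP/idP; rewrite inE horectP => /andP.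
Qed.

(** Each of the four clamp differences is eventually linear in the increment, so the quotient is
    eventually constant in k. *)
Lemma Dm_trap2_cvg (h : nat -> R * R) y :
  (forall k, 0 < (h k).1) -> (forall k, 0 < (h k).2) ->
  (fun k => (h k).1) @ \oo --> 0 -> (fun k => (h k).2) @ \oo --> 0 ->
  (fun k => Dm (trap2 al be ze) y (h k) / ((h k).1 * (h k).2)) @ \oo --> Dm (\1_(horect al be) : T2 -> R) y ze.
Proof.
move=> h1 h2 c1 c2; apply: cvg_near_cst.
near=> k.
have e1 : clamp al.1 be.1 y.1 - clamp al.1 be.1 (y.1 - (h k).1) = hoind al.1 be.1 y.1 * (h k).1.
  by near: k; exact: clamp_quot.
have e2 : clamp al.2 be.2 y.2 - clamp al.2 be.2 (y.2 - (h k).2) = hoind al.2 be.2 y.2 * (h k).2.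
  by near: k; exact: clamp_quot.
have e3 : clamp al.1 be.1 (y.1 - ze.1) - clamp al.1 be.1 (y.1 - ze.1 - (h k).1) = hoind al.1 be.1 (y.1 - ze.1) * (h k).1.
  by near: k; exact: clamp_quot.
have e4 : clamp al.2 be.2 (y.2 - ze.2) - clamp al.2 be.2 (y.2 - ze.2 - (h k).2) = hoind al.2 be.2 (y.2 - ze.2) * (h k).2.
  by near: k; exact: clamp_quot.
rewrite Dm_trap2 /trap.
rewrite (_ : _ - _ - _ = (hoind al.1 be.1 y.1 - hoind al.1 be.1 (y.1 - ze.1)) * (h k).1); last first.
  by rewrite mulrBl -e1 -e3 (addrAC _ (- ze.1)); ring.
rewrite [X in _ * X / _](_ : _ = (hoind al.2 be.2 y.2 - hoind al.2 be.2 (y.2 - ze.2)) * (h k).2); last first.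
  by rewrite mulrBl -e2 -e4 (addrAC _ (- ze.2)); ring.
rewrite /Dm !indic_horect /=.
have := h1 k; have := h2 k => p2 p1.
by field; rewrite !gt_eqF.
Unshelve. all: by end_near.
Qed.

(** Both sides integrate over pairs of a corner s in the rectangle and a point x of its cell; for
    fixed x these corners form a product set of area [trap2]. *)
Lemma integral_trap2 (m : finmeas R) :
  (\int[m]_x (trap2 al be ze x)%:E = \int[leb2]_(s in horect al be) m (hocell s ze))%E.
Proof.
have := @integral_cellmass _ m setT (fun s => (\1_(horect al be) s)%:E) ze measurableT.
have mI : measurable_fun setT (fun s : T2 => (\1_(horect al be) s : R)%:E).
  by apply/measurable_EFinP; apply: measurable_indic; exact: measurable_horect.
move=> /(_ mI (fun s => _)) H.
transitivity (\int[leb2]_s ((\1_(horect al be) s)%:E * m (hocell s ze `&` setT)))%E; last first.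
  rewrite [RHS]integral_mkcond; congr (integral _ _ _); apply/funext => s; rewrite patchE setIT indicE.
  by case: ifPn => h; [rewrite mul1e|rewrite mul0e].
rewrite H; last by move=> s; rewrite lee_fin.
congr (integral _ _ _); apply/funext => x.
pose X : set T2 := (`]al.1, be.1] `&` `[x.1 - ze.1, x.1[) `*` (`]al.2, be.2] `&` `[x.2 - ze.2, x.2[).
rewrite (_ : (fun s => _) = (fun s => (\1_X s)%:E)).
  rewrite integral_indic ?setIT//; last first.
    by apply: measurableX; exact: measurableI.
  rewrite [RHS](leb2X _ _); try exact: measurableI.
  by rewrite EFinM; congr (_ * _)%E; apply/esym; exact: leb_trap.
apply/funext => s; rewrite !indicE -EFinM -natrM mulnb; congr (nat_of_bool _)%:R%:E.
apply/idP/idP.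
  move=> /andP[]; rewrite !inE => /horectP[h1 h2] /hocellP[/andP[h3 h4] /andP[h5 h6]].
  by split; split; rewrite /= in_itv/= ?h1 ?h2 ?h3 ?h5 ?lerBlDr ?h4 ?h6.
rewrite inE /X /= => -[[]]; rewrite !in_itv/= => h1 /andP[h3 h4] [h2 /andP[h5 h6]].
apply/andP; split; rewrite inE; first by apply/horectP.
by apply/hocellP; rewrite h4 h6 -!lerBlDr.
Qed.

End trap2.

Lemma horect_crect (c1 d1 c2 d2 k : R) (lo hi : R * R) : c1 + k <= lo.1 -> hi.1 <= d1 - k ->
  c2 + k <= lo.2 -> hi.2 <= d2 - k -> horect lo hi `<=` crect c1 d1 c2 d2 k.
Proof.
move=> l1 r1 l2 r2 x /horectP[/andP[h1 h2] /andP[h3 h4]]; apply/crectP.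
by rewrite (le_trans l1 (ltW h1)) (le_trans h2 r1) (le_trans l2 (ltW h3)) (le_trans h4 r2).
Qed.

Lemma horect_empty (al be : R * R) : ~ (al.1 <= be.1 /\ al.2 <= be.2) -> horect al be = set0.
Proof.
move=> nab; apply/seteqP; split => // x /horectP[/andP[h1 h2] /andP[h3 h4]].
by apply: nab; split; apply: ltW; [exact: lt_le_trans h2|exact: lt_le_trans h4].
Qed.

Lemma leb2_horect_lty (al be : R * R) : (leb2 (horect al be) < +oo)%E.
Proof.
apply: (@le_lt_trans _ _ (leb `]al.1, be.1] * leb `]al.2, be.2])%E).
  by rewrite (leb2X (measurable_itv _) (measurable_itv _)).
by rewrite lte_mul_pinfty ?measure_ge0// ?fin_num_measure// !lebesgue_measure_itv/=; case: ifP => _; rewrite ?ltry// -EFinB ltry.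
Qed.

Lemma measurable_fine_cellmass (t : R * R) (m : finmeas R) (E : set T2) : measurable E ->
  measurable_fun setT (fun s : T2 => fine (m (hocell s t `&` E))).
Proof. by move=> mE; apply: measurableT_comp => //; exact: measurable_cellmass. Qed.

Lemma cellmass_bounded (t : R * R) (m : finmeas R) (E : set T2) s : measurable E ->
  `|fine (m (hocell s t `&` E))| <= fine (m setT).
Proof.
move=> mE; have mc : measurable (hocell s t `&` E) by apply: measurableI => //; exact: measurable_hocell.
by rewrite ger0_norm ?fine_ge0// fine_le ?fin_num_measure// le_measure// inE.
Qed.

End cell_kernel.

(** * The distributional identity and the masses of cells *)

Section distribution.
Context {R : realType}.
Notation T2 := (@T2 R).
Notation leb2 := (@leb2 R).
Variables (a1 b1 a2 b2 : R) (u : T2 -> R).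
Hypothesis ab1 : a1 < b1.
Hypothesis ab2 : a2 < b2.
Hypothesis int_trunc : forall kap, 0 < kap ->
  leb2.-integrable setT (EFin \o trunc_u a1 b1 a2 b2 u kap).
Variables (e : nat -> R) (z : nat -> R * R).
Hypothesis e_gt0 : forall k, 0 < e k.
Hypothesis e_cvg : e @ \oo --> 0.
Hypothesis z1_gt0 : forall k, 0 < (z k).1.
Hypothesis z2_gt0 : forall k, 0 < (z k).2.
Hypothesis ze : forall k, enorm (z k) <= e k.
Variables (U : set_system nat) (UU : UltraFilter U) (Uoo : \oo `<=` U).
Variables (m1 m2 : finmeas R).
Hypothesis Hm : forall phi, ucont phi -> (exists B, forall p, `|phi p| <= B) ->
    (forall x, ~ box a1 b1 a2 b2 x -> phi x = 0) ->
    (fun k => \int[leb2]_x (phi x * dens a1 b1 a2 b2 u (e k) (z k) x)) @ U --> \int[m1]_x phi x - \int[m2]_x phi x.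

Lemma crect_box kap x : 0 < kap -> crect a1 b1 a2 b2 kap x -> box a1 b1 a2 b2 x.
Proof.
move=> k0 /crectP[/andP[? ?] /andP[? ?]]; apply/boxP.
by split; apply/andP; split; lra.
Qed.

(** The same integrals converge along [\oo] by dominated convergence and along U by weak
    convergence; U refines [\oo], so the limits agree. *)
Lemma limit_pairing (kap : R) (phi g : R * R -> R) (B : R) : 0 < kap ->
  ucont phi -> (exists B, forall p, `|phi p| <= B) ->
  (forall x, ~ crect a1 b1 a2 b2 (2 * kap) x -> phi x = 0) ->
  (forall k y, `|Dm phi y (z k) / ((z k).1 * (z k).2)| <= B) ->
  (forall y, (fun k => Dm phi y (z k) / ((z k).1 * (z k).2)) @ \oo --> g y) ->
  \int[leb2]_y (g y * trunc_u a1 b1 a2 b2 u kap y) = \int[m1]_x phi x - \int[m2]_x phi x.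
Proof.
move=> k0 uphi bphi phi0 qB qg.
have k20 : 0 < 2 * kap by rewrite mulr_gt0.
have c1 := pairing_cvg k0 (int_trunc k0) e_gt0 e_cvg z1_gt0 z2_gt0 ze (measurable_ucont uphi) bphi phi0 qB qg.
have c2 : (fun k => \int[leb2]_x (phi x * dens a1 b1 a2 b2 u (e k) (z k) x)) @ U --> \int[m1]_x phi x - \int[m2]_x phi x.
  apply: Hm => // x nbx; apply: phi0 => /(crect_box k20); exact: nbx.
have c3 : (fun k => \int[leb2]_x (phi x * dens a1 b1 a2 b2 u (e k) (z k) x)) @ U -->
   \int[leb2]_y (g y * trunc_u a1 b1 a2 b2 u kap y).
  by move=> A /c1 h; exact: Uoo.
by rewrite -(cvg_lim (@norm_hausdorff _ R^o) c2) -(cvg_lim (@norm_hausdorff _ R^o) c3).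
Qed.

Lemma test_identity (phi : R * R -> R) : test_fun (box a1 b1 a2 b2) phi ->
  (\int[leb2]_(x in (box a1 b1 a2 b2 : set T2)) (u x * d12 phi x)%:E =
   \int[m1]_(x in [set: T2]) (phi x)%:E - \int[m2]_(x in [set: T2]) (phi x)%:E)%E.
Proof.
move=> [sphi [K [cK Kbox phi0]]].
have [kap k0 Kk] := compact_sub_crect ab1 ab2 cK Kbox.
have uphi := smooth_ucont sphi cK phi0.
have bphi := continuous_supp_bounded (sphi [::]).1 cK phi0.
have d0 : forall p, ~ K p -> d12 phi p = 0 by have := @iter_pd_supp _ phi K [:: true; false] cK phi0.
have [B hB] := continuous_supp_bounded (sphi [:: true; false]).1 cK d0.
have zz k : 0 < (z k).1 * (z k).2 by rewrite mulr_gt0.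
have mean k y : exists w : R * R, [/\ `|y.1 - w.1| <= e k, `|y.2 - w.2| <= e k &
    Dm phi y (z k) / ((z k).1 * (z k).2) = d12 phi w].
  have [w [/andP[? ?] /andP[? ?] ->]] := Dm_mean y sphi (ltW (z1_gt0 k)) (ltW (z2_gt0 k)).
  have [? ?] := z_le z1_gt0 z2_gt0 ze k.
  by exists w; rewrite mulfK ?gt_eqF// !ger0_norm; [split => //; lra|lra|lra].
have key := @limit_pairing kap phi (d12 phi) B k0 uphi bphi.
have {key} -> : (\int[m1]_(x in [set: T2]) (phi x)%:E - \int[m2]_(x in [set: T2]) (phi x)%:E)%E =
   (\int[leb2]_y (d12 phi y * trunc_u a1 b1 a2 b2 u kap y))%:E.
  rewrite key.
  - rewrite EFinB /Rintegral !fineK//; apply: (integrable_fin_num measurableT);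
    by apply: bounded_integrable => //; exact: measurable_ucont.
  - by move=> x nx; apply: phi0 => /Kk.
  - by move=> k y; have [w [_ _ ->]] := mean k y; exact: hB.
  move=> y; apply/cvgrPdist_lt => eps eps0.
  have /cvgrPdist_lt/(_ _ eps0)/nbhs_ballP[r r0 hr] := (sphi [:: true; false]).1 y.
  move/cvgrPdist_lt : e_cvg => /(_ _ r0); apply: filterS => k.
  rewrite sub0r normrN gtr0_norm// => ek.
  have [w [h1 h2 ->]] := mean k y.
  by apply: hr; split; rewrite /ball/=; [exact: le_lt_trans h1 ek|exact: le_lt_trans h2 ek].
have md : measurable_fun setT (d12 phi : T2 -> R).
  exact: (measurable_ucont (smooth_ucont (smooth_iter_pd [:: true; false] sphi) cK d0)).
rewrite /Rintegral fineK; last first.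
  by apply: (integrable_fin_num measurableT); exact: (integrable_bounded_mul (int_trunc k0) md hB).
rewrite [LHS]integral_mkcond; congr (integral _ _ _); apply/funext => x.
rewrite patchE; case: ifPn => [|/negP nbx].
  rewrite inE => bx; congr (_%:E).
  have [Kx|nKx] := pselect (K x); last by rewrite d0// mul0r mulr0.
  rewrite /trunc_u indicE mem_set ?mul1r 1?mulrC//.
  by apply/crectP; have /crectP[/andP[? ?] /andP[? ?]] := Kk _ Kx; split; apply/andP; split; lra.
rewrite d0 ?mul0r// => Kx; apply: nbx; rewrite inE; exact: Kbox.
Qed.

Variables (kap : R) (t : R * R).
Hypothesis kap0 : 0 < kap.
Hypothesis t1 : 0 <= t.1.
Hypothesis t2 : 0 <= t.2.

Notation v := (trunc_u a1 b1 a2 b2 u kap).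

(** The kernel [trap2] is the test function. Transposing the mixed difference back from the
    indicator of the rectangle to v produces the left side, averaging cells over their corners the
    right side. *)
Lemma rect_identity (al be : R * R) : al.1 <= be.1 -> al.2 <= be.2 ->
  a1 + 2 * kap <= al.1 -> be.1 + t.1 <= b1 - 2 * kap ->
  a2 + 2 * kap <= al.2 -> be.2 + t.2 <= b2 - 2 * kap ->
  (\int[leb2]_(s in horect al be) (D2 v s t)%:E =
   \int[leb2]_(s in horect al be) m1 (hocell s t) - \int[leb2]_(s in horect al be) m2 (hocell s t))%E.
Proof.
move=> lh1 lh2 l1 r1 l2 r2.
have zc1 : (fun k => (z k).1) @ \oo --> 0.
  apply: (squeeze_cvgr _ (cvg_cst 0) e_cvg); apply: nearW => k.
  by have [] := z_le z1_gt0 z2_gt0 ze k; rewrite (ltW (z1_gt0 k)).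
have zc2 : (fun k => (z k).2) @ \oo --> 0.
  apply: (squeeze_cvgr _ (cvg_cst 0) e_cvg); apply: nearW => k.
  by have [] := z_le z1_gt0 z2_gt0 ze k; rewrite (ltW (z2_gt0 k)).
have bt : exists B, forall x, `|trap2 al be t x| <= B by exists (t.1 * t.2); exact: trap2_bounded.
have ut := ucont_trap2 lh1 lh2 t1 t2.
have := @limit_pairing kap (trap2 al be t) (Dm (\1_(horect al be) : T2 -> R) ^~ t) 4 kap0 ut bt.
move=> H.
have {}H : \int[leb2]_y (Dm (\1_(horect al be) : T2 -> R) y t * v y) = \int[m1]_x trap2 al be t x - \int[m2]_x trap2 al be t x.
  apply: H.
  - move=> x nx; apply: trap2_out => // /horectP[/=/andP[? ?] /andP[? ?]]; apply: nx.
    by apply/crectP; split; apply/andP; split; lra.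
  - by move=> k y; exact: Dm_trap2_le.
  - by move=> y; exact: Dm_trap2_cvg.
have mI : measurable_fun setT (\1_(horect al be) : T2 -> R).
  by apply: measurable_indic; exact: measurable_horect.
have bI : exists B, forall x : T2, `|\1_(horect al be) x : R| <= B.
  by exists 1 => x; rewrite indicE; case: (_ \in _); rewrite ?normr1 ?normr0.
have [eqD iD _] := @Rintegral_D2 _ v (\1_(horect al be)) t (int_trunc kap0) mI bI.
rewrite -!integral_trap2//.
have it (m : finmeas R) : m.-integrable setT (EFin \o trap2 al be t).
  by apply: bounded_integrable => //; exact: measurable_ucont.
have fi (m : finmeas R) : (\int[m]_x (trap2 al be t x)%:E)%E \is a fin_num.
  exact: (integrable_fin_num measurableT (it m)).
have fD : (\int[leb2]_x (\1_(horect al be) x * D2 v x t)%:E)%E \is a fin_num.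
  exact: (integrable_fin_num measurableT iD).
have H' := etrans eqD H; rewrite /Rintegral in H'.
rewrite -(fineK (fi m1)) -(fineK (fi m2)) -EFinB -H' fineK//.
rewrite [LHS]integral_mkcond; congr (integral _ _ _); apply/funext => s.
by rewrite patchE indicE; case: ifPn => h; rewrite ?mul1r ?mul0r.
Qed.

(** The averaged identity on all subrectangles determines both sides almost everywhere. The
    increment t is independent of the z k that produced the measures, so it can be any good
    increment of the energy. *)
Lemma cell_ae (lo hi : R * R) :
  a1 + 2 * kap <= lo.1 -> hi.1 + t.1 <= b1 - 2 * kap ->
  a2 + 2 * kap <= lo.2 -> hi.2 + t.2 <= b2 - 2 * kap ->
  t.1 <= kap -> t.2 <= kap ->
  {ae leb2, forall s, horect lo hi s -> D2 u s t = fine (m1 (hocell s t)) - fine (m2 (hocell s t))}.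
Proof.
move=> l1 r1 l2 r2 tk1 tk2; pose W := horect lo hi.
have mW : measurable W by exact: measurable_horect.
have mI : measurable_fun setT (\1_W : T2 -> R) by exact: measurable_indic.
have bI : exists B, forall x : T2, `|\1_W x : R| <= B.
  by exists 1 => x; rewrite indicE; case: (_ \in _); rewrite ?normr1 ?normr0.
have [_ iD _] := @Rintegral_D2 _ v \1_W t (int_trunc kap0) mI bI.
have intI := integrable_indic_fin mW (leb2_horect_lty lo hi).
pose M (m : finmeas R) s := fine (m (hocell s t)).
have mM m : measurable_fun setT (M m : T2 -> R).
  by have := measurable_fine_cellmass t m measurableT; under eq_fun do rewrite setIT.
have bM m s : `|M m s| <= fine (m setT) by have := cellmass_bounded t m s measurableT; rewrite setIT.
have iM m : leb2.-integrable setT (fun s => (M m s * \1_W s)%:E) by exact: (integrable_bounded_mul intI (mM m) (bM m)).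
pose h (s : T2) := \1_W s * D2 v s t - M m1 s * \1_W s + M m2 s * \1_W s.
have ih : leb2.-integrable setT (EFin \o h).
  have := integrableD measurableT (integrableB measurableT iD (iM m1)) (iM m2).
  by apply: eq_integrable.
suff : {ae leb2, forall s, h s = 0}.
  apply: filterS => s hs Ws; move: hs; rewrite /h indicE mem_set// mul1r !mulr1 -/(M m1 s) -/(M m2 s).
  rewrite (@D2_trunc _ a1 b1 a2 b2 u kap s t) ?t1 ?t2//; first lra.
  apply: horect_crect Ws => //; first by apply: le_trans r1; rewrite lerDl.
  by apply: le_trans r2; rewrite lerDl.
apply: ae_eq0_horect => // al be.
pose al' := (Num.max al.1 lo.1, Num.max al.2 lo.2).
pose be' := (Num.min be.1 hi.1, Num.min be.2 hi.2).
transitivity (\int[leb2]_(s in horect al' be') (D2 v s t - M m1 s + M m2 s)%:E)%E.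
  rewrite -horectI integral_mkcond [RHS]integral_mkcond; congr (integral _ _ _); apply/funext => s.
  rewrite !patchE (in_setI s (horect al be) W) /= /h indicE.
  case: (s \in horect al be); case: (s \in W) => //=; first by congr (_%:E); ring.
  by rewrite -[RHS]/(0%:E); congr (_%:E); ring.
have [[lh1 lh2]|nab] := pselect (al'.1 <= be'.1 /\ al'.2 <= be'.2); last first.
  by rewrite horect_empty// integral_set0.
have Wsub : horect al' be' `<=` W by rewrite -horectI => s [].
have mQ := measurable_horect al' be'.
have iD' : leb2.-integrable (horect al' be') (fun s => (D2 v s t)%:E).
  have := integrableS measurableT mQ (@subsetT _ _) iD.
  by apply: eq_integrable => // s; rewrite inE => /Wsub Ws; rewrite /= indicE mem_set// mul1r.
have iM' m : leb2.-integrable (horect al' be') (fun s => (M m s)%:E).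
  have := integrableS measurableT mQ (@subsetT _ _) (iM m).
  by apply: eq_integrable => // s; rewrite inE => /Wsub Ws; rewrite /= indicE mem_set// mulr1.
have := rect_identity lh1 lh2; rewrite /al' /be' /= !le_max.
rewrite l1 l2 !orbT => /(_ isT _ isT _).
have h1 : Num.min be.1 hi.1 + t.1 <= b1 - 2 * kap by apply: le_trans r1; rewrite lerD2r ge_min lexx orbT.
have h2 : Num.min be.2 hi.2 + t.2 <= b2 - 2 * kap by apply: le_trans r2; rewrite lerD2r ge_min lexx orbT.
move=> /(_ h1 h2); rewrite -/al' -/be'.
have ME (m : finmeas R) : (\int[leb2]_(s in horect al' be') m (hocell s t))%E = (\int[leb2]_(s in horect al' be') (M m s)%:E)%E.
  by apply: eq_integral => s _; rewrite /M fineK// fin_num_measure//; exact: measurable_hocell.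
rewrite !ME => E.
have -> : (fun s => (D2 v s t - M m1 s + M m2 s)%:E) = (fun s => ((D2 v s t)%:E - (M m1 s)%:E) + (M m2 s)%:E)%E by [].
rewrite integralD//; last exact: integrableB.
rewrite integralB// E -(fineK (integrable_fin_num mQ (iM' m1))) -(fineK (integrable_fin_num mQ (iM' m2))).
by rewrite -!EFinB -EFinD; congr (_%:E); ring.
Qed.

End distribution.

(** * Concentration on the set of positive density *)

Section strip_estimate.
Context {R : realType}.
Notation T2 := (@T2 R).
Notation leb2 := (@leb2 R).

(** Replacing f by min(f, g) keeps its integral and makes the inequality hold everywhere. *)
Lemma le_Rintegral_ae (f g : T2 -> R) :
  leb2.-integrable setT (EFin \o f) -> leb2.-integrable setT (EFin \o g) ->
  {ae leb2, forall x, f x <= g x} -> \int[leb2]_x f x <= \int[leb2]_x g x.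
Proof.
move=> jf jg fg.
have mf : measurable_fun setT f by apply/measurable_EFinP; exact: measurable_int jf.
have mg : measurable_fun setT g by apply/measurable_EFinP; exact: measurable_int jg.
have e : (\int[leb2]_x (f x)%:E = \int[leb2]_x (Num.min (f x) (g x))%:E)%E.
  apply: ae_eq_integral => //; try exact/measurable_EFinP.
    by apply/measurable_EFinP; exact: measurable_minr.
  by apply: filterS fg => x fgx _ /=; rewrite min_l.
have jm : leb2.-integrable setT (EFin \o (fun x => Num.min (f x) (g x))).
  have js := integrableD measurableT (integrable_abse jf) (integrable_abse jg).
  apply: (le_integrable measurableT _ _ js).
    by apply/measurable_EFinP; exact: measurable_minr.
  move=> x _ /=; rewrite lee_fin (ger0_norm (addr_ge0 _ _))//.
  by have [_|_] := leP (f x) (g x); rewrite ?lerDl ?lerDr.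
rewrite {1}/Rintegral e; apply: le_Rintegral => // x _.
by rewrite ge_min lexx orbT.
Qed.

Lemma integrable_cut (X : set T2) (f : T2 -> R) (C : R) : measurable X -> (leb2 X < +oo)%E ->
  measurable_fun setT f -> (forall x, `|f x| <= C) ->
  leb2.-integrable setT (EFin \o (fun x => f x * \1_X x)).
Proof. by move=> mX Xfin mf fC; exact: (integrable_bounded_mul (integrable_indic_fin mX Xfin) mf fC). Qed.

Lemma Rintegral_cst_indic (c : R) (X : set T2) : measurable X -> (leb2 X < +oo)%E ->
  \int[leb2]_x (c * \1_X x) = c * fine (leb2 X).
Proof.
move=> mX Xfin; rewrite RintegralZl//; last exact: integrable_indic_fin.
by rewrite /Rintegral integral_indic// setIT.
Qed.

Lemma RintegralB_cut (f g : T2 -> R) : leb2.-integrable setT (EFin \o f) ->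
  leb2.-integrable setT (EFin \o g) ->
  \int[leb2]_x (f x - g x) = \int[leb2]_x f x - \int[leb2]_x g x /\
  leb2.-integrable setT (EFin \o (fun x => f x - g x)).
Proof.
by move=> jf jg; split; [exact: RintegralB|have := integrableB measurableT jf jg].
Qed.

(* Truncated at the level [2 tau], [g] is bounded, so that its increments telescope;
   a jump of size at most [tau] starting from [|g| <= tau] survives the truncation. *)
Lemma strip_estimate (V S1 S2 : set T2) (d : R * R) (w tau C : R) (g DE Dn : T2 -> R) :
  measurable V -> measurable S1 -> measurable S2 ->
  (leb2 V < +oo)%E -> leb2 S1 = w%:E -> leb2 S2 = w%:E ->
  (forall x, `|\1_V (translate x (- d.1, - d.2)) - \1_V x| <= \1_S1 x + \1_S2 x :> R) ->
  measurable_fun setT g -> measurable_fun setT DE -> measurable_fun setT Dn ->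
  0 < tau -> (forall x, 0 <= DE x <= tau) -> (forall x, 0 <= Dn x <= C) ->
  {ae leb2, forall x, V x -> DE x - Dn x <= g (translate x d) - g x} ->
  \int[leb2]_x (DE x * \1_(V `&` [set x | `|g x| <= tau]) x) <=
  4 * tau * w + \int[leb2]_x (Dn x * \1_V x).
Proof.
move=> mV mS1 mS2 Vfin S1w S2w hS mg mDE mDn t0 DEt DnC hae.
have t20 : 0 <= 2 * tau by lra.
pose Psi x := clamp (- (2 * tau)) (2 * tau) (g x).
have mPsi : measurable_fun setT (Psi : T2 -> R) by exact: measurable_clamp.
have bPsi x : `|Psi x| <= 2 * tau by exact: clamp_norm_le.
(* Translation by d turns the integral of Psi(x + d) over V into that of Psi over V'; the telescoped
   difference lives where V and V' differ, inside S1 and S2. *)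
pose V' : set T2 := [set x | V (translate x (- d.1, - d.2))].
have mV' : measurable V'.
  by rewrite -[V']setTI; exact: (@measurable_translate R (- d.1, - d.2)).
have V'E x : \1_V' x = \1_V (translate x (- d.1, - d.2)) :> R by [].
have S1fin : (leb2 S1 < +oo)%E by rewrite S1w ltry.
have S2fin : (leb2 S2 < +oo)%E by rewrite S2w ltry.
have V'fin : (leb2 V' < +oo)%E.
  have sub : V' `<=` V `|` (S1 `|` S2).
    move=> x V'x; have := hS x; rewrite -V'E !indicE (mem_set V'x).
    have [|/negP nV] := boolP (x \in V); first by rewrite inE; left.
    have [|/negP nS1] := boolP (x \in S1); first by rewrite inE; right; left.
    have [|/negP nS2] := boolP (x \in S2); first by rewrite inE; right; right.
    by rewrite subr0 normr1 addr0 ler10.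
  have mS : measurable (S1 `|` S2) by exact: measurableU.
  apply: (@le_lt_trans _ _ (leb2 (V `|` (S1 `|` S2)))).
    by apply: le_measure => //; rewrite inE//; exact: measurableU.
  apply: (@le_lt_trans _ _ (leb2 V + leb2 (S1 `|` S2))%E); first exact: measureU2.
  apply: (lte_add_pinfty Vfin).
  by apply: (@le_lt_trans _ _ (leb2 S1 + leb2 S2)%E); [exact: measureU2|exact: lte_add_pinfty].
pose G := V `&` [set x | `|g x| <= tau].
have mG : measurable G.
  apply: measurableI => //.
  have mn : measurable_fun setT (fun x => `|g x|) by exact: measurableT_comp.
  by have := measurable_fun_le measurableT mn (measurable_cst tau); rewrite setTI.
have Gfin : (leb2 G < +oo)%E.
  by apply: le_lt_trans Vfin; apply: le_measure; rewrite ?inE// => x [].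
have bDE x : `|DE x| <= tau by have /andP[? ?] := DEt x; rewrite ger0_norm.
have bDn x : `|Dn x| <= C by have /andP[? ?] := DnC x; rewrite ger0_norm.
have jDE := integrable_cut mG Gfin mDE bDE.
have jDn := integrable_cut mV Vfin mDn bDn.
have jPV' := integrable_cut mV' V'fin mPsi bPsi.
have jPV := integrable_cut mV Vfin mPsi bPsi.
have [tr1 tr2] := integral_trans2 d jPV'.
have trE : (fun x : T2 => (EFin \o (fun x => Psi x * \1_V' x)) (x.1 + d.1, x.2 + d.2)) =
    EFin \o (fun x => Psi (translate x d) * \1_V x).
  apply/funext => x /=; rewrite V'E /translate/= !addrK.
  by case: x.
rewrite trE in tr1 tr2.
have [I1 J1] := RintegralB_cut jDE jDn.
have [I2 J2] := RintegralB_cut tr2 jPV.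
have [I3 J3] := RintegralB_cut jPV' jPV.
have step1 := @le_Rintegral_ae _ _ J1 J2.
(* Two strips of area w, on which |Psi| <= 2 tau. *)
have step2 : \int[leb2]_x (Psi x * \1_V' x - Psi x * \1_V x) <= 4 * tau * w.
  have jS1 : leb2.-integrable setT (EFin \o (fun x => 2 * tau * \1_S1 x)).
    by have := integrableZl measurableT (2 * tau) (integrable_indic_fin mS1 S1fin).
  have jS2 : leb2.-integrable setT (EFin \o (fun x => 2 * tau * \1_S2 x)).
    by have := integrableZl measurableT (2 * tau) (integrable_indic_fin mS2 S2fin).
  have jS : leb2.-integrable setT (EFin \o (fun x => 2 * tau * \1_S1 x + 2 * tau * \1_S2 x)).
    by have := integrableD measurableT jS1 jS2.
  apply: (@le_trans _ _ (\int[leb2]_x (2 * tau * \1_S1 x + 2 * tau * \1_S2 x))).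
    apply: le_Rintegral => // x _; rewrite -mulrBr -mulrDr.
    apply: le_trans (ler_norm _) _; rewrite normrM; apply: ler_pM => //.
    by rewrite V'E.
  rewrite RintegralD// !Rintegral_cst_indic// S1w S2w /=; lra.
have {}step1 : \int[leb2]_x (DE x * \1_G x - Dn x * \1_V x) <=
    \int[leb2]_x (Psi (translate x d) * \1_V x - Psi x * \1_V x).
  apply: step1; apply: filterS hae => x hx.
  have [Vx|nVx] := pselect (V x); last first.
    have nGx : ~ G x by case.
    by rewrite !indicE (memNset nVx) (memNset nGx) !mulr0.
  rewrite [\1_V x]indicE (mem_set Vx) !mulr1 indicE.
  have -> : (x \in G) = (`|g x| <= tau).
    by apply/idP/idP; [rewrite inE => -[]|move=> h; rewrite inE].
  by apply: clamp_ge => //; [have /andP[] := DnC x|exact: hx].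
have eq23 : \int[leb2]_x (Psi (translate x d) * \1_V x) = \int[leb2]_x (Psi x * \1_V' x).
  by rewrite /Rintegral; congr fine.
rewrite I1 I2 eq23 -I3 in step1.
by rewrite -lerBlDr; exact: le_trans step1 step2.
Qed.

End strip_estimate.

(** * Main estimate on a rectangle *)

Section main_estimate.
Context {R : realType}.
Notation T2 := (@T2 R).
Notation leb2 := (@leb2 R).

Lemma leb2_horect (lo hi : R * R) : lo.1 <= hi.1 -> lo.2 <= hi.2 ->
  leb2 (horect lo hi) = ((hi.1 - lo.1) * (hi.2 - lo.2))%:E.
Proof.
move=> h1 h2; rewrite (leb2X (measurable_itv _) (measurable_itv _)) !lebesgue_measure_itv /= !lte_fin.
rewrite EFinM; congr (_ * _)%E; case: ltP => //= h.
- by congr (_%:E); apply/eqP; rewrite eq_sym subr_eq0 eq_le h.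
- by congr (_%:E); apply/eqP; rewrite eq_sym subr_eq0 eq_le h.
Qed.

Lemma indic_or (V : set T2) x : V x /\ \1_V x = 1 :> R \/ ~ V x /\ \1_V x = 0 :> R.
Proof.
rewrite indicE; have [Vx|nVx] := pselect (V x); first by left; rewrite mem_set.
by right; rewrite memNset.
Qed.

Lemma indic_shift_le (V V' S1 S2 : set T2) x : (V' x -> V x \/ S2 x) -> (V x -> V' x \/ S1 x) ->
  `|\1_V' x - \1_V x| <= \1_S1 x + \1_S2 x :> R.
Proof.
move=> h1 h2; have s1 : 0 <= \1_S1 x :> R by []. have s2 : 0 <= \1_S2 x :> R by [].
have [[V'x ->]|[nV'x ->]] := indic_or V' x; have [[Vx ->]|[nVx ->]] := indic_or V x.
- by rewrite subrr normr0 addr_ge0.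
- rewrite subr0 normr1; have [//|] := h1 V'x; have [[? ->]|[]//] := indic_or S2 x; lra.
- rewrite sub0r normrN normr1; have [//|] := h2 Vx; have [[? ->]|[]//] := indic_or S1 x; lra.
- by rewrite subrr normr0 addr_ge0.
Qed.

Lemma itv_shift (l h s x : R) : 0 < s -> l < x - s <= h -> l < x <= h \/ h < x <= h + s.
Proof.
move=> s0 /andP[h1 h2]; have [xh|xh] := leP x h; [left|right]; apply/andP; split; lra.
Qed.

Lemma itv_unshift (l h s x : R) : 0 < s -> l < x <= h -> l < x - s <= h \/ l < x <= l + s.
Proof.
move=> s0 /andP[h1 h2]; have [xl|xl] := leP x (l + s); [right|left]; apply/andP; split; lra.
Qed.

(** D2 u is the increment of p in the second direction and of q in the first. Points with |p| <= tau
    or |q| <= tau fall under two strip estimates, whence the factor 2 on Dn. Elsewhere the energy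
    density is at least tau, so these points fill an area at most K / tau and contribute at most dl
    K / tau. *)
Lemma main_estimate (lo hi z : R * R) (u : T2 -> R) (th1 th2 tau dl C K : R) (W : set T2) (DE Dn : T2 -> R) :
  measurable_fun setT u -> 0 < z.1 -> 0 < z.2 -> lo.1 <= hi.1 -> lo.2 <= hi.2 ->
  0 < th1 -> 0 < th2 -> th1 + th2 = 1 ->
  measurable_fun setT DE -> (forall x, 0 <= DE x <= dl) -> dl <= tau -> 0 < tau ->
  measurable_fun setT Dn -> (forall x, 0 <= Dn x <= C) ->
  {ae leb2, forall x, horect lo hi x -> DE x - Dn x <= D2 u x z} ->
  measurable W -> horect lo hi `<=` W -> (energy th1 th2 W u z <= K%:E)%E ->
  \int[leb2]_x (DE x * \1_(horect lo hi) x) <=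
  4 * tau * (z.2 * (hi.1 - lo.1) + z.1 * (hi.2 - lo.2)) + 2 * \int[leb2]_x (Dn x * \1_(horect lo hi) x)
   + dl / tau * K.
Proof.
move=> mu z1 z2 lh1 lh2 th10 th20 th12 mDE DEd dt t0 mDn DnC hae mW VW EK.
pose V := horect lo hi; have mV : measurable V by exact: measurable_horect.
have Vfin : (leb2 V < +oo)%E by exact: leb2_horect_lty.
pose p (x : T2) := Du1 u x z; pose q (x : T2) := Du2 u x z.
have mtr (d : R * R) : measurable_fun setT (fun y : T2 => u (translate y d)).
  exact: (measurableT_comp mu (@measurable_translate R d)).
have mp : measurable_fun setT (p : T2 -> R).
  rewrite (_ : p = (fun x => u (translate x (z.1, 0)) - u x)); first exact: measurable_funB.
  by apply/funext => x; rewrite /p /Du1 /translate/= addr0.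
have mq : measurable_fun setT (q : T2 -> R).
  rewrite (_ : q = (fun x => u (translate x (0, z.2)) - u x)); first exact: measurable_funB.
  by apply/funext => x; rewrite /q /Du2 /translate/= addr0.
have DEt x : 0 <= DE x <= tau by have /andP[-> h] := DEd x; exact: le_trans h dt.
have estp : \int[leb2]_x (DE x * \1_(V `&` [set x | `|p x| <= tau]) x) <=
    4 * tau * (z.2 * (hi.1 - lo.1)) + \int[leb2]_x (Dn x * \1_V x).
  (* The strips run along the lower side of the rectangle and just above the upper one. *)
  pose S1 := horect lo (hi.1, lo.2 + z.2). pose S2 := horect (lo.1, hi.2) (hi.1, hi.2 + z.2).
  apply: (@strip_estimate _ V S1 S2 (0, z.2) _ _ C) => //; try exact: measurable_horect.
  - by rewrite leb2_horect//= ?lerDl ?(ltW z2)//; congr (_%:E); ring.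
  - by rewrite leb2_horect//= ?lerDl ?(ltW z2)//; congr (_%:E); ring.
  - move=> x; apply: (@indic_shift_le V [set x | V (translate x (- 0, - z.2))]) => /=.
      move=> /horectP/=; rewrite oppr0 addr0 => -[h1 /(itv_shift z2)[h2|h2]]; [left|right];
      by apply/horectP.
    move=> /horectP[h1 /(itv_unshift z2)[h2|h2]]; [left|right];
    by apply/horectP; rewrite /= ?oppr0 ?addr0.
  - apply: filterS hae => x hx Vx; have := hx Vx; rewrite /p /Du1 /D2 /translate/= !addr0; lra.
have estq : \int[leb2]_x (DE x * \1_(V `&` [set x | `|q x| <= tau]) x) <=
    4 * tau * (z.1 * (hi.2 - lo.2)) + \int[leb2]_x (Dn x * \1_V x).
  pose S1 := horect lo (lo.1 + z.1, hi.2). pose S2 := horect (hi.1, lo.2) (hi.1 + z.1, hi.2).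
  apply: (@strip_estimate _ V S1 S2 (z.1, 0) _ _ C) => //; try exact: measurable_horect.
  - by rewrite leb2_horect//= ?lerDl ?(ltW z1)//; congr (_%:E); ring.
  - by rewrite leb2_horect//= ?lerDl ?(ltW z1)//; congr (_%:E); ring.
  - move=> x; apply: (@indic_shift_le V [set x | V (translate x (- z.1, - 0))]) => /=.
      move=> /horectP/=; rewrite oppr0 addr0 => -[/(itv_shift z1)[h1|h1] h2]; [left|right];
      by apply/horectP.
    move=> /horectP[/(itv_unshift z1)[h1|h1] h2]; [left|right];
    by apply/horectP; rewrite /= ?oppr0 ?addr0.
  - apply: filterS hae => x hx Vx; have := hx Vx; rewrite /q /Du2 /D2 /translate/= !addr0; lra.
have mle (f : T2 -> R) : measurable_fun setT f -> measurable (V `&` [set x | `|f x| <= tau]).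
  move=> mf; apply: measurableI => //.
  have mn : measurable_fun setT (fun x => `|f x|) by exact: measurableT_comp.
  by have := measurable_fun_le measurableT mn (measurable_cst tau); rewrite setTI.
pose Gp := V `&` [set x | `|p x| <= tau]; pose Gq := V `&` [set x | `|q x| <= tau].
have mGp : measurable Gp by exact: mle.
have mGq : measurable Gq by exact: mle.
pose G := V `\` (Gp `|` Gq).
have mG : measurable G by apply: measurableD => //; exact: measurableU.
have fin A : measurable A -> A `<=` V -> (leb2 A < +oo)%E.
  by move=> mA AV; apply: le_lt_trans Vfin; apply: le_measure; rewrite ?inE.
have Gpfin : (leb2 Gp < +oo)%E by apply: fin => // x [].
have Gqfin : (leb2 Gq < +oo)%E by apply: fin => // x [].
have Gfin : (leb2 G < +oo)%E by apply: fin => // x [].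
(* Markov inequality: both jumps are at least tau on G, and th1 + th2 = 1 makes their weighted
   product at least tau. *)
have estG : tau * fine (leb2 G) <= K.
  rewrite -lee_fin EFinM fineK; last by rewrite ge0_fin_numE.
  apply: le_trans EK; rewrite -(integral_cst leb2 mG) /energy.
  apply: (@le_trans _ _ (\int[leb2]_(x in G) (`|Du1 u x z| `^ th1 * `|Du2 u x z| `^ th2)%:E)%E).
    apply: ge0_le_integral => //.
    - by move=> x _; rewrite lee_fin ltW.
    - by apply/measurable_EFinP; apply: measurable_funTS; exact: measurable_Du_pow_x.
    move=> x [Vx nG]; rewrite lee_fin.
    have px : tau <= `|p x| by rewrite leNgt; apply/negP => h; apply: nG; left; split => //; exact: ltW.
    have qx : tau <= `|q x| by rewrite leNgt; apply/negP => h; apply: nG; right; split => //; exact: ltW.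
    rewrite -[leLHS](@powRr1 _ tau) ?(ltW t0)// -th12 powRD; last by rewrite (gt_eqF t0) implybT.
    by apply: ler_pM; rewrite ?powR_ge0// ge0_ler_powR// ?nnegrE ?(ltW t0)// ltW.
  apply: ge0_subset_integral => //.
  - by apply/measurable_EFinP; apply: measurable_funTS; exact: measurable_Du_pow_x.
  - by move=> x [Vx _]; exact: VW.
have dl0 : 0 <= dl by have /andP[] := DEd (0, 0); exact: le_trans.
have bDE x : `|DE x| <= dl by have /andP[? ?] := DEd x; rewrite ger0_norm.
have j1 := integrable_cut mGp Gpfin mDE bDE.
have j2 := integrable_cut mGq Gqfin mDE bDE.
have j12 : leb2.-integrable setT (EFin \o (fun x => DE x * \1_Gp x + DE x * \1_Gq x)).
  by have := integrableD measurableT j1 j2.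
have j3 : leb2.-integrable setT (EFin \o (fun x => dl * \1_G x)).
  by have := integrableZl measurableT dl (integrable_indic_fin mG Gfin).
have j123 : leb2.-integrable setT (EFin \o (fun x => DE x * \1_Gp x + DE x * \1_Gq x + dl * \1_G x)).
  by have := integrableD measurableT j12 j3.
have jV := integrable_cut mV Vfin mDE bDE.
apply: (@le_trans _ _ (\int[leb2]_x (DE x * \1_Gp x + DE x * \1_Gq x + dl * \1_G x))).
  apply: le_Rintegral => // x _.
  have /andP[D0 Dd] := DEd x.
  have gp : 0 <= \1_Gp x :> R by []. have gq : 0 <= \1_Gq x :> R by []. have g0 : 0 <= \1_G x :> R by [].
  have [[Vx ->]|[nVx ->]] := indic_or V x; last by rewrite mulr0 !addr_ge0 ?mulr_ge0.
  have [[? Gpx]|[nGp Gpx]] := indic_or Gp x.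
    by rewrite Gpx -addrA lerDl addr_ge0 ?mulr_ge0.
  have [[? Gqx]|[nGq Gqx]] := indic_or Gq x.
    by rewrite Gqx Gpx mulr0 add0r lerDl mulr_ge0.
  have [[? ->]|[[]]] := indic_or G x; first by rewrite Gpx Gqx !mulr0 mulr1 add0r add0r mulr1.
  by split => // -[].
rewrite RintegralD// RintegralD// Rintegral_cst_indic//.
have h : dl * fine (leb2 G) <= dl / tau * K.
  rewrite -mulrA; apply: ler_wpM2l => //.
  by rewrite mulrC ler_pdivlMr// mulrC.
move: estp estq h; rewrite -/Gp -/Gq; lra.
Qed.

End main_estimate.

(** * Masses of cells and their averages over rectangles *)

Section cell_mass.
Context {R : realType}.
Notation T2 := (@T2 R).
Notation leb2 := (@leb2 R).

Section light.
Variable lam : {measure set T2 -> \bar R}.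

(** Fixing the starting level J makes smallness of the density uniform; as J grows these sets
    exhaust the complement of [upper_dens]. *)
Definition light (d : R) (J : nat) : set T2 :=
  [set x | forall j, (J <= j)%N -> (lam (dsq j (dlab j x)) <= (2 ^- j * d)%:E)%E].

Lemma measurable_light d J : measurable (light d J).
Proof.
rewrite (_ : light d J = \bigcap_(j in [set j | (J <= j)%N]) (dlab j @^-1` [set k | (lam (dsq j k) <= (2 ^- j * d)%:E)%E])).
  by apply: bigcap_measurableType => j _; exact: measurable_preimage_dlab.
by apply/seteqP; split => x h j /h.
Qed.

Lemma light_le d J J' : (J <= J')%N -> light d J `<=` light d J'.
Proof. by move=> JJ x h j J'j; apply: h; exact: leq_trans J'j. Qed.

Lemma bigcup_light d x : ~ upper_dens lam d x -> (\bigcup_J light d J) x.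
Proof.
move=> /existsNP[J nJ]; exists J => // j Jj; rewrite leNgt; apply/negP => hj.
by apply: nJ; exists j.
Qed.

(** Take j = i - 1 with i the least index such that 2^-i < r; i is not 0 because r <= 2^-J <= 1. *)
Lemma dyadic_scale (r : R) J : 0 < r -> r <= 2 ^- J ->
  exists2 j, (J <= j)%N & r <= 2 ^- j < 2 * r.
Proof.
move=> r0 rJ; have [n hn] := exp2_small (divr_gt0 r0 (ltr0n _ 2)).
have exi : exists i, (2 ^- i < r)%R.
  by exists n; apply: le_lt_trans (hn n (leqnn n)) _; lra.
pose i := ex_minn exi; have : i = ex_minn exi by []; case: ex_minnP => i' hi' imin _.
case: i' hi' imin => [|j] hj jmin.
  exfalso; move: (lt_le_trans hj rJ); rewrite expr0 invr1 ltNge => /negP; apply.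
  by rewrite invf_le1 ?exprn_gt0// exprn_ege1// ler1n.
have rj : r <= 2 ^- j by rewrite leNgt; apply/negP => /jmin; rewrite ltnn.
exists j; last first.
  by rewrite rj/= -ltr_pdivrMl// -invfM -exprS.
rewrite leqNgt; apply/negP => jJ; have : (2 ^- J <= 2 ^- j.+1 :> R).
  by rewrite lef_pV2 ?posrE ?exprn_gt0// ler_eXn2l// ltr1n.
by move: hj rJ; lra.
Qed.

(** At a level with r <= 2^-j < 2 r the cell meets at most four dyadic squares. A square meeting the
    light set has mass at most 2^-j d <= 2 r d, and four of them give 8 d r. *)
Lemma cell_mass_le (m : finmeas R) d J x (z : R * R) (r : R) :
  (forall A, measurable A -> m A <= lam A)%E -> 0 <= d -> 0 < r -> r <= 2 ^- J ->
  z.1 <= r -> z.2 <= r -> (m (hocell x z `&` light d J) <= (8 * d * r)%:E)%E.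
Proof.
move=> mlam d0 r0 rJ z1 z2; have [j Jj /andP[rj jr]] := dyadic_scale r0 rJ.
have mL := measurable_light d J.
pose Q (b1 b2 : bool) : set T2 := dsq j ((dlab j x).1 + b1%:Z, (dlab j x).2 + b2%:Z).
have mQL b1 b2 : measurable (Q b1 b2 `&` light d J) by apply: measurableI => //; exact: measurable_dsq.
have Qle b1 b2 : (m (Q b1 b2 `&` light d J) <= (2 ^- j * d)%:E)%E.
  have [->|/set0P[p [Qp Lp]]] := eqVneq (Q b1 b2 `&` light d J) set0.
    by rewrite measure0 lee_fin mulr_ge0// invr_ge0 exprn_ge0.
  apply: le_trans (Lp j Jj).
  apply: (@le_trans _ _ (m (dsq j (dlab j p)))); last by apply: mlam; exact: measurable_dsq.
  apply: le_measure; rewrite ?inE//; first exact: measurable_dsq.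
  by move=> q [Qq _]; rewrite /dsq/= Qp.
have lab (s y w : R) : w <= r -> s < y <= s + w ->
    exists b : bool, Num.floor (2 ^+ j * y) = Num.floor (2 ^+ j * s) + b%:Z.
  move=> wr /andP[sy yw]; have j0 : 0 < 2 ^+ j :> R by rewrite exprn_gt0.
  have h1 : Num.floor (2 ^+ j * s) <= Num.floor (2 ^+ j * y).
    have h : 2 ^+ j * s <= 2 ^+ j * y by rewrite ler_pM2l// ltW.
    exact: le_floor.
  have h2 : Num.floor (2 ^+ j * y) < Num.floor (2 ^+ j * s) + 2.
    rewrite floor_lt_int intrD.
    apply: (@le_lt_trans _ _ (2 ^+ j * s + 1)).
      apply: (@le_trans _ _ (2 ^+ j * (s + w))); first by rewrite ler_pM2l.
      rewrite mulrDr lerD2l; apply: (@le_trans _ _ (2 ^+ j * 2 ^- j)); last by rewrite divff// gt_eqF.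
      by rewrite ler_pM2l// (le_trans wr).
    by have := floorD1_gt (2 ^+ j * s); rewrite intrD; lra.
  have [h|h] := leP (Num.floor (2 ^+ j * y)) (Num.floor (2 ^+ j * s)).
    by exists false; apply/eqP; rewrite addr0 eq_le h h1.
  by exists true; apply/eqP; rewrite eq_le -ltzD1 -addrA h2 /= lezD1.
have cov : hocell x z `&` light d J `<=` (Q false false `&` light d J `|` Q false true `&` light d J)
    `|` (Q true false `&` light d J `|` Q true true `&` light d J).
  move=> y [/hocellP[h1 h2] Ly].
  have [c1 e1] := lab _ _ _ z1 h1; have [c2 e2] := lab _ _ _ z2 h2.
  have : (Q c1 c2 `&` light d J) y by split => //; rewrite /Q /dsq /= /dlab e1 e2.
  by case: c1 {e1}; case: c2 {e2} => h; [right; right|right; left|left; right|left; left].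
have mU b : measurable (Q b false `&` light d J `|` Q b true `&` light d J) by exact: measurableU.
apply: (@le_trans _ _ (m ((Q false false `&` light d J `|` Q false true `&` light d J)
    `|` (Q true false `&` light d J `|` Q true true `&` light d J)))).
  by apply: le_measure; rewrite ?inE//; [apply: measurableI => //; exact: measurable_hocell|exact: measurableU].
apply: le_trans (measureU2 _ (mU _) (mU _)) _.
apply: le_trans (leeD (measureU2 _ (mQL _ _) (mQL _ _)) (measureU2 _ (mQL _ _) (mQL _ _))) _.
apply: le_trans (leeD (leeD (Qle _ _) (Qle _ _)) (leeD (Qle _ _) (Qle _ _))) _.
rewrite -!EFinD lee_fin.
have : 2 ^- j * d <= 2 * r * d by rewrite ler_wpM2r// ltW.
lra.
Qed.

End light.

Lemma Rintegral_cell (m : finmeas R) (lo hi z : R * R) :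
  lo.1 <= hi.1 -> lo.2 <= hi.2 -> 0 <= z.1 -> 0 <= z.2 ->
  \int[leb2]_x (fine (m (hocell x z)) * \1_(horect lo hi) x) = \int[m]_x trap2 lo hi z x.
Proof.
move=> h1 h2 z1 z2; rewrite /Rintegral integral_trap2//; congr fine.
rewrite [RHS]integral_mkcond; congr (integral _ _ _); apply/funext => s.
rewrite patchE indicE; case: ifPn => _; rewrite ?mulr0// mulr1 fineK//.
by rewrite fin_num_measure//; exact: measurable_hocell.
Qed.

Lemma Rintegral_indicZ (m : finmeas R) (c : R) (X : set T2) : measurable X ->
  \int[m]_x (c * \1_X x) = c * fine (m X).
Proof.
move=> mX; rewrite RintegralZl//; last exact: integrable_indic.
by rewrite /Rintegral integral_indic// setIT.
Qed.

Lemma trap2_integrable (m : finmeas R) (lo hi z : R * R) :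
  lo.1 <= hi.1 -> lo.2 <= hi.2 -> 0 <= z.1 -> 0 <= z.2 ->
  m.-integrable setT (EFin \o trap2 lo hi z).
Proof.
move=> h1 h2 z1 z2; apply: bounded_integrable.
  by apply: measurable_ucont; exact: ucont_trap2.
by exists (z.1 * z.2) => x; exact: trap2_bounded.
Qed.

(** The kernel reaches its full value z1 z2 once the rectangle is shrunk by kap on the left and from
    below. The companion [trap2_le] uses that it vanishes off the rectangle enlarged on the other
    two sides. *)
Lemma trap2_ge (m : finmeas R) (lo hi z : R * R) (kap : R) :
  lo.1 <= hi.1 -> lo.2 <= hi.2 -> 0 <= z.1 <= kap -> 0 <= z.2 <= kap ->
  z.1 * z.2 * fine (m (horect (lo.1 + kap, lo.2 + kap) hi)) <= \int[m]_x trap2 lo hi z x.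
Proof.
move=> h1 h2 /andP[z1 k1] /andP[z2 k2].
have mH := measurable_horect (lo.1 + kap, lo.2 + kap) hi.
rewrite -Rintegral_indicZ//; apply: le_Rintegral => //.
- by have := integrableZl measurableT (z.1 * z.2) (integrable_indic m mH).
- exact: trap2_integrable.
move=> x _; rewrite /trap2.
have /andP[t10 _] := trap_itv x.1 h1 z1; have /andP[t20 _] := trap_itv x.2 h2 z2.
have [[/horectP/=[/andP[l1 r1] /andP[l2 r2]] ->]|[_ ->]] := indic_or (horect (lo.1 + kap, lo.2 + kap) hi) x; last first.
  by rewrite mulr0 mulr_ge0.
have le1 : lo.1 + z.1 <= x.1 by apply: le_trans (ltW l1); rewrite lerD2l.
have le2 : lo.2 + z.2 <= x.2 by apply: le_trans (ltW l2); rewrite lerD2l.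
by rewrite (trap_full h1 z1) ?(trap_full h2 z2) ?le1 ?le2// mulr1.
Qed.

Lemma trap2_le (m : finmeas R) (lo hi z : R * R) (kap : R) :
  lo.1 <= hi.1 -> lo.2 <= hi.2 -> 0 <= z.1 <= kap -> 0 <= z.2 <= kap ->
  \int[m]_x trap2 lo hi z x <= z.1 * z.2 * fine (m (horect lo (hi.1 + kap, hi.2 + kap))).
Proof.
move=> h1 h2 /andP[z1 k1] /andP[z2 k2].
have mH := measurable_horect lo (hi.1 + kap, hi.2 + kap).
rewrite -Rintegral_indicZ//; apply: le_Rintegral => //.
- exact: trap2_integrable.
- by have := integrableZl measurableT (z.1 * z.2) (integrable_indic m mH).
move=> x _; rewrite /trap2.
have /andP[t10 t1] := trap_itv x.1 h1 z1; have /andP[t20 t2] := trap_itv x.2 h2 z2.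
have [[_ ->]|[nx ->]] := indic_or (horect lo (hi.1 + kap, hi.2 + kap)) x.
  by rewrite mulr1; exact: ler_pM.
rewrite -/(trap2 lo hi z x) trap2_out ?mulr0// => /horectP[/=/andP[l1 r1] /andP[l2 r2]].
by apply: nx; apply/horectP; rewrite /= l1 l2 (le_trans r1) ?(le_trans r2)// lerD2l.
Qed.

End cell_mass.

(** * Concentration on the set of positive density *)

Section concentration.
Context {R : realType}.
Notation T2 := (@T2 R).
Notation leb2 := (@leb2 R).

(** The main estimate with tau = s r, cell masses at most 8 s^2 r and energy at most M r^2 has error
    terms bounded by s r^2 times a constant; since r^2 <= z1 z2 / c, division by z1 z2 removes the
    scale r. *)
Lemma scale_away (r c s z1 z2 L1 L2 m n M : R) : 0 < r -> 0 < c -> 0 < s ->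
  0 < z1 <= r -> 0 < z2 <= r -> c * r ^+ 2 <= z1 * z2 -> 0 <= L1 -> 0 <= L2 -> 0 <= M ->
  z1 * z2 * m <= 4 * (s * r) * (z2 * L1 + z1 * L2) + 2 * (z1 * z2 * n) + 8 * s ^+ 2 * r / (s * r) * (M * r ^+ 2) ->
  m <= 2 * n + s * ((4 * (L1 + L2) + 8 * M) / c).
Proof.
move=> r0 c0 s0 /andP[z10 z1r] /andP[z20 z2r] crz L10 L20 M0.
have -> : 8 * s ^+ 2 * r / (s * r) = 8 * s by field; rewrite !gt_eqF.
have zz : 0 < z1 * z2 by rewrite mulr_gt0.
have hL : z2 * L1 + z1 * L2 <= r * (L1 + L2) by rewrite mulrDr lerD// ler_wpM2r.
set Q := 4 * (L1 + L2) + 8 * M.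
have Q0 : 0 <= Q by rewrite addr_ge0// mulr_ge0// addr_ge0.
have h1 : 4 * (s * r) * (z2 * L1 + z1 * L2) + 8 * s * (M * r ^+ 2) <= s * Q * r ^+ 2.
  apply: (@le_trans _ _ (4 * (s * r) * (r * (L1 + L2)) + 8 * s * (M * r ^+ 2))).
    by rewrite lerD2r ler_wpM2l// !mulr_ge0 ?ltW.
  by rewrite le_eqVlt; apply/orP; left; apply/eqP; rewrite /Q; ring.
have h2 : s * Q * r ^+ 2 <= s * Q / c * (z1 * z2).
  have rz : r ^+ 2 <= c^-1 * (z1 * z2) by rewrite ler_pdivlMl.
  by rewrite -(mulrA _ c^-1); apply: ler_wpM2l => //; rewrite mulr_ge0// ltW.
move=> h; rewrite -(ler_pM2l zz) mulrDr (_ : z1 * z2 * (s * (Q / c)) = s * Q / c * (z1 * z2)); last by ring.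
by move: h h1 h2; lra.
Qed.

Variables (th1 th2 a1 b1 a2 b2 c M : R) (u : T2 -> R) (n1 n2 : finmeas R).
Variable lam : {measure set T2 -> \bar R}.
Hypothesis th10 : 0 < th1.
Hypothesis th20 : 0 < th2.
Hypothesis th12 : th1 + th2 = 1.
Hypothesis mu : measurable_fun setT u.
Hypothesis c0 : 0 < c.
Hypothesis lam_ge : forall A, measurable A -> (n1 A <= lam A)%E.
Hypothesis scales : forall eta, 0 < eta -> exists e z,
  [/\ 0 < e < eta, cone c z, enorm z <= e &
      (energy th1 th2 (box_eps a1 b1 a2 b2 e) u z <= (M * enorm z ^+ 2)%:E)%E].
Hypothesis cells : forall (kap : R) (t lo hi : R * R), 0 < kap ->
  0 <= t.1 -> 0 <= t.2 -> t.1 <= kap -> t.2 <= kap ->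
  a1 + 2 * kap <= lo.1 -> hi.1 + t.1 <= b1 - 2 * kap ->
  a2 + 2 * kap <= lo.2 -> hi.2 + t.2 <= b2 - 2 * kap ->
  {ae leb2, forall s, horect lo hi s ->
     D2 u s t = fine (n1 (hocell s t)) - fine (n2 (hocell s t))}.

(** Only the part of n1 on the light set enters the positive jumps [DE]; the rest is nonnegative and
    is dropped from the lower bound for D2 u. The density level s^2 makes cell masses small against
    the truncation level s r. *)
Lemma light_mass_le (lo hi : R * R) (kap s : R) J : 0 < kap -> 0 < s <= 8^-1 ->
  lo.1 <= hi.1 -> lo.2 <= hi.2 ->
  a1 + 2 * kap <= lo.1 -> hi.1 + kap <= b1 - 2 * kap ->
  a2 + 2 * kap <= lo.2 -> hi.2 + kap <= b2 - 2 * kap ->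
  fine (n1 (horect (lo.1 + kap, lo.2 + kap) hi `&` light lam (s ^+ 2) J)) <=
  2 * fine (n2 (horect lo (hi.1 + kap, hi.2 + kap))) +
  s * ((4 * ((hi.1 - lo.1) + (hi.2 - lo.2)) + 8 * `|M|) / c).
Proof.
move=> k0 /andP[s0 s8] lh1 lh2 l1 r1 l2 r2.
have eta0 : 0 < Num.min kap (2 ^- J) by rewrite lt_min k0 invr_gt0 exprn_gt0.
have [e [z [/andP[e0 ee] /coneP[z1 z2 cz] ze ez]]] := scales eta0.
move: ee; rewrite lt_min => /andP[ek eJ].
have [] := enorm_ge z; rewrite (gtr0_norm z1) (gtr0_norm z2) => z1r z2r.
pose r := enorm z; have r0 : 0 < r by exact: lt_le_trans z1r.
have mL : measurable (light lam (s ^+ 2) J) by exact: measurable_light.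
have [m' [m'E _]] := restrict_finite n1 mL.
pose DE (x : T2) := fine (m' (hocell x z)).
pose Dn (x : T2) := fine (n2 (hocell x z)).
have mfc (m : finmeas R) : measurable_fun setT (fun x : T2 => fine (m (hocell x z))).
  by have := measurable_fine_cellmass z m measurableT; under eq_fun do rewrite setIT.
have s20 : 0 <= s ^+ 2 by rewrite sqr_ge0.
have DEd x : 0 <= DE x <= 8 * s ^+ 2 * r.
  rewrite fine_ge0//= /DE m'E -lee_fin fineK; last first.
    by rewrite fin_num_measure//; apply: measurableI => //; exact: measurable_hocell.
  by apply: cell_mass_le => //; apply: le_trans (ltW eJ).
have DnC x : 0 <= Dn x <= fine (n2 setT).
  rewrite fine_ge0//=; apply: le_trans (ler_norm _) _.
  by have := cellmass_bounded z n2 x measurableT; rewrite setIT.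
have z1k : z.1 <= kap by rewrite (le_trans z1r)// (le_trans ze)// ltW.
have z2k : z.2 <= kap by rewrite (le_trans z2r)// (le_trans ze)// ltW.
have hae : {ae leb2, forall x, horect lo hi x -> DE x - Dn x <= D2 u x z}.
  have := cells k0 (ltW z1) (ltW z2) z1k z2k l1 _ l2 _.
  have h1 : hi.1 + z.1 <= b1 - 2 * kap by apply: le_trans r1; rewrite lerD2l.
  have h2 : hi.2 + z.2 <= b2 - 2 * kap by apply: le_trans r2; rewrite lerD2l.
  move=> /(_ _ h1 h2); apply: filterS => x hx Vx; rewrite (hx Vx) lerD2r /DE m'E.
  have mc := measurable_hocell x z.
  rewrite fine_le ?fin_num_measure//; try exact: measurableI.
  by apply: le_measure; rewrite ?inE//; exact: measurableI.
have mW : measurable (box_eps a1 b1 a2 b2 e : set T2) by exact: measurable_box_eps.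
have VW : horect lo hi `<=` (box_eps a1 b1 a2 b2 e : set T2).
  move=> x /horectP[/andP[x1 y1] /andP[x2 y2]]; apply/box_epsP => //.
  split; apply/andP; split.
  - by apply: le_lt_trans x1; apply: le_trans l1; lra.
  - by apply: (le_lt_trans y1); lra.
  - by apply: le_lt_trans x2; apply: le_trans l2; lra.
  - by apply: (le_lt_trans y2); lra.
have EK : (energy th1 th2 (box_eps a1 b1 a2 b2 e) u z <= (`|M| * r ^+ 2)%:E)%E.
  by apply: le_trans ez _; rewrite lee_fin ler_wpM2r ?sqr_ge0// ler_norm.
(* This is where s <= 1/8 enters. *)
have dt : 8 * s ^+ 2 * r <= s * r.
  by rewrite ler_pM2r// expr2 mulrA ger_pMl//; lra.
have t0 : 0 < s * r by rewrite mulr_gt0.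
(* [tau = s |z|] exceeds the masses of the cells, which are at most [8 s^2 |z|]. *)
have := main_estimate mu z1 z2 lh1 lh2 th10 th20 th12 (mfc m') DEd dt t0 (mfc n2) DnC hae mW VW EK.
rewrite !Rintegral_cell ?(ltW z1) ?(ltW z2)// => H.
apply: (@scale_away r c s z.1 z.2); rewrite ?z1 ?z2 ?subr_ge0//.
have z1k' : 0 <= z.1 <= kap by rewrite ltW.
have z2k' : 0 <= z.2 <= kap by rewrite ltW.
have g := trap2_ge m' lh1 lh2 z1k' z2k'.
rewrite m'E in g; apply: (le_trans g); apply: (le_trans H).
by rewrite lerD2r lerD2l ler_pM2l// trap2_le.
Qed.

Definition dens_set : set T2 := \bigcup_n upper_dens lam (rr n).

Lemma measurable_dens_set : measurable dens_set.
Proof. by apply: bigcup_measurable => n _; exact: measurable_upper_dens. Qed.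

Lemma dens_set_light (d : R) : 0 < d -> ~` dens_set `<=` \bigcup_J light lam d J.
Proof.
move=> d0 x nx; apply: bigcup_light => dx; apply: nx.
have [n h] := rr_small d0.
exists n => // J; have [j Jj hj] := dx J; exists j => //.
apply: le_lt_trans hj; by rewrite lee_fin ler_wpM2l// ltW.
Qed.

(** J tends to infinity at fixed s, by continuity from below, and then s tends to 0; the scale z no
    longer occurs in the estimate. *)
Lemma off_dens_mass_le (lo hi : R * R) (kap : R) : 0 < kap ->
  lo.1 <= hi.1 -> lo.2 <= hi.2 ->
  a1 + 2 * kap <= lo.1 -> hi.1 + kap <= b1 - 2 * kap ->
  a2 + 2 * kap <= lo.2 -> hi.2 + kap <= b2 - 2 * kap ->
  (n1 (horect (lo.1 + kap, lo.2 + kap)%R hi `&` ~` dens_set) <=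
   n2 (horect lo (hi.1 + kap, hi.2 + kap)%R) + n2 (horect lo (hi.1 + kap, hi.2 + kap)%R))%E.
Proof.
move=> k0 lh1 lh2 l1 r1 l2 r2.
set X := horect (lo.1 + kap, lo.2 + kap) hi; set Y := horect lo _.
have mX : measurable X by exact: measurable_horect.
have mY : measurable Y by exact: measurable_horect.
have mD : measurable (~` dens_set) by apply: measurableC; exact: measurable_dens_set.
set Q := (4 * ((hi.1 - lo.1) + (hi.2 - lo.2)) + 8 * `|M|) / c.
have Q0 : 0 <= Q by rewrite divr_ge0 ?(ltW c0)// addr_ge0// mulr_ge0// addr_ge0// subr_ge0.
have key s : 0 < s <= 8^-1 -> fine (n1 (X `&` ~` dens_set)) <= 2 * fine (n2 Y) + s * Q.
  move=> s08; have s20 : 0 < s ^+ 2 by rewrite exprn_gt0//; case/andP: s08.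
  pose F J := X `&` light lam (s ^+ 2) J.
  have mF J : measurable (F J) by apply: measurableI => //; exact: measurable_light.
  have mU : measurable (\bigcup_J F J) by exact: bigcup_measurable.
  rewrite -lee_fin fineK; last by rewrite fin_num_measure//; exact: measurableI.
  apply: (@le_trans _ _ (n1 (\bigcup_J F J))).
    apply: le_measure; rewrite ?inE//; first exact: measurableI.
    by rewrite -setI_bigcupr; apply: setIS; exact: dens_set_light.
  have nd : {homo F : n m / (n <= m)%N >-> (n <= m)%O}.
    by move=> n m nm; apply/subsetPset; apply: setIS; exact: light_le.
  have cv := nondecreasing_cvg_mu (mu := n1) mF mU nd.
  apply: (lee_cvg_to cv (cvg_cst _)); apply: nearW => J /=.
  rewrite -[leLHS]fineK ?fin_num_measure// lee_fin; exact: light_mass_le.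
have f1 : n1 (X `&` ~` dens_set) \is a fin_num by rewrite fin_num_measure//; exact: measurableI.
have f2 : n2 Y \is a fin_num by rewrite fin_num_measure.
rewrite -(fineK f1) -(fineK f2).
rewrite -EFinD lee_fin; apply/ler_addgt0Pr => e e0.
(* The first bound is the range of [light_mass_le]; the second makes the error s Q at most e. *)
pose s := Num.min 8^-1 (e / (Q + 1)).
have Q1 : 0 < Q + 1 by rewrite ltr_wpDl.
have s0 : 0 < s by rewrite lt_min invr_gt0 ltr0n/= divr_gt0.
have s8 : s <= 8^-1 by rewrite ge_min lexx.
have sQ : s * Q <= e.
  apply: (@le_trans _ _ (s * (Q + 1))); first by rewrite ler_pM2l// lerDl.
  by rewrite -ler_pdivlMr// ge_min lexx orbT.
have := key s; rewrite s0 s8 => /(_ isT); lra.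
Qed.

(** As kap tends to 0, the inner rectangles increase to the given one, which is open on the left,
    and the outer ones decrease to it, since it is closed on the right. *)
Lemma off_dens_horect_le (lo hi : R * R) : a1 < lo.1 -> hi.1 < b1 -> a2 < lo.2 -> hi.2 < b2 ->
  (n1 (horect lo hi `&` ~` dens_set) <= n2 (horect lo hi) + n2 (horect lo hi))%E.
Proof.
move=> l1 r1 l2 r2.
have [[lh1 lh2]|nlh] := pselect (lo.1 <= hi.1 /\ lo.2 <= hi.2); last first.
  by rewrite horect_empty// set0I !measure0 adde0.
have mD : measurable (~` dens_set) by apply: measurableC; exact: measurable_dens_set.
pose F k := horect (lo.1 + rr k, lo.2 + rr k) hi `&` ~` dens_set.
pose G k := horect lo (hi.1 + rr k, hi.2 + rr k).
have mF k : measurable (F k) by apply: measurableI => //; exact: measurable_horect.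
have mG k : measurable (G k) by exact: measurable_horect.
have FU : \bigcup_k F k = horect lo hi `&` ~` dens_set.
  rewrite -setI_bigcupl; congr (_ `&` _); apply/seteqP; split => x.
    move=> [k _ /horectP/=[/andP[h1 h2] /andP[h3 h4]]]; have := @rr_gt0 R k => ?.
    by apply/horectP; rewrite h2 h4; split; apply/andP; split => //; lra.
  move=> /horectP[/andP[h1 h2] /andP[h3 h4]].
  have d0 : 0 < Num.min (x.1 - lo.1) (x.2 - lo.2) by rewrite lt_min !subr_gt0 h1.
  have [k] := rr_small d0; rewrite lt_min => /andP[? ?]; exists k => //.
  by apply/horectP; rewrite /= h2 h4; split; apply/andP; split => //; lra.
have GI : \bigcap_k G k = horect lo hi.
  apply/seteqP; split => x.
    move=> H; have le (p q : R) : (forall k, p <= q + rr k) -> p <= q.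
      move=> h; rewrite leNgt; apply/negP; rewrite -subr_gt0 => pq; have [k hk] := rr_small pq.
      by have := h k; lra.
    have [/= /andP[h1 _] /andP[h2 _]] := (horectP _ _ _).1 (H 0%N I).
    apply/horectP; rewrite h1 h2 /=; split; apply: le => k;
    by have [/= /andP[_ ?] /andP[_ ?]] := (horectP _ _ _).1 (H k I).
  move=> /horectP[/andP[h1 h2] /andP[h3 h4]] k _; have := @rr_gt0 R k => ?.
  by apply/horectP; rewrite /= h1 h3; split; apply/andP; split => //; lra.
have ndF : {homo F : n m / (n <= m)%N >-> (n <= m)%O}.
  move=> n m nm; apply/subsetPset; apply: setSI => x /horectP/=[/andP[h1 h2] /andP[h3 h4]].
  by have := @rr_le R _ _ nm => ?; apply/horectP; rewrite /= h2 h4; split; apply/andP; split => //; lra.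
have niG : {homo G : n m / (n <= m)%N >-> (m <= n)%O}.
  move=> n m nm; apply/subsetPset => x /horectP/=[/andP[h1 h2] /andP[h3 h4]].
  by have := @rr_le R _ _ nm => ?; apply/horectP; rewrite /= h1 h3; split; apply/andP; split => //; lra.
have cF := nondecreasing_cvg_mu (mu := n1) mF (bigcup_measurable (fun k _ => mF k)) ndF.
have cG := nonincreasing_cvg_mu (mu := n2) (finite_lty n2 (mG 0%N)) mG (bigcapT_measurable mG) niG.
rewrite FU in cF; rewrite GI in cG.
have mH := measurable_horect lo hi.
have cGG : (fun k => n2 (G k) + n2 (G k))%E @ \oo --> (n2 (horect lo hi) + n2 (horect lo hi))%E.
  by apply: cvgeD => //; rewrite fin_num_adde_defl// fin_num_measure.
apply: (lee_cvg_to cF cGG).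
(* The upper margin is 3 kap: kap for the enlarged rectangle and 2 kap for the cut-off. *)
have d0 : 0 < Num.min (Num.min (lo.1 - a1) (b1 - hi.1)) (Num.min (lo.2 - a2) (b2 - hi.2)) / 3.
  by rewrite divr_gt0// !lt_min !subr_gt0 l1 r1 l2 r2.
apply: filterS (rr_near d0) => k.
rewrite ltr_pdivlMr// !lt_min => /andP[/andP[? ?] /andP[? ?]].
have := @rr_gt0 R k => ?.
by apply: off_dens_mass_le => //; lra.
Qed.

Notation Om := (box a1 b1 a2 b2 : set T2).

(** The inequality on rectangles extends to n1 <= 2 n2 off the density set for all Borel subsets of
    the box. On P the right side vanishes, and off P there is no mass of n1. *)
Lemma off_dens_null (P : set T2) : measurable P -> n1 (~` P) = 0%E -> n2 P = 0%E ->
  n1 (Om `&` ~` dens_set) = 0%E.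
Proof.
move=> mP n1P n2P.
have mD : measurable (~` dens_set) by apply: measurableC; exact: measurable_dens_set.
have mbox : measurable Om by exact: measurableX.
have [a [aE _]] := restrict_finite n1 mD.
have [|b bE] := @finite_measure_of _ _ _ (measure_add n2 n2).
  apply: (@le_lt_trans _ _ (n2 setT + n2 setT)%E); first by rewrite le_eqVlt; apply/orP; left; apply/eqP; exact: measure_addE.
  by rewrite lte_add_pinfty// finite_lty.
have {}bE A : b A = (n2 A + n2 A)%E by rewrite bE; exact: measure_addE.
have mB : measurable (Om `&` P) by exact: measurableI.
have H : (a (Om `&` P) <= b (Om `&` P))%E.
  apply: (@measure_le_horect _ a b a1 b1 a2 b2) => //.
  by move=> lo hi ? ? ? ?; rewrite aE bE; exact: off_dens_horect_le.
have sub0 (m : finmeas R) (A B : set T2) : measurable A -> measurable B ->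
    A `<=` B -> m B = 0%E -> m A = 0%E.
  move=> mA mB' AB mB0; apply/eqP; rewrite eq_le measure_ge0 andbT -mB0.
  by apply: le_measure; rewrite ?inE.
have b0 : b (Om `&` P) = 0%E.
  by rewrite bE (sub0 n2 _ P)// ?adde0//; exact: subIsetr.
rewrite b0 aE in H.
have mBP : measurable (Om `&` P `&` ~` dens_set) by exact: measurableI.
have mBC : measurable (Om `&` ~` P `&` ~` dens_set).
  by apply: measurableI => //; apply: measurableI => //; exact: measurableC.
apply/eqP; rewrite eq_le measure_ge0 andbT.
apply: (@le_trans _ _ (n1 (Om `&` P `&` ~` dens_set) +
  n1 (Om `&` ~` P `&` ~` dens_set))%E).
  apply: le_trans (measureU2 _ mBP mBC).
  apply: le_measure; rewrite ?inE//; try exact: measurableI; try exact: measurableU.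
  by move=> x [bx dx]; have [Px|nPx] := pselect (P x); [left|right].
rewrite [X in (_ + X)%E](sub0 n1 _ (~` P)) ?adde0//; first exact: measurableC.
by move=> x [[_ ?] _].
Qed.

End concentration.

(** * Zero extension of the function and sigma-finiteness of the density set *)

Section reduction.
Context {R : realType}.
Notation T2 := (@T2 R).
Notation leb2 := (@leb2 R).

(** For |z| <= e and x in [box_eps] all values that occur are taken inside the box, where v agrees
    with u; for |z| > e the weight [rho_eps] vanishes. Global measurability of v then becomes
    available. *)
Lemma Eeps_energy (th1 th2 : R) (rho : R * R -> R) (a1 b1 a2 b2 e : R) (u v : R * R -> R) :
  (forall z, 0 <= rho z) -> (forall z, 1 < enorm z -> rho z = 0) ->
  measurable_fun setT (v : T2 -> R) -> (forall x, box a1 b1 a2 b2 x -> v x = u x) -> 0 < e ->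
  Eeps th1 th2 rho a1 b1 a2 b2 u e =
  (\int[leb2]_z (energy th1 th2 (box_eps a1 b1 a2 b2 e) v z *
      ((enorm z) ^- 2 * rho_eps rho e z)%R%:E))%E.
Proof.
move=> rho0 rho_supp mv vu e0; rewrite /Eeps; congr (integral _ _ _); apply/funext => z.
have := @rho_eps_supp _ _ rho_supp e z e0; move: (rho_eps rho e z) => r r0.
set I := (X in (X * _)%E = _); set En := energy th1 th2 _ v z.
have [ze|/r0 ->] := leP (enorm z) e; last by rewrite mulr0 !mule0.
rewrite (EFinM _ r) muleA; congr (_ * _)%E.
have nz : 0 <= enorm z ^- 2 by rewrite invr_ge0 sqr_ge0.
rewrite muleC /En /I /energy -ge0_integralZl//; last 2 first.
- exact: measurable_box_eps.
- by apply/measurable_EFinP; apply: measurable_funTS; exact: measurable_Du_pow_x.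
apply: eq_integral => x; rewrite inE => /(box_epsP _ _ _ _ _ e0)[/andP[h1 h2] /andP[h3 h4]].
have [] := enorm_ge z; rewrite !ler_norml => /andP[z1 z1'] /andP[z2 z2'].
have ev (y : R * R) : `|y.1 - x.1| <= e -> `|y.2 - x.2| <= e -> v y = u y.
  rewrite !ler_norml => /andP[? ?] /andP[? ?]; apply: vu; apply/boxP; split; apply/andP; split; lra.
have n0 : `|0 : R| <= e by rewrite normr0 ltW.
have nz1 : `|z.1| <= e by rewrite ler_norml; apply/andP; split; lra.
have nz2 : `|z.2| <= e by rewrite ler_norml; apply/andP; split; lra.
rewrite -EFinM mulrA /Du1 /Du2 !ev//= ?subrr//; by rewrite addrAC subrr add0r.
Qed.

Lemma Eliminf_bound (th1 th2 : R) (rho : R * R -> R) (a1 b1 a2 b2 : R) (u : R * R -> R) :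
  (Eliminf th1 th2 rho a1 b1 a2 b2 u < +oo)%E ->
  exists Cb : R, forall d, 0 < d -> exists2 e, 0 < e < d & (Eeps th1 th2 rho a1 b1 a2 b2 u e < Cb%:E)%E.
Proof.
move=> Efin.
have [Cb hCb] : exists Cb : R, (Eliminf th1 th2 rho a1 b1 a2 b2 u < Cb%:E)%E.
  move: Efin; case: (Eliminf _ _ _ _ _ _ _ _) => [r _||_] //.
    by exists (r + 1); rewrite lte_fin ltrDl.
  (* The value -oo, for which any real bound works. *)
  by exists 0; exact: ltNyr.
exists Cb => d d0.
have [] := @ereal_inf_lt _ [set Eeps th1 th2 rho a1 b1 a2 b2 u eps | eps in [set e : R | 0 < e < d]] Cb%:E.
  by apply: le_lt_trans hCb; apply: ereal_sup_ubound; exists d.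
by move=> _ [e ed <-] h; exists e.
Qed.

Lemma compact_crect (a1 b1 a2 b2 k : R) : compact (crect a1 b1 a2 b2 k : set (R * R)).
Proof. by apply: compact_setX; exact: segment_compact. Qed.

Lemma integrable_trunc (a1 b1 a2 b2 kap : R) (u v : R * R -> R) : 0 < kap ->
  (forall x, box a1 b1 a2 b2 x -> v x = u x) -> L1loc (box a1 b1 a2 b2) u ->
  leb2.-integrable setT (EFin \o (trunc_u a1 b1 a2 b2 v kap : T2 -> R)).
Proof.
move=> k0 vu [_ H].
have sub : crect a1 b1 a2 b2 kap `<=` box a1 b1 a2 b2 by move=> x; exact: crect_box.
have := H _ (@compact_crect a1 b1 a2 b2 kap) sub.
move/(integrable_mkcond _ (measurable_crect _ _ _ _ _)); apply: eq_integrable => // x _.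
rewrite patchE /= /trunc_u indicE; case: ifPn => h; rewrite ?mul1r ?mul0r//.
by rewrite vu//; apply: sub; rewrite inE in h.
Qed.

Lemma energy_opp (th1 th2 : R) V (u : R * R -> R) z :
  energy th1 th2 V (fun x => - u x) z = energy th1 th2 V u z.
Proof.
rewrite /energy; congr (integral _ _ _); apply/funext => x.
by rewrite /Du1 /Du2 -!opprD !normrN.
Qed.

Lemma D2_opp (u : R * R -> R) x z : D2 (fun x => - u x) x z = - D2 u x z.
Proof. by rewrite /D2; ring. Qed.

(** Piece 0 is the complement of the density set and meets the given set in nothing; every other
    piece has finite [H1] by the covering argument. *)
Lemma H1_dens_set (lam : {measure set T2 -> \bar R}) (X : set T2) : (lam setT < +oo)%E ->
  H1_restr_sigma_finite (X `&` dens_set lam).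
Proof.
move=> lam_fin.
exists (fun k => if k is n.+1 then upper_dens lam (rr n) else ~` dens_set lam); split.
- by case=> [|n]; [apply: measurableC; exact: measurable_dens_set|exact: measurable_upper_dens].
- apply/seteqP; split => // x _; have [[n _ h]|h] := pselect (dens_set lam x); first by exists n.+1.
  by exists 0%N.
case=> [|n].
  by rewrite -setIA setICr setI0; exact: H1_set0.
by apply: (H1_upper_dens lam_fin (rr_gt0 n)) => x [].
Qed.

End reduction.

Theorem theorem1p7 (R : realType) (th1 th2 : R) (rho : R * R -> R)
  (a1 b1 a2 b2 : R) (u : R * R -> R) :
  0 < th1 -> 0 < th2 -> th1 + th2 = 1 ->
  (* rho : nonnegative, integrable, radial, supported in B_1, of mass 1 *)
  (forall z, 0 <= rho z) ->
  (@leb2 R).-integrable [set: T2] (EFin \o (rho : T2 -> R)) ->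
  (forall z w, enorm z = enorm w -> rho z = rho w) ->
  (forall z, 1 < enorm z -> rho z = 0) ->
  (\int[@leb2 R]_(z in [set: T2]) (rho z)%:E = 1)%E ->
  (* bounded open box *)
  a1 < b1 -> a2 < b2 ->
  L1loc (box a1 b1 a2 b2) u ->
  (Eliminf th1 th2 rho a1 b1 a2 b2 u < +oo)%E ->
  exists mu1 mu2 : {finite_measure set T2 -> \bar R},
    [/\ mu1 (~` (box a1 b1 a2 b2 : set T2)) = 0%E,
        mu2 (~` (box a1 b1 a2 b2 : set T2)) = 0%E,
        (* mu[u] = d1 d2 u = mu1 - mu2 in the sense of distributions *)
        (forall phi, test_fun (box a1 b1 a2 b2) phi ->
           (\int[@leb2 R]_(x in (box a1 b1 a2 b2 : set T2)) (u x * d12 phi x)%:E =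
            \int[mu1]_(x in [set: T2]) (phi x)%:E -
            \int[mu2]_(x in [set: T2]) (phi x)%:E)%E) &
        exists A : set T2,
          [/\ measurable A, A `<=` (box a1 b1 a2 b2 : set T2),
              H1_restr_sigma_finite (A : set (R * R)) &
              forall B : set T2, measurable B ->
                (mu1 B - mu2 B = mu1 (B `&` A) - mu2 (B `&` A))%E]].
Proof.
move=> th10 th20 th12 rho0 int_rho rho_radial rho_supp rho1 ab1 ab2 Lu Efin.
have mbox : measurable (box a1 b1 a2 b2 : set (Defs.T2)) by exact: measurableX.
(* The zero extension is measurable on the whole plane. *)
pose v : @T2 R -> R := (u : @T2 R -> R) \_ (box a1 b1 a2 b2 : set T2).
have mv : measurable_fun setT v by apply/(measurable_restrictT _ mbox); case: Lu.
have vu x : box a1 b1 a2 b2 x -> v x = u x by move=> bx; rewrite /v patchE mem_set.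
have int_trunc kap : 0 < kap -> (@leb2 R).-integrable setT (EFin \o trunc_u a1 b1 a2 b2 v kap).
  by move=> k0; exact: (integrable_trunc k0 vu Lu).
have [Cb hCb] := Eliminf_bound Efin.
have [|c [M [c0 scales]]] := @good_scales R rho rho0 int_rho rho_radial rho_supp rho1
    th1 th2 a1 b1 a2 b2 Cb v mv.
  move=> d d0; have [e ed h] := hCb d d0; exists e => //.
  by rewrite -(@Eeps_energy R th1 th2 rho a1 b1 a2 b2 e u v)//; case/andP: ed.
(* Scales below 1 / (k + 1) are fixed to produce and identify the limit measures; the concentration
   argument draws on [scales] anew. *)
have [ez hez] : {ez : nat -> R * @T2 R & forall k,
    [/\ 0 < (ez k).1 < rr k, cone c (ez k).2, enorm (ez k).2 <= (ez k).1 &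
     forall s, (energy th1 th2 (box_eps a1 b1 a2 b2 (ez k).1) v (flip s (ez k).2) <= (M * enorm (ez k).2 ^+ 2)%:E)%E]}.
  apply: (@choice _ _ (fun (k : nat) (p : R * @T2 R) => [/\ 0 < p.1 < rr k, cone c p.2, enorm p.2 <= p.1 &
     forall s, (energy th1 th2 (box_eps a1 b1 a2 b2 p.1) v (flip s p.2) <= (M * enorm p.2 ^+ 2)%:E)%E])) => k.
  by have [e [z h]] := scales _ (rr_gt0 k); exists (e, z).
pose e k := (ez k).1; pose z k := (ez k).2.
have e_gt0 k : 0 < e k by have [/andP[]] := hez k.
have e_cvg : e @ \oo --> 0.
  apply/cvgrPdist_lt => d d0; apply: filterS (rr_near d0) => k hk.
  rewrite sub0r normrN gtr0_norm//; apply: lt_trans hk; by have [/andP[]] := hez k.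
have z1_gt0 k : 0 < (z k).1 by have [_ /coneP[]] := hez k.
have z2_gt0 k : 0 < (z k).2 by have [_ /coneP[]] := hez k.
have ze k : enorm (z k) <= e k by have [] := hez k.
have good k : good_pair a1 b1 a2 b2 th1 th2 v c M (e k) (z k).
  by have [/andP[? _] ? ? ?] := hez k; split.
(* One ultrafilter makes the masses of all cells converge at once, without extracting
   subsequences. *)
have [U [UU Uoo]] := @ultraFilterLemma nat \oo _.
have dsupp k x : ~ box a1 b1 a2 b2 x -> dens a1 b1 a2 b2 v (e k) (z k) x = 0.
  move=> nbx; rewrite /dens indicE memNset ?mul0r// => bx; apply: nbx.
  have e20 : 0 < 2 * e k by rewrite mulr_gt0.
  move: bx => /(box_epsP _ _ _ _ _ e20)[/andP[? ?] /andP[? ?]].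
  by apply/boxP; split; apply/andP; split; lra.
have [m1 [m2 [m1off m2off Hm]]] := limit_measures ab1 ab2 UU
  (fun k => dens_integrable th10 th20 th12 mv c0 (good k))
  (fun k => dens_bound th10 th20 th12 mv c0 (good k)) dsupp.
(* The weak limits of the positive and negative parts may overlap; the density argument needs a set
   P that carries n1 and is null for n2. *)
have [n1 [n2 [P [mP n1P n2P nm mn]]]] := singular_pair m1 m2.
have mboxC : measurable (~` (box a1 b1 a2 b2 : set (@T2 R))) by exact: measurableC.
have n1off : n1 (~` (box a1 b1 a2 b2 : set T2)) = 0%E.
  by apply/eqP; rewrite eq_le measure_ge0 andbT -m1off; exact: (nm _ mboxC).1.
have n2off : n2 (~` (box a1 b1 a2 b2 : set T2)) = 0%E.
  by apply/eqP; rewrite eq_le measure_ge0 andbT -m2off; exact: (nm _ mboxC).2.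
have {}Hm phi : ucont phi -> (exists B, forall p, `|phi p| <= B) ->
    (forall x, ~ box a1 b1 a2 b2 x -> phi x = 0) ->
    (fun k => \int[@leb2 R]_x (phi x * dens a1 b1 a2 b2 v (e k) (z k) x)) @ U -->
    \int[n1]_x phi x - \int[n2]_x phi x.
  move=> uphi bphi phi0; rewrite -(Rintegral_transfer mn (measurable_ucont uphi) bphi).
  exact: Hm.
pose lam : {measure set (@T2 R) -> \bar R} := measure_add n1 n2.
have lamE A : lam A = (n1 A + n2 A)%E by exact: measure_addE.
have lam_fin : (lam setT < +oo)%E by rewrite lamE lte_add_pinfty// finite_lty.
have cells (kap : R) (t lo hi : R * R) : 0 < kap ->
    0 <= t.1 -> 0 <= t.2 -> t.1 <= kap -> t.2 <= kap ->
    a1 + 2 * kap <= lo.1 -> hi.1 + t.1 <= b1 - 2 * kap ->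
    a2 + 2 * kap <= lo.2 -> hi.2 + t.2 <= b2 - 2 * kap ->
    {ae @leb2 R, forall s, horect lo hi s ->
       D2 v s t = fine (n1 (hocell s t)) - fine (n2 (hocell s t))}.
  move=> k0 t1 t2 tk1 tk2 l1 r1 l2 r2.
  exact: (cell_ae int_trunc e_gt0 e_cvg z1_gt0 z2_gt0 ze UU Uoo Hm k0 t1 t2 l1 r1 l2 r2 tk1 tk2).
have flip0 (w : R * R) : flip (false, false) w = w by case: w => ? ?; rewrite /flip/= !expr0 !mul1r.
have N1 : n1 ((box a1 b1 a2 b2 : set T2) `&` ~` dens_set lam) = 0%E.
  apply: (@off_dens_null R th1 th2 a1 b1 a2 b2 c M v n1 n2 lam) mP n1P n2P => //.
  - by move=> A _; rewrite lamE leeDl.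
  - move=> eta eta0; have [e' [z' [? ? ? h]]] := scales eta eta0; exists e', z'; split => //.
    by have := h (false, false); rewrite flip0.
(* Passing to -u exchanges n1 and n2, and P with its complement, while the energy is unchanged. *)
have N2 : n2 ((box a1 b1 a2 b2 : set T2) `&` ~` dens_set lam) = 0%E.
  apply: (@off_dens_null R th1 th2 a1 b1 a2 b2 c M (fun x => - v x) n2 n1 lam) (measurableC mP) _ n1P => //.
  - exact: measurableT_comp.
  - by move=> A _; rewrite lamE leeDr.
  - move=> eta eta0; have [e' [z' [? ? ? h]]] := scales eta eta0; exists e', z'; split => //.
    by have := h (false, false); rewrite flip0 energy_opp.
  - move=> kap t lo hi k0 t1 t2 tk1 tk2 l1 r1 l2 r2.
    apply: filterS (cells kap t lo hi k0 t1 t2 tk1 tk2 l1 r1 l2 r2) => s hs Vs.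
    by rewrite D2_opp (hs Vs) opprB.
  - by rewrite setCK.
exists n1, n2; split => //.
  move=> phi tphi; rewrite -(test_identity ab1 ab2 int_trunc e_gt0 e_cvg z1_gt0 z2_gt0 ze UU Uoo Hm tphi).
  by apply: eq_integral => x; rewrite inE => bx; rewrite vu.
have mD := measurable_dens_set lam.
exists ((box a1 b1 a2 b2 : set T2) `&` dens_set lam); split.
- exact: measurableI.
- by move=> x [].
- exact: H1_dens_set.
move=> B mB.
set A := _ `&` dens_set lam; have mA : measurable A by exact: measurableI.
(* What B has outside A lies off the box or in the null part of the box. *)
have key (n : {finite_measure set (@T2 R) -> \bar R}) :
    n (~` (box a1 b1 a2 b2 : set T2)) = 0%E ->
    n ((box a1 b1 a2 b2 : set T2) `&` ~` dens_set lam) = 0%E -> n B = n (B `&` A).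
  move=> h1 h2; apply/eqP; rewrite eq_le; apply/andP; split; last first.
    by apply: le_measure; rewrite ?inE//; exact: measurableI.
  have mN : measurable ((box a1 b1 a2 b2 : set T2) `&` ~` dens_set lam).
    by apply: measurableI => //; exact: measurableC.
  have mBA : measurable (B `&` A) by exact: measurableI.
  have mBN := measurableU _ _ mboxC mN.
  apply: (@le_trans _ _ (n ((B `&` A) `|` (~` (box a1 b1 a2 b2 : set T2) `|` ((box a1 b1 a2 b2 : set T2) `&` ~` dens_set lam))))).
    apply: le_measure; rewrite ?inE//; first exact: measurableU.
    move=> x Bx; have [bx|nbx] := pselect (box a1 b1 a2 b2 x); last by right; left.
    by have [dx|ndx] := pselect (dens_set lam x); [left|right; right].
  apply: le_trans (measureU2 _ mBA mBN) _.
  apply: le_trans (leeD (lexx _) (measureU2 _ mboxC mN)) _.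
  have h1' : (n (~` (box a1 b1 a2 b2 : set T2)) <= 0)%E by rewrite h1.
  have h2' : (n ((box a1 b1 a2 b2 : set T2) `&` ~` dens_set lam) <= 0)%E by rewrite h2.
  by apply: le_trans (leeD (lexx _) (leeD h1' h2')) _; rewrite !adde0.
by rewrite (key n1 n1off N1) (key n2 n2off N2).
Qed.
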